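(* Let $1<p<3$, let $q,s$ satisfy $$\max\left\{1,\frac{3p}{5p-3}\right\}<q<3,\qquad \max\left\{1,\frac{(q^*-1)p}{q^*}\right\}<s<\frac{(q^*-1)p^*}{q^*},$$ where $p^*=\frac{3p}{3-p}$ and $q^*=\frac{3q}{3-q}$, and let $p<r<p^*$ and $\lambda>0$. For $u\in W^{1,p}(\mathbb{R}^3)$ let $\phi_u\in D^{1,q}(\mathbb{R}^3)$ be the unique solution of $-\Delta_q\phi=|u|^s$, and define $$\mathcal{J}(u)=\frac1p\int_{\mathbb{R}^3}\left(|\nabla u|^p+|u|^p\right)dx+\frac{\lambda(q-1)}{qs}\int_{\mathbb{R}^3}\phi_u|u|^s\,dx-\frac1r\int_{\mathbb{R}^3}|u|^r\,dx.$$ Then $\mathcal{J}\in C^1(W^{1,p}(\mathbb{R}^3),\mathbb{R})$ and for all $u,v\in W^{1,p}(\mathbb{R}^3)$, $$\mathcal{J}'(u)[v]=\int_{\mathbb{R}^3}\left(|\nabla u|^{p-2}\nabla u\cdot\nabla v+|u|^{p-2}uv\right)dx+\lambda\int_{\mathbb{R}^3}\phi_u|u|^{s-2}uv\,dx-\int_{\mathbb{R}^3}|u|^{r-2}uv\,dx.$$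
   Context: All functions are real-valued. $\Delta_q\phi=\operatorname{div}(|\nabla\phi|^{q-2}\nabla\phi)$. $W^{1,p}(\mathbb{R}^3)$ has the norm $\|u\|=\left(\int_{\mathbb{R}^3}(|\nabla u|^p+|u|^p)\,dx\right)^{1/p}$. $D^{1,q}(\mathbb{R}^3)$ is the completion of $C_0^\infty(\mathbb{R}^3)$ with respect to the norm $\|u\|_{D^{1,q}}=\left(\int_{\mathbb{R}^3}|\nabla u|^q\,dx\right)^{1/q}$; by the Sobolev inequality it is regarded as a space of functions in $L^{q^*}(\mathbb{R}^3)$. The equation $-\Delta_q\phi=|u|^s$ is understood weakly: $\int_{\mathbb{R}^3}|\nabla\phi|^{q-2}\nabla\phi\cdot\nabla w\,dx=\int_{\mathbb{R}^3}|u|^sw\,dx$ for all $w\in D^{1,q}(\mathbb{R}^3)$; under the stated conditions on $p,q,s$ it has exactly one solution $\phi_u\in D^{1,q}(\mathbb{R}^3)$ for each $u\in W^{1,p}(\mathbb{R}^3)$. Expressions such as $|u|^{s-2}u$ or $|\nabla u|^{p-2}\nabla u$ are understood as $0$ where $u=0$, respectively $\nabla u=0$. $C^1$ means continuously Fréchet differentiable. *)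

(* Defs.v *)
From HB Require Import structures.
From mathcomp Require Import all_boot all_order all_algebra.
From mathcomp Require Import all_classical all_reals all_analysis.
Set Implicit Arguments.
Unset Strict Implicit.
Unset Printing Implicit Defensive.
Import Order.TTheory GRing.Theory Num.Theory.
Import numFieldNormedType.Exports.
Local Open Scope classical_set_scope.
Local Open Scope ring_scope.

Notation R3 R := (R * R * R)%type.

(* Measurability on R^3 is Borel measurability.  This loses nothing: every
   Lebesgue measurable function is almost everywhere equal to a Borel one. *)
Notation leb3 R :=
  ((@lebesgue_measure R \x @lebesgue_measure R) \x @lebesgue_measure R)%E.

Section EuclideanGradient.
Context {R : realType}.

(* The norm `|a| of the library on 'rV[R]_3 is the max norm, not the Euclidean
   one. *)
Definition edot (a b : 'rV[R]_3) : R := \sum_(i < 3) a 0 i * b 0 i.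
Definition enorm (a : 'rV[R]_3) : R := Num.sqrt (edot a a).

Definition e3 (i : 'I_3) : R3 R :=
  ((i == 0 :> nat)%:R, (i == 1 :> nat)%:R, (i == 2 :> nat)%:R).

Definition partial (i : 'I_3) (f : R3 R -> R) : R3 R -> R :=
  fun x => 'D_(e3 i) f x.

Definition grad (f : R3 R -> R) (x : R3 R) : 'rV[R]_3 := \row_i partial i f x.

(* Partial derivatives of all orders exist and are continuous; l lists the
   directions of differentiation. *)
Definition smooth (f : R3 R -> R) : Prop := forall l : seq 'I_3,
  continuous (foldr partial f l) /\
  forall i x, derivable (foldr partial f l) x (e3 i).

Definition test_function (f : R3 R -> R) : Prop :=
  smooth f /\ compact (closure [set x | f x != 0]).

End EuclideanGradient.

Section SobolevSpaces.
Context {R : realType}.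
Implicit Types (u v w phi : R3 R -> R) (p q s : R).

Definition locally_integrable3 u : Prop :=
  measurable_fun setT (u : _ -> measurableTypeR R) /\
  forall K : set (R3 R), compact K -> (leb3 R).-integrable K (EFin \o u).

Definition weak_gradient u (G : R3 R -> 'rV[R]_3) : Prop :=
  [/\ locally_integrable3 u,
      forall i, locally_integrable3 (fun x => G x 0 i) &
      forall psi, test_function psi -> forall i,
        \int[leb3 R]_x (u x * partial i psi x) =
        - \int[leb3 R]_x (G x 0 i * psi x)].

Definition weakly_differentiable u : Prop := exists G, weak_gradient u G.

(* A weak gradient is only determined almost everywhere; wgrad u is a chosen
   representative. *)
Definition wgrad u : R3 R -> 'rV[R]_3 := xget (fun=> 0) (weak_gradient u).

(* Elements of W^{1,p}(R^3) and D^{1,q}(R^3) are represented by functions, not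
   by classes of almost everywhere equal functions; normW1p is accordingly a
   seminorm on W1p, whose kernel consists of the functions vanishing almost
   everywhere. *)
Definition W1p p u : Prop :=
  [/\ u \in Lfun (leb3 R) p%:E, weakly_differentiable u &
      enorm \o wgrad u \in Lfun (leb3 R) p%:E].

Definition normW1p p u : R :=
  (\int[leb3 R]_x (enorm (wgrad u x) `^ p + `|u x| `^ p)) `^ p^-1.

Definition sobolev_exp p : R := 3 * p / (3 - p).

(* By the Sobolev inequality a sequence of test functions whose gradients are
   Cauchy in L^q converges in L^{q^*}; the limits are the elements of the
   completion, seen as functions. *)
Definition D1q q phi : Prop :=
  [/\ phi \in Lfun (leb3 R) (sobolev_exp q)%:E, weakly_differentiable phi &
      exists psi : nat -> R3 R -> R,
        [/\ forall n, test_function (psi n),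
            Lnorm (leb3 R) q%:E
              (fun x => (enorm (grad (psi n) x - wgrad phi x))%:E)
              @[n --> \oo] --> 0%E &
            Lnorm (leb3 R) (sobolev_exp q)%:E
              (fun x => (psi n x - phi x)%:E) @[n --> \oo] --> 0%E]].

(* -Delta_q phi = |u|^s in R^3 *)
Definition weak_solution q s u phi : Prop :=
  D1q q phi /\
  forall w, D1q q w ->
    \int[leb3 R]_x (enorm (wgrad phi x) `^ (q - 2)
                    * edot (wgrad phi x) (wgrad w x)) =
    \int[leb3 R]_x (`|u x| `^ s * w x).

End SobolevSpaces.

(* Frechet calculus on a vector space W of functions with a seminorm N.  The
   library's differentiable asks for a normedModType, whereas L^p-type spaces
   are not available as such; the conditions below are those of the library's
   notion.  They pass to the quotient of W by the kernel of N: a functional with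
   a Frechet derivative at u takes the same value at u and u + h if N h = 0. *)
Section FrechetC1.
Context {R : realType} {T : Type}.
Variables (W : set (T -> R)) (N : (T -> R) -> R).
Implicit Types (J L : (T -> R) -> R) (u v w h : T -> R).

Definition frechet_derivative J u L : Prop :=
  [/\ forall a v w, W v -> W w ->
        L (fun x => a * v x + w x) = a * L v + L w,
      exists C, forall v, W v -> `|L v| <= C * N v &
      forall eps, 0 < eps -> exists2 delta, 0 < delta &
        forall h, W h -> N h < delta ->
          `|J (fun x => u x + h x) - J u - L h| <= eps * N h].

Definition C1_on J : Prop := exists dJ : (T -> R) -> (T -> R) -> R,
  (forall u, W u -> frechet_derivative J u (dJ u)) /\
  forall u, W u -> forall eps, 0 < eps -> exists2 delta, 0 < delta &
    forall w, W w -> N (fun x => w x - u x) < delta ->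
      forall v, W v -> `|dJ w v - dJ u v| <= eps * N v.

End FrechetC1.

(* Main.v *)
(** The local terms of J are of the form A |-> int |A|^t on L^t vector fields.
    Convexity of the power gives
      0 <= |A + H|^t - |A|^t - t V(A).H <= t (V(A + H) - V(A)).H,
    V(A) = |A|^(t-2) A, so they are C^1 because A |-> V(A) is continuous from
    L^t to L^(t/(t-1)).

    For the nonlocal term put E(f) = (q-1)/q int phi_f f, where phi_f solves
    -Delta_q phi = f.  As E(f) is the maximum of int f w - 1/q int |grad w|^q,
      int phi_f (g - f) <= E(g) - E(f) <= int phi_g (g - f),
    and f |-> phi_f is continuous into L^{q^*} by the strong monotonicity of V
    and the Sobolev inequality.  Hence E is C^1 with derivative phi_f on the
    dual of L^{q^*}, and u |-> |u|^s is differentiable from L^m to this dual,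
    with p < m = s q^*/(q^* - 1) < p^*.

    The embeddings follow Gagliardo and Nirenberg.  By Fubini's theorem and the
    fundamental lemma of the calculus of variations, a weakly differentiable u
    is absolutely continuous on almost every line parallel to an axis, whence
    |u|^gam is bounded there by gam int |u|^(gam-1) |grad u|, and the
    Loomis-Whitney inequality bounds int |u|^(3 gam/2).  For D^{1,q} this is
    applied to test functions with gam = 2q/(3-q).  For W^{1,p} it is iterated
    from gam = 1 + p/p', which yields integrability exponents converging to
    p^*; this avoids the density of test functions in W^{1,p}. *)

(* Two obstacles shape the proof. For exponents below 2, V is not Lipschitz and its monotonicity is
   not bounded below by a power of |a - b|. Both properties are therefore stated with a small
   parameter eta: |V(b) - V(a)| <= eta |a|^(s-1) + C |b - a|^(s-1), and |a - b|^t <= eta (|a|^t +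
   |b|^t) + C (V(a) - V(b)).(a - b). These hold for every exponent above 1, and they become
   continuity statements in Lebesgue spaces by fixing eta first and delta afterwards, with no
   passage to subsequences. Secondly, f |-> phi_f is only shown to be continuous. This is enough:
   the two bounds enclosing E(g) - E(f) differ by the pairing of phi_g - phi_f with g - f, which is
   o(|g - f|). The iteration for W^{1,p} never reaches p^* itself; the strict upper bounds on s and
   r leave the room for this. Since [wgrad] picks a representative for each function separately,
   gradients are linear only almost everywhere, and so are all the linear maps considered. *)
Require Import Defs.
From HB Require Import structures.
From mathcomp Require Import all_boot all_order all_algebra.
From mathcomp Require Import all_classical all_reals all_analysis.
From mathcomp Require Import measurable_realfun ring lra.
Set Implicit Arguments.
Unset Strict Implicit.
Unset Printing Implicit Defensive.
Import Order.TTheory GRing.Theory Num.Theory.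
Import numFieldNormedType.Exports.
Local Open Scope classical_set_scope.
Local Open Scope ring_scope.

(** * Powers of real numbers and of vectors *)

Section RealPowers.
Context {R : realType}.
Implicit Types (x y t a b : R).

(** Young's inequality for the factors [x] and 1 with exponents [t] and [t / (t - 1)], multiplied by
    [t]. At [t = 1], where the conjugate exponent degenerates, there is equality. *)
Lemma powR_bernoulli x t : 0 <= x -> 1 <= t -> 1 + t * (x - 1) <= x `^ t.
Proof.
move=> x0; rewrite le_eqVlt => /predU1P[<-|t1]; first by rewrite powRr1//; lra.
have t0 : 0 < t by lra.
have := @conjugate_powR R x 1 t (t / (t - 1)) x0 ler01.
rewrite powR1 mulr1 => /(_ t0 _ _) H.
have {}H : x <= x `^ t / t + 1 / (t / (t - 1)).
  apply: H; first by rewrite divr_gt0//; lra.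
  by field; apply/andP; split; lra.
have E : t * x <= t * (x `^ t / t + 1 / (t / (t - 1))) by rewrite ler_pM2l.
have E2 : t * (x `^ t / t + 1 / (t / (t - 1))) = x `^ t + (t - 1).
  by field; apply/andP; split; lra.
by rewrite E2 in E; lra.
Qed.

(** The convex case for the exponent 1/t at the point x^t. *)
Lemma powR_bernoulli_le1 x t : 0 <= x -> 0 < t <= 1 -> x `^ t <= 1 + t * (x - 1).
Proof.
move=> x0 /andP[t0 t1].
have ti : 1 <= t^-1 by rewrite invf_ge1.
have := powR_bernoulli (powR_ge0 x t) ti.
rewrite -powRrM mulfV ?gt_eqF// powRr1// => H.
have : t * (1 + t^-1 * (x `^ t - 1)) <= t * x by rewrite ler_pM2l.
have -> : t * (1 + t^-1 * (x `^ t - 1)) = t + (x `^ t - 1) by field; lra.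
by lra.
Qed.

Lemma ler_powRl t a b : 0 <= t -> 0 <= a -> a <= b -> a `^ t <= b `^ t.
Proof.
move=> t0 a0 ab; apply: (ge0_ler_powR t0) => //; rewrite nnegrE//.
exact: le_trans ab.
Qed.

Lemma ler_powRl_neg t a b : t <= 0 -> 0 < a -> a <= b -> b `^ t <= a `^ t.
Proof.
move=> t0 a0 ab; rewrite -(opprK t) 2!(powRN _ (- t)) lef_pV2 ?posrE ?powR_gt0//.
  by apply: ler_powRl; [lra|exact: ltW|].
exact: lt_le_trans ab.
Qed.

(** The power 0^0 is 1, so at [a = 0], [t = 2] the identity rests on the factor [a ^+ 2]. *)
Lemma powR_split t a : 1 < t -> 0 <= a -> a `^ t = a `^ (t - 2) * a ^+ 2.
Proof.
move=> t1; rewrite le_eqVlt => /predU1P[<-|a0].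
  by rewrite powR0 ?expr0n ?mulr0//; apply/eqP; lra.
rewrite -(powR_mulrn 2 (ltW a0)) -powRD; first by congr powR; lra.
by rewrite (gt_eqF a0) implybT.
Qed.

Lemma powR_split1 t a : 1 < t -> 0 <= a -> a `^ (t - 1) = a `^ (t - 2) * a.
Proof.
move=> t1; rewrite le_eqVlt => /predU1P[<-|a0].
  by rewrite powR0 ?mulr0//; apply/eqP; lra.
rewrite -{3}(powRr1 (ltW a0)) -powRD; first by congr powR; lra.
by rewrite (gt_eqF a0) implybT.
Qed.

(** Bernoulli's inequality at [b / a], multiplied by a^t. *)
Lemma powR_tangent t a b : 1 <= t -> 0 < a -> 0 <= b ->
  a `^ t + t * a `^ (t - 1) * (b - a) <= b `^ t.
Proof.
move=> t1 a0 b0.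
have H := powR_bernoulli (divr_ge0 b0 (ltW a0)) t1.
have -> : b = (b / a) * a by rewrite divfK// gt_eqF.
rewrite powRM ?divr_ge0 ?(ltW a0)//.
have at0 : 0 < a `^ t by exact: powR_gt0.
have E : a `^ t = a `^ (t - 1) * a.
  rewrite mulrC mulr_powRB1 ?ltW//; lra.
have := ler_wpM2r (ltW at0) H; apply: le_trans.
rewrite E le_eqVlt; apply/orP; left; apply/eqP; ring.
Qed.

Lemma powR_tangent_le1 t a b : 0 < t <= 1 -> 0 < a -> 0 <= b ->
  t * a `^ (t - 1) * (a - b) <= a `^ t - b `^ t.
Proof.
move=> t1 a0 b0.
have H := powR_bernoulli_le1 (divr_ge0 b0 (ltW a0)) t1.
have -> : b = (b / a) * a by rewrite divfK// gt_eqF.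
rewrite powRM ?divr_ge0 ?(ltW a0)//.
have at0 : 0 < a `^ t by exact: powR_gt0.
have E : a `^ t = a `^ (t - 1) * a.
  by rewrite mulrC mulr_powRB1 ?ltW//; case/andP: t1.
have := ler_wpM2r (ltW at0) H; rewrite -subr_ge0 => {}H.
rewrite -subr_ge0; apply: le_trans H _.
rewrite E le_eqVlt; apply/orP; left; apply/eqP; ring.
Qed.

Lemma powR_add_le t a b : 0 <= t -> 0 <= a -> 0 <= b ->
  (a + b) `^ t <= (2 * a) `^ t + (2 * b) `^ t.
Proof.
move=> t0 a0 b0; have [ab|ba] := leP a b.
  apply: (@le_trans _ _ ((2 * b) `^ t)); last by rewrite lerDr powR_ge0.
  by apply: ler_powRl => //; lra.
apply: (@le_trans _ _ ((2 * a) `^ t)); last by rewrite lerDl powR_ge0.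
by apply: ler_powRl => //; lra.
Qed.

Lemma powR_near1 t (eta : R) : 0 < eta -> exists2 delta, 0 < delta <= 2^-1 &
  forall x, `|x - 1| < delta -> `|x `^ t - 1| < eta.
Proof.
move=> eta0.
have : {for (1:R), continuous (fun x : R => x `^ t)}.
  apply: differentiable_continuous; apply/derivable1_diffP.
  by apply: derivable_powR; rewrite in_itv/= andbT.
move=> /cvgrPdist_lt /(_ _ eta0) /nbhs_ballP[d /= d0 H].
exists (Num.min d 2^-1); first by rewrite lt_min d0 ge_min lexx orbT andbT; lra.
move=> x; rewrite lt_min => /andP[xd _].
by rewrite distrC; have := H x; rewrite /ball/= powR1 => /(_ _); apply; rewrite distrC.
Qed.

End RealPowers.

(** * The map V on vectors: convexity, monotonicity and continuity *)

Section Vectors.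
Context {R : realType}.
Implicit Types (a b c h : 'rV[R]_3) (t s q k eta : R).

Lemma edotC a b : edot a b = edot b a.
Proof. by apply: eq_bigr => i _; rewrite mulrC. Qed.

Lemma edotDl a b c : edot (a + b) c = edot a c + edot b c.
Proof. by rewrite -big_split; apply: eq_bigr => i _; rewrite mxE mulrDl. Qed.

Lemma edotZl k a b : edot (k *: a) b = k * edot a b.
Proof. by rewrite mulr_sumr; apply: eq_bigr => i _; rewrite mxE mulrA. Qed.

Lemma edotNl a b : edot (- a) b = - edot a b.
Proof. by rewrite -scaleN1r edotZl mulN1r. Qed.

Lemma edotBl a b c : edot (a - b) c = edot a c - edot b c.
Proof. by rewrite edotDl edotNl. Qed.

Lemma edotDr a b c : edot c (a + b) = edot c a + edot c b.
Proof. by rewrite edotC edotDl !(edotC c). Qed.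

Lemma edotZr k a b : edot a (k *: b) = k * edot a b.
Proof. by rewrite edotC edotZl edotC. Qed.

Lemma edotBr a b c : edot c (a - b) = edot c a - edot c b.
Proof. by rewrite edotC edotBl !(edotC c). Qed.

Lemma edot_ge0 a : 0 <= edot a a.
Proof. by apply: sumr_ge0 => i _; rewrite -expr2 sqr_ge0. Qed.

Lemma enorm_ge0 a : 0 <= enorm a. Proof. exact: sqrtr_ge0. Qed.
Hint Resolve enorm_ge0 : core.

Lemma enorm_sqr a : enorm a ^+ 2 = edot a a.
Proof. by rewrite sqr_sqrtr ?edot_ge0. Qed.

Lemma enorm0 : enorm (0 : 'rV[R]_3) = 0.
Proof. by rewrite /enorm /edot big1 ?sqrtr0// => i _; rewrite !mxE mulr0. Qed.

Lemma enorm0_eq0 a : enorm a = 0 -> a = 0.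
Proof.
move=> a0; have : edot a a = 0 by rewrite -enorm_sqr a0 expr0n.
move/eqP; rewrite psumr_eq0 => [/allP H|i _]; last by rewrite -expr2 sqr_ge0.
apply/rowP => i; rewrite mxE.
by have := H i (mem_index_enum _); rewrite /= mulf_eq0 orbb => /eqP.
Qed.

Lemma enormZ k a : enorm (k *: a) = `|k| * enorm a.
Proof.
by rewrite /enorm edotZl edotZr mulrA -expr2 sqrtrM ?sqr_ge0// sqrtr_sqr.
Qed.

Lemma enormN a : enorm (- a) = enorm a.
Proof. by rewrite -scaleN1r enormZ normrN1 mul1r. Qed.

Lemma enormB a b : enorm (a - b) = enorm (b - a).
Proof. by rewrite -enormN opprB. Qed.

Lemma edot_norm_le a b : `|edot a b| <= enorm a * enorm b.
Proof.
rewrite -(@ler_pXn2r _ 2)// ?nnegrE ?mulr_ge0//.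
rewrite exprMn !enorm_sqr -normrX ger0_norm ?sqr_ge0//.
(* The square of this vector is |b|^2 (|a|^2 |b|^2 - (a.b)^2), from which |b|^2 is cancelled. *)
have := edot_ge0 (edot b b *: a - edot a b *: b).
rewrite !(edotBl, edotBr, edotZl, edotZr) (edotC b a).
have [b0|b0] := eqVneq (edot b b) 0.
  have -> : b = 0 by apply: enorm0_eq0; rewrite /enorm b0 sqrtr0.
  by rewrite -(scale0r (0 : 'rV[R]_3)) !edotZr !mul0r mulr0 expr0n.
have {}b0 : 0 < edot b b by rewrite lt0r b0 edot_ge0.
move=> H; rewrite -(ler_pM2l b0); lra.
Qed.

Lemma edot_le a b : edot a b <= enorm a * enorm b.
Proof. exact: le_trans (ler_norm _) (edot_norm_le a b). Qed.

Lemma enormD a b : enorm (a + b) <= enorm a + enorm b.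
Proof.
rewrite -(@ler_pXn2r _ 2)// ?nnegrE ?addr_ge0//.
rewrite sqrrD !enorm_sqr edotDl !edotDr (edotC b a).
by have := edot_le a b; lra.
Qed.

Lemma enormB_le a b : enorm (a - b) <= enorm a + enorm b.
Proof. by rewrite -(enormN b); exact: enormD. Qed.

Lemma abs_coord_le a i : `|a 0 i| <= enorm a.
Proof.
rewrite -(@ler_pXn2r _ 2)// ?nnegrE// enorm_sqr -normrX ger0_norm ?sqr_ge0//.
rewrite /edot (bigD1 i)//= -expr2 lerDl sumr_ge0// => j _.
by rewrite -expr2 sqr_ge0.
Qed.

(** The gradient of |a|^t / t. At [a = 0] it is 0 whatever [powR] gives for the scalar factor, which
    is the convention of the theorem. *)
Definition vpow t a : 'rV[R]_3 := enorm a `^ (t - 2) *: a.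

Lemma enorm_vpow t a : 1 < t -> enorm (vpow t a) = enorm a `^ (t - 1).
Proof. by move=> t1; rewrite enormZ ger0_norm ?powR_ge0// powR_split1. Qed.

Lemma edot_vpow t a : 1 < t -> edot (vpow t a) a = enorm a `^ t.
Proof. by move=> t1; rewrite /vpow edotZl -enorm_sqr -powR_split. Qed.

(** By the Cauchy-Schwarz inequality a.(b - a) <= |a| (|b| - |a|), which leaves the scalar tangent
    inequality at |a|. *)
Lemma vpow_convex t a b : 1 < t ->
  enorm a `^ t + t * edot (vpow t a) (b - a) <= enorm b `^ t.
Proof.
move=> t1; have [a0|a0] := eqVneq (enorm a) 0.
  rewrite /vpow (enorm0_eq0 a0) scaler0 -(scale0r 0) edotZl mul0r mulr0 scale0r.
  by rewrite enorm0 addr0 powR0 ?powR_ge0//; apply/eqP; lra.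
have {}a0 : 0 < enorm a by rewrite lt0r a0/=.
apply: le_trans (powR_tangent (ltW t1) a0 (enorm_ge0 b)).
rewrite lerD2l -mulrA ler_pM2l; last by lra.
rewrite edotZl powR_split1// -mulrA ler_wpM2l ?powR_ge0//.
by rewrite edotBr -enorm_sqr; have := edot_le a b; nra.
Qed.

(** The weight is taken at the longer vector, which gives one form for all [t > 1]. The constant 1/2
    serves [t >= 2], and [t - 1] serves [t < 2]. *)
Lemma vpow_mono_max t : 1 < t -> exists2 k : R, 0 < k & forall a b,
  enorm b <= enorm a -> k * enorm a `^ (t - 2) * enorm (a - b) ^+ 2
     <= edot (vpow t a - vpow t b) (a - b).
Proof.
move=> t1; exists (Num.min (2^-1) (t - 1)); first by rewrite lt_min; lra.
move=> a b ba.
have [a0|a0] := eqVneq (enorm a) 0.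
  have b0 : b = 0 by apply: enorm0_eq0; apply/eqP; rewrite eq_le -{1}a0 ba/=.
  rewrite (enorm0_eq0 a0) b0 subrr enorm0 expr0n mulr0.
  by rewrite -(scale0r (0 : 'rV[R]_3)) edotZr mul0r.
have {}a0 : 0 < enorm a by rewrite lt0r a0/=.
rewrite enorm_sqr !(edotBl, edotBr, edotZl) (edotC b a) -!enorm_sqr.
have := edot_norm_le a b; rewrite ler_norml => /andP[].
set f := enorm a `^ _; set g := enorm b `^ _.
have f0 : 0 <= f by exact: powR_ge0.
have g0 : 0 <= g by exact: powR_ge0.
have D0 : 0 <= edot (a - b) (a - b) by exact: edot_ge0.
move: D0; rewrite !(edotBl, edotBr) (edotC b a) -!enorm_sqr.
move: (enorm_ge0 b) ba a0 (edot a b).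
(* With f = |a|^(t-2) and g = |b|^(t-2), twice the right side is (f + g) |a - b|^2 + (f - g)(|a|^2 -
   |b|^2); for [t >= 2] the last product is nonnegative. *)
have [t2|t2] := leP 2 t.
  have : 0 <= enorm b -> enorm b <= enorm a -> g <= f.
    by move=> *; apply: ler_powRl => //; lra.
  move: (enorm a) (enorm b) => al be fg be0 ab al0 c D0 _ cle.
  have {}fg := fg be0 ab.
  apply: (@le_trans _ _ (2^-1 * f * (al ^+ 2 - c - (c - be ^+ 2)))).
    by rewrite ler_wpM2r// ler_wpM2r// ge_min lexx.
  have H1 : 0 <= (f - g) * (al ^+ 2 - be ^+ 2) by rewrite mulr_ge0//; nra.
  have H2 : 0 <= g * (al ^+ 2 - c - (c - be ^+ 2)) by rewrite mulr_ge0.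
  lra.
(* For [t < 2] the right side is (f|a| - g|b|)(|a| - |b|) + (f + g)(|a||b| - a.b), to be compared
   with |a - b|^2 = (|a| - |b|)^2 + 2(|a||b| - a.b). The first product is bounded below by concavity
   of the power t - 1, the second by f <= g. *)
have K : 0 < enorm a -> (t - 1) * f * (enorm a - enorm b) <= f * enorm a - g * enorm b.
  move=> a0; rewrite -!powR_split1//.
  rewrite /f (_ : t - 2 = (t - 1) - 1); last by ring.
  by apply: powR_tangent_le1 => //; lra.
have fg : 0 < enorm b -> enorm b <= enorm a -> f <= g.
  by move=> *; apply: ler_powRl_neg => //; lra.
move: (enorm a) (enorm b) K fg => al be K fg be0 ab al0 c D0 lec cle.
have {}K := K al0.
apply: (@le_trans _ _ ((t - 1) * f * (al ^+ 2 - c - (c - be ^+ 2)))).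
  by rewrite ler_wpM2r// ler_wpM2r// ge_min lexx orbT.
have H1 := ler_wpM2r (_ : 0 <= al - be) K.
have {}H1 := H1 ltac:(lra).
have H2 : 0 <= ((f + g) - 2 * (t - 1) * f) * (al * be - c).
  (* The value of 0^(t-2) is 0 rather than infinite, so f <= g can fail at b = 0; there the second
     factor vanishes. *)
  have [be00|be00] := eqVneq be 0.
    rewrite be00 mulr0 sub0r.
    have ce : c = 0 by move: lec cle; rewrite be00 mulr0; lra.
    by rewrite ce oppr0 mulr0.
  have {}fg : f <= g by apply: fg => //; rewrite lt0r be00.
  by rewrite mulr_ge0//; nra.
nra.
Qed.

(** If |a - b| <= d |a| with d^t = eta, the first term suffices. Otherwise d |a| < |a - b| <= 2 |a|,
    hence |a - b|^(t-2) <= K |a|^(t-2), where the 2 in [K] is for [t >= 2] and the [d] for [t < 2],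
    and [vpow_mono_max] applies. This is for the longer vector [a]; the other case follows by
    symmetry. *)
Lemma vpow_coercive t eta : 1 < t -> 0 < eta -> exists2 C : R, 0 <= C &
  forall a b, enorm (a - b) `^ t <= eta * (enorm a `^ t + enorm b `^ t)
     + C * edot (vpow t a - vpow t b) (a - b).
Proof.
move=> t1 eta0; have [k k0 kP] := vpow_mono_max t1.
set d := eta `^ t^-1.
have t0 : t != 0 by apply/eqP; lra.
have d0 : 0 < d by exact: powR_gt0.
have dt : d `^ t = eta by rewrite -powRrM mulVf// powRr1// ltW.
set K := 2 `^ (t - 2) + d `^ (t - 2).
have K0 : 0 <= K by rewrite addr_ge0 ?powR_ge0.
exists (K / k); first by rewrite divr_ge0// ltW.
have main a b : enorm b <= enorm a ->
    enorm (a - b) `^ t <= eta * (enorm a `^ t + enorm b `^ t)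
     + K / k * edot (vpow t a - vpow t b) (a - b).
  move=> ba; have kab := kP a b ba.
  have mon0 : 0 <= edot (vpow t a - vpow t b) (a - b).
    by apply: le_trans kab; rewrite !mulr_ge0 ?powR_ge0 ?sqr_ge0 ?(ltW k0).
  have [dle|dgt] := leP (enorm (a - b)) (d * enorm a).
    apply: (@le_trans _ _ (eta * enorm a `^ t)).
      rewrite -dt -powRM ?(ltW d0)//; apply: ler_powRl => //; lra.
    rewrite mulrDr -addrA lerDl addr_ge0 ?mulr_ge0 ?powR_ge0 ?(ltW eta0)//.
    by rewrite invr_ge0 ltW.
  have Dd : enorm (a - b) <= 2 * enorm a by have := enormB_le a b; lra.
  apply: (@le_trans _ _ (K / k * edot (vpow t a - vpow t b) (a - b))); last first.
    by rewrite lerDr mulr_ge0 ?addr_ge0 ?powR_ge0// ltW.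
  have : K / k * (k * enorm a `^ (t - 2) * enorm (a - b) ^+ 2) <=
         K / k * edot (vpow t a - vpow t b) (a - b).
    by rewrite ler_wpM2l// divr_ge0// ltW.
  apply: le_trans.
  have -> : K / k * (k * enorm a `^ (t - 2) * enorm (a - b) ^+ 2) =
      K * enorm a `^ (t - 2) * enorm (a - b) ^+ 2.
    by rewrite !mulrA divfK// gt_eqF.
  rewrite powR_split// ler_wpM2r ?sqr_ge0//.
  have a0 : 0 <= enorm a by [].
  have da0 : 0 <= d * enorm a by rewrite mulr_ge0// ltW.
  have [t2|t2] := leP 2 t.
    apply: (@le_trans _ _ ((2 * enorm a) `^ (t - 2))).
      by apply: ler_powRl => //; lra.
    by rewrite powRM// ler_wpM2r ?powR_ge0// lerDl powR_ge0.
  have [aa0|aa0] := eqVneq (enorm a) 0.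
    by move: dgt Dd; rewrite aa0 !mulr0; lra.
  have {}aa0 : 0 < enorm a by rewrite lt0r aa0/=.
  apply: (@le_trans _ _ ((d * enorm a) `^ (t - 2))).
    by apply: ler_powRl_neg; [lra|exact: mulr_gt0|exact: ltW].
  by rewrite powRM ?(ltW d0)// ler_wpM2r ?powR_ge0// lerDr powR_ge0.
move=> a b; have [ba|/ltW ab] := leP (enorm b) (enorm a); first exact: main.
have := main b a ab; rewrite enormB (addrC (enorm b `^ t)).
by rewrite -(opprB a b) -(opprB (vpow t a)) edotNl edotC edotNl opprK edotC.
Qed.

(** If |b - a| >= d |a|, both vectors are at most multiples of |b - a| and the last term suffices.
    Otherwise |b| / |a| is so close to 1 that V changes by at most eta |a|^(s-1). *)
Lemma vpow_continuity s eta : 1 < s -> 0 < eta -> exists2 C : R, 0 <= C &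
  forall a b, enorm (vpow s b - vpow s a) <=
     eta * enorm a `^ (s - 1) + C * enorm (b - a) `^ (s - 1).
Proof.
move=> s1 eta0.
have [d1 /andP[d10 d1h] d1P] := @powR_near1 R (s - 2) (Num.min 1 (eta / 2))
  ltac:(by rewrite lt_min divr_gt0 ?ltr01).
set d := Num.min d1 (eta / 4).
have d0 : 0 < d by rewrite lt_min d10 divr_gt0.
have dd1 : d <= d1 by rewrite ge_min lexx.
have deta : d <= eta / 4 by rewrite ge_min lexx orbT.
exists ((1 + d^-1) `^ (s - 1) + (d^-1) `^ (s - 1)).
  by rewrite addr_ge0 ?powR_ge0.
move=> a b.
have [dge|dlt] := leP (d * enorm a) (enorm (b - a)).
  have s10 : 0 <= s - 1 by lra.
  have aD : enorm a <= d^-1 * enorm (b - a) by rewrite ler_pdivlMl.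
  have bD : enorm b <= (1 + d^-1) * enorm (b - a).
    by have := enormD (b - a) a; rewrite subrK; lra.
  apply: (@le_trans _ _ (enorm b `^ (s - 1) + enorm a `^ (s - 1))).
    by rewrite -!enorm_vpow//; exact: enormB_le.
  apply: ler_wpDl; first by rewrite mulr_ge0 ?powR_ge0// ltW.
  have di0 : 0 <= d^-1 by rewrite invr_ge0 ltW.
  rewrite mulrDl -!powRM ?addr_ge0//.
  by apply: lerD; apply: ler_powRl.
have a0 : 0 < enorm a.
  rewrite lt0r enorm_ge0 andbT; apply/eqP => a0.
  by move: dlt; rewrite a0 mulr0 ltNge enorm_ge0.
apply: ler_wpDr; first by rewrite mulr_ge0 ?addr_ge0 ?powR_ge0.
set x := enorm b / enorm a.
have x1 : `|x - 1| < d1.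
  have -> : x - 1 = (enorm b - enorm a) / enorm a.
    by rewrite /x mulrBl divff// gt_eqF.
  rewrite normrM normfV (ger0_norm (ltW a0)) ltr_pdivrMr//.
  apply: (@le_lt_trans _ _ (enorm (b - a))).
    rewrite ler_norml; apply/andP; split.
      by have := enormD (a - b) b; rewrite subrK (enormB a); lra.
    by have := enormD (b - a) a; rewrite subrK; lra.
  by apply: lt_le_trans dlt _; rewrite ler_pM2r.
have := d1P x x1; rewrite lt_min => /andP[x2 x3].
have bE : enorm b = x * enorm a by rewrite divfK// gt_eqF.
have x0 : 0 <= x by rewrite divr_ge0.
(* One summand has the increment of the vector, the other that of the weight; [d] and [d1] keep each
   below half of eta |a|^(s-1). *)
have -> : vpow s b - vpow s a =
    enorm b `^ (s - 2) *: (b - a) + (enorm b `^ (s - 2) - enorm a `^ (s - 2)) *: a.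
  rewrite /vpow scalerBr scalerBl addrA subrK //.
apply: le_trans (enormD _ _) _; rewrite !enormZ.
rewrite (ger0_norm (powR_ge0 _ _)) bE powRM//.
set X := x `^ (s - 2) in x2 x3 *; set f := enorm a `^ (s - 2).
have f0 : 0 <= f by exact: powR_ge0.
have -> : X * f - f = (X - 1) * f by ring.
rewrite powR_split1// -/f normrM (ger0_norm f0).
have X2 : X <= 2 by move: x2; rewrite ltr_norml => /andP[_]; lra.
have X0 : 0 <= X by exact: powR_ge0.
have H1 : X * enorm (b - a) <= 2 * (eta / 4 * enorm a).
  apply: ler_pM => //; apply: le_trans (ltW dlt) _.
  by rewrite ler_pM2r.
have H2 : `|X - 1| * enorm a <= eta / 2 * enorm a by rewrite ler_pM2r// ltW.
have H3 := ler_wpM2r f0 H1.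
have H4 := ler_wpM2r f0 H2.
lra.
Qed.

End Vectors.
#[global] Hint Resolve enorm_ge0 : core.

(** * Smooth functions *)

Section Smooth.
Context {R : realType}.
Implicit Types (f g : R3 R -> R) (i j : 'I_3).

Definition crd i (x : R3 R) : R :=
  if i == 0 :> nat then x.1.1 else if i == 1 :> nat then x.1.2 else x.2.

Lemma crd_shift i j (h : R) (x : R3 R) : crd i (h *: e3 j + x) = (i == j)%:R * h + crd i x.
Proof.
by case: i => [[|[|[|//]]] ?]; case: j => [[|[|[|//]]] ?];
  rewrite /crd/= /GRing.scale/= ?mulr1 ?mulr0 ?mul1r ?mul0r.
Qed.

Lemma crdP (x y : R3 R) : (forall i, crd i x = crd i y) -> x = y.
Proof.
case: x => [[x1 x2] x3]; case: y => [[y1 y2] y3] H.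
move: (H (@Ordinal 3 0 isT)) (H (@Ordinal 3 1 isT)) (H (@Ordinal 3 2 isT)).
by rewrite /crd/= => -> -> ->.
Qed.

Lemma crdD i (x y : R3 R) : crd i (x + y) = crd i x + crd i y.
Proof. by rewrite /crd; case: ifP => //; case: ifP. Qed.

Lemma continuous_crd i : continuous (crd i).
Proof.
case: i => [[|[|[|//]]] ?]; rewrite /crd/=.
- by move=> x; apply: (@continuous_comp _ _ _ fst fst); exact: cvg_fst.
- move=> x; apply: (@continuous_comp _ _ _ fst snd); [exact: cvg_fst|exact: cvg_snd].
- by move=> x; exact: cvg_snd.
Qed.

(** Both difference quotients are the same function of [h], so derivatives transfer between
    different spaces. This serves functions of one coordinate, translates, and restrictions to
    lines. *)
Lemma is_derive_along (V V' : normedModType R) (F : V -> R) (f : V' -> R)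
    (x v : V) (y w : V') (d : R) :
  (forall h : R, F (h *: v + x) = f (h *: w + y)) ->
  is_derive y w f d -> is_derive x v F d.
Proof.
move=> Ff [fd fd'].
have F0 : F x = f y by have := Ff 0; rewrite !scale0r !add0r.
have E : (fun h : R => h^-1 *: ((F \o shift x) (h *: v) - F x)) =
    (fun h : R => h^-1 *: ((f \o shift y) (h *: w) - f y)).
  by apply/funext => h /=; rewrite Ff F0.
apply: DeriveDef; first by rewrite /derivable E.
by rewrite -fd' /derive E.
Qed.

Lemma is_derive_crd (f : R -> R) df i j (x : R3 R) :
  is_derive (crd i x) 1 f df ->
  is_derive x (e3 j) (f \o crd i) ((i == j)%:R * df).
Proof.
move=> fd; have [ij|ij] := eqVneq i j.
  rewrite mul1r; apply: is_derive_along fd => h /=.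
  by rewrite crd_shift ij eqxx mul1r /GRing.scale/= mulr1.
rewrite mul0r; apply: (@is_derive_along _ _ _ (cst (f (crd i x))) x _ 0 (1:R)).
by move=> h /=; rewrite crd_shift (negbTE ij) mul0r add0r.
Qed.

(** Coinduction for smoothness: a class of functions stable under [partial] settles all iterated
    derivatives without a formula for any of them. *)
Lemma smooth_coind (S : set (R3 R -> R)) :
  (forall f, S f -> continuous f /\ forall i, S (partial i f) /\
    forall x, derivable f x (e3 i)) -> S `<=` smooth.
Proof.
move=> HS f Sf l; have {Sf} : S (foldr partial f l).
  by elim: l => [//|i l IH] /=; exact: ((HS _ IH).2 i).1.
by move=> /HS[cf df]; split => // i; exact: (df i).2.
Qed.

Lemma smooth_partial f i : smooth f -> smooth (partial i f).
Proof. by move=> sf l; have := sf (rcons l i); rewrite foldr_rcons. Qed.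

Lemma smooth_continuous f : smooth f -> continuous f.
Proof. by move=> /(_ [::])[]. Qed.

Lemma smooth_derivable f i x : smooth f -> derivable f x (e3 i).
Proof. by move=> /(_ [::])[_]. Qed.

(* x^-k exp(-1/x) on the positive half-line: the derivatives of exp(-1/x) are
   linear combinations of these. *)
Definition flat (k : nat) (x : R) : R := if 0 < x then x^-1 ^+ k * expR (- x^-1) else 0.

Lemma flat_ge0 k x : 0 <= flat k x.
Proof.
rewrite /flat; case: ifPn => // x0.
by rewrite mulr_ge0 ?expR_ge0// exprn_ge0// invr_ge0 ltW.
Qed.

(** From exp y >= y^(k+2) / (k+2)! at y = 1/x. The two powers beyond [k] leave x^2, hence a zero
    derivative at the origin. *)
Lemma flat_le k x : flat k x <= (k.+2)`!%:R * x ^+ 2.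
Proof.
rewrite /flat; case: ifPn => x0; last by rewrite mulr_ge0 ?sqr_ge0.
have y0 : 0 < x^-1 by rewrite invr_gt0.
have := expR_ge1Dxn k.+1 (ltW y0); set y := x^-1 in y0 *.
have xE : x = y^-1 by rewrite invrK.
set F : R := (k.+2)`!%:R.
have F0 : 0 < F by rewrite ltr0n fact_gt0.
move=> H; have {}H : y ^+ k.+2 <= F * expR y.
  have H2 : y ^+ k.+2 / F <= expR y by apply: le_trans H; rewrite lerDr.
  by rewrite mulrC -ler_pdivrMr.
rewrite expRN xE ler_pdivrMr ?expR_gt0//.
rewrite mulrAC (exprVn y 2) ler_pdivlMr ?exprn_gt0//.
by rewrite -exprD addn2.
Qed.

Lemma is_derive_flat k (x : R) :
  is_derive x (1 : R) (flat k) (flat k.+2 x - k%:R * flat k.+1 x).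
Proof.
have [x0|x0|<-] := ltgtP 0 x.
- have Hd : is_derive x 1 (fun z : R => z^-1 ^+ k * expR (- z^-1))
      (flat k.+2 x - k%:R * flat k.+1 x).
    have xn0 : x != 0 by rewrite gt_eqF.
    have H1 : is_derive x 1 (fun z : R => z^-1) (- x ^- 2 *: 1).
      exact: (@is_deriveV R id x 1 1).
    have := @is_deriveX _ _ (fun z : R => z^-1) k x 1 _ H1.
    rewrite exprfctE => H2.
    have H3 : is_derive x 1 (fun z : R => - z^-1) (- (- x ^- 2 *: 1)).
      exact: is_deriveN.
    have H4 := @is_derive1_comp R expR (fun z : R => - z^-1) x _ _
      (is_derive_expR (- x^-1)) H3.
    have := is_deriveM H2 H4.
    rewrite /flat x0 => H.
    apply: (is_derive_eq H).
    rewrite /GRing.scale/= -(exprVn x 2).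
    case: k {H2 H} => [|k]; first by rewrite !expr0 !mul0r; ring.
    by rewrite /= !mulr1 !exprS; ring.
  apply: near_eq_is_derive Hd.
  have : \forall z \near x, 0 < z by exact: lt_nbhsr.
  by apply: filterS => z z0; rewrite /flat z0.
- have Hd : is_derive x 1 (cst (0:R)) (flat k.+2 x - k%:R * flat k.+1 x).
    rewrite /flat !ltNge (ltW x0)/= mulr0 subr0; exact: is_derive_cst.
  apply: near_eq_is_derive Hd.
  have : \forall z \near x, z < 0 by exact: lt_nbhsl.
  by apply: filterS => z z0; rewrite /flat ltNge (ltW z0).
(* At the origin the difference quotient is at most (k+2)! |h|. *)
- have -> : flat k.+2 0 - k%:R * flat k.+1 0 = 0 by rewrite /flat ltxx mulr0 subr0.
  suff H : (fun h : R => h^-1 *: ((flat k \o shift 0) (h *: 1) - flat k 0)) @ 0^' --> (0:R).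
    by apply: DeriveDef; [apply/cvg_ex; exists 0|exact/cvg_lim].
  set F : R := (k.+2)`!%:R.
  have F0 : 0 < F by rewrite ltr0n fact_gt0.
  apply/cvgrPdist_le => e e0.
  have : \forall h \near (0:R)^', `|h| < e / F by apply: dnbhs0_lt; rewrite divr_gt0.
  apply: filterS => h he /=.
  rewrite {2}/flat ltxx subr0 addr0 sub0r normrN /GRing.scale/= mulr1.
  have [->|hn0] := eqVneq h 0; first by rewrite invr0 mul0r normr0 ltW.
  rewrite normrM normfV ler_pdivrMl ?normr_gt0//.
  rewrite (ger0_norm (flat_ge0 _ _)).
  apply: le_trans (flat_le _ _) _; rewrite -/F -(real_normK (num_real h)) expr2.
  rewrite mulrCA ler_wpM2l// mulrC -ler_pdivlMr//; exact: ltW.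
Qed.

(** Stable under [partial] by the product rule and the formula for the derivative of [flat]; it
    contains the cut-off functions used below, which are therefore smooth by [smooth_coind]. *)
Inductive smooth_alg : (R3 R -> R) -> Prop :=
| SmoothBase f : smooth f -> smooth_alg f
| SmoothFlat k i (a b : R) : smooth_alg (fun x => flat k (a * crd i x + b))
| SmoothCst (c : R) : smooth_alg (cst c)
| SmoothD f g : smooth_alg f -> smooth_alg g -> smooth_alg (fun x => f x + g x)
| SmoothM f g : smooth_alg f -> smooth_alg g -> smooth_alg (fun x => f x * g x).

Lemma smooth_alg_smooth : smooth_alg `<=` smooth.
Proof.
apply: smooth_coind => f; elim => {f}.
- move=> f sf; split; first exact: smooth_continuous.
  move=> i; split; first exact/SmoothBase/smooth_partial.
  by move=> x; exact: smooth_derivable.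
- move=> k i a b.
  have D (z : R) : is_derive z (1 : R) (fun z : R => flat k (a * z + b))
      (a * (flat k.+2 (a * z + b) - k%:R * flat k.+1 (a * z + b))).
    have H : is_derive z (1 : R) (fun z : R => a * z + b) (a * 1).
      rewrite -[a * 1]addr0; apply: is_deriveD.
    have := @is_derive1_comp R (flat k) (fun z : R => a * z + b) z _ _
       (is_derive_flat k (a * z + b)) H.
    by rewrite mulr1 mulrC.
  split.
    move=> x; apply: (@continuous_comp _ _ _ (crd i) (fun z => flat k (a * z + b))).
      exact: continuous_crd.
    by apply: differentiable_continuous; apply/derivable1_diffP; exact: (@ex_derive _ _ _ _ _ _ _ (D _)).
  move=> j; split; last by move=> x; exact: (@ex_derive _ _ _ _ _ _ _ (is_derive_crd j (D (crd i x)))).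
  have -> : partial j (fun x => flat k (a * crd i x + b)) =
    (fun x => cst ((i == j)%:R * a) x *
      (flat k.+2 (a * crd i x + b) + cst (- k%:R) x * flat k.+1 (a * crd i x + b))).
    apply/funext => x; rewrite /partial.
    rewrite (@derive_val _ _ _ _ _ _ _ (is_derive_crd j (D (crd i x)))).
    by rewrite /=; ring.
  apply: SmoothM; first exact: SmoothCst.
  apply: SmoothD; first exact: SmoothFlat.
  by apply: SmoothM; [exact: SmoothCst|exact: SmoothFlat].
- move=> c; split; first by move=> x; exact: cvg_cst.
  move=> i; split; last by move=> x; exact: derivable_cst.
  have -> : partial i (cst c : R3 R -> R) = cst 0.
    by apply/funext => x; rewrite /partial derive_cst.
  exact: SmoothCst.
- move=> f g sf [cf df] sg [cg dg]; split.
    by move=> x; apply: cvgD; [exact: cf|exact: cg].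
  move=> i; split; last by move=> x; apply: derivableD; [exact: (df i).2|exact: (dg i).2].
  have -> : partial i (fun x => f x + g x) = (fun x => partial i f x + partial i g x).
    by apply/funext => x; rewrite /partial deriveD//; [exact: (df i).2|exact: (dg i).2].
  by apply: SmoothD; [exact: (df i).1|exact: (dg i).1].
- move=> f g sf [cf df] sg [cg dg]; split.
    by move=> x; apply: cvgM; [exact: cf|exact: cg].
  move=> i; split; last by move=> x; apply: derivableM; [exact: (df i).2|exact: (dg i).2].
  have -> : partial i (fun x => f x * g x) =
      (fun x => (f x * partial i g x) + (g x * partial i f x)).
    by apply/funext => x; rewrite /partial deriveM//; [exact: (df i).2|exact: (dg i).2].
  apply: SmoothD; apply: SmoothM => //; [exact: (dg i).1|exact: (df i).1].
Qed.

Lemma smooth_translate f (c : R3 R) : smooth f -> smooth (fun x => f (x + c)).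
Proof.
move=> sf; apply: (smooth_coind (S := [set h | exists2 f, smooth f & h = fun x => f (x + c)])); last by exists f.
move=> {sf}_ [{}f sf ->].
have D i x : is_derive x (e3 i) (fun x => f (x + c)) (partial i f (x + c)).
  apply: (@is_derive_along _ _ _ f x (e3 i) (x + c) (e3 i)).
    by move=> h; rewrite addrA.
  by apply: DeriveDef => //; exact: smooth_derivable.
split.
  move=> x; apply: (@continuous_comp (R3 R) (R3 R) R (fun x => x + c) f x).
    by apply: cvgD; [exact: cvg_id|exact: cvg_cst].
  exact: smooth_continuous.
move=> i; split; last by move=> x; exact: (@ex_derive _ _ _ _ _ _ _ (D i x)).
exists (partial i f); first exact: smooth_partial.
by apply/funext => x; rewrite /partial (@derive_val _ _ _ _ _ _ _ (D i x)).
Qed.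

Lemma partial_translate f (c : R3 R) i x : partial i (fun x => f (x + c)) x = partial i f (x + c).
Proof.
rewrite /partial /derive.
have -> : (fun h : R => h^-1 *: (((fun x => f (x + c)) \o shift x) (h *: e3 i) - f (x + c))) =
    (fun h : R => h^-1 *: ((f \o shift (x + c)) (h *: e3 i) - f (x + c))).
  by apply/funext => h /=; rewrite addrA.
by [].
Qed.

End Smooth.

(** * Test functions *)

Section MeasurableR3.
Context {R : realType}.
Local Notation mR := (measurableTypeR R).
Implicit Types (i : 'I_3).

Lemma measurable_crd i : measurable_fun setT (crd i : R3 mR -> mR).
Proof.
case: i => [[|[|[|//]]] ?]; rewrite /crd/=.
- exact: (measurableT_comp measurable_fst measurable_fst).
- exact: (measurableT_comp measurable_snd measurable_fst).
- exact: measurable_snd.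
Qed.

Definition cube (c : R3 R) (e : R) : set (R3 R) := [set x | forall i, `|crd i x - crd i c| < e].

Lemma measurable_cube c e : measurable (cube c e : set (R3 mR)).
Proof.
pose A (i : 'I_3) := crd i @^-1` `]crd i c - e, crd i c + e[%classic : set (R3 mR).
have mA i : measurable (A i).
  by rewrite -[A i]setTI; apply: measurable_crd => //; exact: measurable_itv.
have -> : cube c e = A (@Ordinal 3 0 isT) `&` A (@Ordinal 3 1 isT) `&` A (@Ordinal 3 2 isT).
  have AE i x : A i x = (`|crd i x - crd i c| < e) by rewrite /A/= in_itv/= distrC ltr_distlC.
  apply/seteqP; split => x /=; first by move=> H; rewrite !AE.
  by rewrite !AE => -[[H1 H2] H3] [[|[|[|//]]] ?]; rewrite /crd/=.
by apply: measurableI => //; exact: measurableI.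
Qed.

(** Cubes with rational centre and radius 1/(n+1); an index whose cube leaves [U] is given the empty
    set. Countability makes open sets measurable for the product sigma-algebra. *)
Lemma open_bigcup_cube (U : set (R3 R)) : open U ->
  exists2 F : rat * rat * rat * nat -> set (R3 R), U = \bigcup_k F k &
    forall k, F k = set0 \/ exists c e, F k = cube c e.
Proof.
move=> oU.
pose I := (rat * rat * rat * nat)%type.
pose ctr (k : I) : R3 R := (ratr k.1.1.1, ratr k.1.1.2, ratr k.1.2).
pose F (k : I) := if `[< cube (ctr k) k.2.+1%:R^-1 `<=` U >] then cube (ctr k) k.2.+1%:R^-1 else set0.
exists F; last first.
  move=> k; rewrite /F; case: asboolP => _; last by left.
  by right; exists (ctr k), k.2.+1%:R^-1.
apply/seteqP; split; last first.
  by move=> x [k _]; rewrite /F; case: asboolP => // kU /kU.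
  move=> x Ux; have /nbhs_ballP[e /= e0 xe] := open_nbhs_nbhs (conj oU Ux).
  have [n nE] : exists n : nat, n.+1%:R^-1 < e / 2.
    have e20 : 0 < e / 2 by rewrite divr_gt0.
    by have [n _ H] := near_infty_natSinv_lt (PosNum e20); exists n; exact: (H n (leqnn n)).
  have n0 : 0 < n.+1%:R^-1 :> R by rewrite invr_gt0.
  have Q (z : R) : exists q : rat, `|z - ratr q| < n.+1%:R^-1.
    have [q] := @rat_in_itvoo R (z - n.+1%:R^-1) (z + n.+1%:R^-1) ltac:(move: n0; set d := (_%:R)^-1; lra).
    by rewrite in_itv/= -ltr_distlC distrC => ?; exists q; rewrite distrC.
  have [q1 H1] := Q x.1.1; have [q2 H2] := Q x.1.2; have [q3 H3] := Q x.2.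
  exists (q1, q2, q3, n) => //.
  have cx : cube (ctr (q1, q2, q3, n)) n.+1%:R^-1 x.
    by case=> [[|[|[|//]]] ?]; rewrite /crd/=.
  rewrite /F asboolT//= => y cy; apply: xe.
  have D i : `|crd i x - crd i y| < e.
    have := cx i; have := cy i; move: nE; rewrite /= !ltr_norml.
    move: (n.+1%:R^-1 : R) => d ? /andP[? ?] /andP[? ?].
    by apply/andP; split; lra.
  split; first split.
  - by have := D (@Ordinal 3 0 isT).
  - by have := D (@Ordinal 3 1 isT).
  - by have := D (@Ordinal 3 2 isT).
Qed.

Lemma open_measurable3 (U : set (R3 R)) : open U -> measurable (U : set (R3 mR)).
Proof.
move=> /open_bigcup_cube[F -> FP].
apply: countable_bigcupT_measurable => [|k]; first exact: countableP.
by have [->|[c [e ->]]] := FP k; [exact: measurable0|exact: measurable_cube].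
Qed.

Lemma continuous_measurable3 (f : R3 R -> R) :
  continuous f -> measurable_fun setT (f : R3 mR -> mR).
Proof.
move=> /continuousP cf; apply: (measurability _ (RGenOpens.measurableE R)).
move=> _ [_ [a [b ->] <-]]; rewrite setTI; apply: open_measurable3.
exact/cf/interval_open.
Qed.

Lemma compact_measurable3 (K : set (R3 R)) : compact K -> measurable (K : set (R3 mR)).
Proof.
move=> cK; rewrite -(setCK K); apply: measurableC; apply: open_measurable3.
rewrite openC; apply: compact_closed => //; exact: norm_hausdorff.
Qed.

Definition box (M : R) : set (R3 R) := [set x | forall i, `|crd i x| <= M].

Lemma compact_box M : compact (box M).
Proof.
have -> : box M = (`[- M, M] `*` `[- M, M]) `*` `[- M, M]%classic.
  apply/seteqP; split => x /=; rewrite !in_itv/= -!ler_norml.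
    move=> H; split; [split|]; [exact: (H (@Ordinal 3 0 isT))|
      exact: (H (@Ordinal 3 1 isT))|exact: (H (@Ordinal 3 2 isT))].
  by move=> [[H1 H2] H3] [[|[|[|//]]] ?]; rewrite /crd.
by apply: compact_setX; [apply: compact_setX|]; exact: segment_compact.
Qed.

Lemma compact_sub_box (K : set (R3 R)) : compact K -> exists2 M, 0 < M & K `<=` box M.
Proof.
move=> /compact_bounded[M0 [_ H]].
exists (`|M0| + 1) => [|x Kx i]; first by rewrite ltr_pwDr.
have := H (`|M0| + 1); have [_ h] := (ler_norm M0, I).
have M01 : M0 < `|M0| + 1 by have := ler_norm M0; lra.
move=> /(_ M01) /(_ x Kx) /=; apply: le_trans.
rewrite /crd; case: ifP => _; [|case: ifP => _].
- by rewrite /Num.norm/= !le_max lexx.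
- by rewrite /Num.norm/= !le_max lexx !orbT.
- by rewrite /Num.norm/= !le_max lexx !orbT.
Qed.

End MeasurableR3.

Section TestFunctions.
Context {R : realType}.
Implicit Types (f g : R3 R -> R) (i : 'I_3).

Lemma test_of_box f M : smooth f -> (forall x, f x != 0 -> box M x) -> test_function f.
Proof.
move=> sf fM; split => //.
have cb := @compact_box R M.
apply: (subclosed_compact _ cb); first exact: closed_closure.
have : closed (box M : set (R3 R)).
  by apply: compact_closed => //; exact: norm_hausdorff.
by move=> /closure_id ->; exact: closure_subset.
Qed.

Lemma test_box f : test_function f -> exists2 M, 0 < M & forall x, f x != 0 -> box M x.
Proof.
move=> [_ /compact_sub_box[M M0 H]]; exists M => // x fx; apply: H.
exact: subset_closure.
Qed.

(** Off its closed support [f] vanishes in a neighbourhood, so its partial derivatives vanish there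
    too. *)
Lemma test_partial f i : test_function f -> test_function (partial i f).
Proof.
move=> [sf cf]; split; first exact: smooth_partial.
apply: (subclosed_compact _ cf); first exact: closed_closure.
rewrite [X in _ `<=` X]((closure_id _).1 (@closed_closure _ [set x | f x != 0])).
apply: closure_subset => x /= Hx; apply: contrapT => xn.
have : \forall y \near x, ~ closure [set x | f x != 0] y.
  apply: open_nbhs_nbhs; split => //; rewrite openC; exact: closed_closure.
move=> nx; move/negP: Hx; apply; apply/eqP; rewrite /partial.
rewrite (near_eq_derive (g := cst 0)); first by rewrite derive_cst.
apply: filterS nx => y; apply: contra_notP => /eqP fy; exact: subset_closure.
Qed.

Lemma test_bounded f : test_function f -> exists2 C, 0 < C & forall x, `|f x| <= C.
Proof.
move=> [sf cf].
have /compact_bounded[M [_ HM]] : compact (f @` closure [set x | f x != 0]).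
  apply: continuous_compact => //; apply: continuous_subspaceT.
  exact: smooth_continuous.
exists (`|M| + 1) => [|x]; first by rewrite ltr_pwDr.
have [->|fx] := eqVneq (f x) 0; first by rewrite normr0.
apply: (HM (`|M| + 1)); first by have := ler_norm M; lra.
by exists x => //; exact: subset_closure.
Qed.

Lemma test_measurable f : test_function f ->
  measurable_fun setT (f : R3 (measurableTypeR R) -> measurableTypeR R).
Proof. by move=> [/smooth_continuous/continuous_measurable3]. Qed.

Lemma test_translate f (c : R3 R) : test_function f -> test_function (fun x => f (x + c)).
Proof.
move=> tf; have [M M0 HM] := test_box tf.
have [M' M'0 HM'] := @compact_sub_box R [set c] (@compact_set1 (R3 R) c).
apply: (@test_of_box _ (M + M')); first exact: smooth_translate tf.1.
move=> x /HM H i; have := H i; have := HM' c erefl i.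
rewrite crdD !ler_norml => /andP[? ?] /andP[? ?]; apply/andP; split; lra.
Qed.

Lemma test_lin (a : R) f g : test_function f -> test_function g ->
  test_function (fun x => a * f x + g x).
Proof.
move=> tf tg; have [M M0 HM] := test_box tf; have [M' M'0 HM'] := test_box tg.
apply: (@test_of_box _ (M + M')).
  apply: smooth_alg_smooth; apply: SmoothD; last exact: SmoothBase tg.1.
  by apply: (SmoothM (f := cst a)); [exact: SmoothCst|exact: SmoothBase tf.1].
move=> x H i; have [f0|/HM/(_ i)] := eqVneq (f x) 0; last by lra.
have [g0|/HM'/(_ i)] := eqVneq (g x) 0; last by lra.
by move: H; rewrite f0 g0 mulr0 addr0 eqxx.
Qed.

Lemma partial_lin (a : R) f g i x : smooth f -> smooth g ->
  partial i (fun x => a * f x + g x) x = a * partial i f x + partial i g x.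
Proof.
move=> sf sg.
have df : derivable (a *: (f : _ -> R^o)) x (e3 i).
  by apply: derivableZ; exact: smooth_derivable.
rewrite /partial (_ : (fun x => _) = a *: (f : _ -> R^o) + g)//.
rewrite deriveD//; last exact: smooth_derivable.
by rewrite deriveZ//; exact: smooth_derivable.
Qed.

Definition obox (lo hi : R3 R) : set (R3 R) :=
  [set x | forall i, crd i lo < crd i x < crd i hi].

(** Inside the box, the product over the coordinates of exp(-1/(n(x_i - lo_i))) exp(-1/(n(hi_i -
    x_i))), and 0 outside. The values lie in [0, 1] and tend to the indicator of the open box, as
    dominated convergence requires. For [n = 0] this is the zero function. *)
Definition bumpf (lo hi : R3 R) (n : nat) (x : R3 R) : R :=
  \prod_(i < 3) (flat 0 (n%:R * crd i x + - (n%:R * crd i lo)) *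
                 flat 0 (- n%:R * crd i x + n%:R * crd i hi)).

Lemma flat0_le1 (x : R) : flat 0 x <= 1.
Proof.
rewrite /flat; case: ifPn => // x0; rewrite expr0 mul1r -expR0 ler_expR.
by rewrite oppr_le0 invr_ge0 ltW.
Qed.

Lemma flat0_gt0 (x : R) : flat 0 x != 0 -> 0 < x.
Proof. by rewrite /flat; case: ifPn => // _ /eqP. Qed.

Lemma bump_ge0 lo hi n x : 0 <= bumpf lo hi n x.
Proof. by apply: prodr_ge0 => i _; rewrite mulr_ge0 ?flat_ge0. Qed.

Lemma bump_le1 lo hi n x : bumpf lo hi n x <= 1.
Proof.
apply: prodr_ile1 => i _; rewrite mulr_ge0 ?flat_ge0//=.
by rewrite -[leRHS]mulr1 ler_pM ?flat_ge0 ?flat0_le1.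
Qed.

Lemma bump_neq0 lo hi n x : bumpf lo hi n x != 0 -> obox lo hi x.
Proof.
move=> /prodf_neq0 H i; have := H i isT.
rewrite mulf_eq0 negb_or => /andP[/flat0_gt0 H1 /flat0_gt0 H2].
have n0 : 0 < n%:R :> R.
  by rewrite ltr0n lt0n; apply/eqP => n0; move: H1; rewrite n0 !mul0r oppr0 addr0 ltxx.
apply/andP; split; rewrite -(ltr_pM2l n0); lra.
Qed.

Lemma test_bump lo hi n : test_function (bumpf lo hi n).
Proof.
have [M M0 HM] := @compact_sub_box R [set lo] (@compact_set1 (R3 R) lo).
have [M' M'0 HM'] := @compact_sub_box R [set hi] (@compact_set1 (R3 R) hi).
apply: (@test_of_box _ (M + M')).
  apply: smooth_alg_smooth; rewrite /bumpf.
  elim: (index_enum _) => [|i s IH].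
    under eq_fun do rewrite big_nil; exact: SmoothCst.
  under eq_fun do rewrite big_cons; apply: SmoothM IH.
  by apply: SmoothM; exact: SmoothFlat.
move=> x /bump_neq0 H i; have := HM lo erefl i; have := HM' hi erefl i.
have := H i; rewrite !ler_norml => /andP[? ?] /andP[? ?] /andP[? ?].
by apply/andP; split; lra.
Qed.

Lemma flat_cvg (y : R) : flat 0 (n%:R * y) @[n --> \oo] --> ((0 < y)%R%:R : R).
Proof.
have [y0|y0] := ltP 0 y; last first.
  rewrite (_ : (fun n => _) = cst 0); first exact: cvg_cst.
  by apply/funext => n; rewrite /flat ltNge mulr_ge0_le0.
have H : (fun n : nat => n.+1%:R^-1 * y^-1) @ \oo --> (0 : R).
  rewrite -[X in _ --> X](mul0r y^-1); apply: cvgM; last exact: cvg_cst.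
  exact: cvg_harmonic.
have : (fun n : nat => expR (- (n.+1%:R^-1 * y^-1))) @ \oo --> (1 : R).
  rewrite -[X in _ --> X]expR0 -[X in expR X]oppr0.
  apply: (@cvg_comp _ _ _ (fun n : nat => - (n.+1%:R^-1 * y^-1)) expR _ (nbhs (- 0 : R))).
    exact: cvgN H.
  exact: continuous_expR.
move=> {}H; rewrite -(cvg_shiftS (fun n => flat 0 (n%:R * y))).
apply: cvg_trans H; apply: near_eq_cvg; apply: nearW => n /=.
by rewrite /flat mulr_gt0// expr0 mul1r invfM.
Qed.

Lemma bump_cvg lo hi x : bumpf lo hi n x @[n --> \oo] --> (\1_(obox lo hi) x : R).
Proof.
have -> : \1_(obox lo hi) x = \prod_(i < 3) ((0 < crd i x - crd i lo)%R%:R *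
    (0 < crd i hi - crd i x)%R%:R) :> R.
  rewrite indicE; have [H|H] := boolP (x \in obox lo hi).
    rewrite big1// => i _; have := set_mem H i => /andP[H1 H2].
    by rewrite !subr_gt0 H1 H2 mulr1.
  have [i Hi] : exists i, ~~ (crd i lo < crd i x < crd i hi).
    apply/not_existsP => H'; move/negP: H; apply; apply: mem_set => i.
    by apply/negPn/negP; exact: H'.
  rewrite (bigD1 i)//= !subr_gt0.
  by move: Hi; rewrite negb_and => /orP[/negbTE ->|/negbTE ->]; rewrite ?mulr0 ?mul0r.
rewrite /bumpf; elim: (index_enum _) => [|i s IH].
  by under eq_fun do rewrite big_nil; rewrite big_nil; exact: cvg_cst.
under eq_fun do rewrite big_cons; rewrite big_cons; apply: cvgM IH.
apply: cvgM.
  under eq_fun do rewrite -mulrBr; exact: flat_cvg.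
under eq_fun do rewrite mulNr addrC -mulrBr; exact: flat_cvg.
Qed.

End TestFunctions.

(** * Lebesgue measure on R^3 *)

Section ProductSigmaFinite.
Context d1 d2 (T1 : measurableType d1) (T2 : measurableType d2) (R : realType).
Context (m1 : {sigma_finite_measure set T1 -> \bar R}).
Context (m2 : {sigma_finite_measure set T2 -> \bar R}).

(* A copy of m1 \x m2: for the latter the canonical sigma-finite structure is
   the one for products of subprobabilities, which hides the general one. *)
Definition prodm : set (T1 * T2) -> \bar R := (m1 \x m2)%E.

HB.instance Definition _ := Measure.on prodm.

Let sigma_finite_prodm : sigma_finite setT prodm.
Proof.
have /sigma_finiteP[F [TF ndF Foo]] := sigma_finiteT m1.
have /sigma_finiteP[G [TG ndG Goo]] := sigma_finiteT m2.
exists (fun n => F n `*` G n) => [|k].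
  rewrite predeqE => -[x y]; split => // _.
  have [n _ Fx] : (\bigcup_i F i) x by rewrite -TF.
  have [k _ Gy] : (\bigcup_i G i) y by rewrite -TG.
  exists (maxn n k) => //; split => /=.
    by move: x Fx; exact/subsetPset/ndF/leq_maxl.
  by move: y Gy; exact/subsetPset/ndG/leq_maxr.
have [mF Fk] := Foo k; have [mG Gk] := Goo k.
split; first exact: measurableX.
by rewrite /prodm product_measure1E// lte_mul_pinfty// ge0_fin_numE.
Qed.

HB.instance Definition _ := Measure_isSigmaFinite.Build _ _ _ prodm sigma_finite_prodm.

End ProductSigmaFinite.

(** * Maps that preserve integrals; translations *)

Section MeasurePreserving.
Local Open Scope ereal_scope.

(** Put with integrals of nonnegative functions rather than preimages: in this form product maps are
    handled by Tonelli's theorem one factor at a time. *)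
Definition mpres d (T : measurableType d) (R : realType)
    (mu : {measure set T -> \bar R}) (tau : T -> T) :=
  measurable_fun setT tau /\
  forall f : T -> \bar R, measurable_fun setT f -> (forall x, 0 <= f x) ->
    \int[mu]_x f (tau x) = \int[mu]_x f x.

Context d (T : measurableType d) (R : realType) (mu : {measure set T -> \bar R}).
Variables (tau : T -> T) (tauP : mpres mu tau).

Lemma mpres_integrable (f : T -> \bar R) :
  mu.-integrable setT f -> mu.-integrable setT (f \o tau).
Proof.
move=> /integrableP[mf intf]; apply/integrableP; split.
  exact: measurableT_comp tauP.1.
rewrite -(tauP.2 (fun x => `|f x|)) // in intf; exact: measurableT_comp.
Qed.

Lemma mpres_integral (f : T -> \bar R) : measurable_fun setT f ->
  \int[mu]_x f (tau x) = \int[mu]_x f x.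
Proof.
move=> mf; rewrite integralE [RHS]integralE; congr (_ - _).
  rewrite -(tauP.2 _ (measurable_funepos mf) (fun x => funepos_ge0 f x)).
  by apply: eq_integral => x _; rewrite !funeposE.
rewrite -(tauP.2 _ (measurable_funeneg mf) (fun x => funeneg_ge0 f x)).
by apply: eq_integral => x _; rewrite !funenegE.
Qed.

End MeasurePreserving.

Section MeasurePreservingProd.
Context d1 d2 (T1 : measurableType d1) (T2 : measurableType d2) (R : realType).
Context (m1 : {sigma_finite_measure set T1 -> \bar R}).
Context (m2 : {sigma_finite_measure set T2 -> \bar R}).

Lemma mpres_prod (t1 : T1 -> T1) (t2 : T2 -> T2) : mpres m1 t1 -> mpres m2 t2 ->
  mpres (prodm m1 m2) (fun x => (t1 x.1, t2 x.2)).
Proof.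
move=> [mt1 I1] [mt2 I2].
have mt : measurable_fun setT (fun x : T1 * T2 => (t1 x.1, t2 x.2)).
  apply/measurable_fun_pairP; split.
    exact: (measurableT_comp mt1 measurable_fst).
  exact: (measurableT_comp mt2 measurable_snd).
split=> // f mf f0.
rewrite (@fubini_tonelli1 _ _ _ _ _ m1 m2 (fun x => f (t1 x.1, t2 x.2)))//; last first.
  exact: measurableT_comp mt.
rewrite (@fubini_tonelli1 _ _ _ _ _ m1 m2 f)// -[RHS]I1; last 2 first.
- exact: measurable_fun_fubini_tonelli_F.
- by move=> x; exact: integral_ge0.
apply: eq_integral => x _; rewrite /fubini_F/=.
rewrite -[RHS](I2 (fun y => f (t1 x, y)))//.
exact: (measurableT_comp mf (measurable_pair1 (t1 x))).
Qed.

End MeasurePreservingProd.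

Section LebesgueR3.
Context {R : realType}.
Local Notation mR := (measurableTypeR R).
Local Notation lam := (@lebesgue_measure R).

Definition mu3 : {sigma_finite_measure set (R3 mR) -> \bar R} :=
  prodm (prodm lam lam) lam.

(** The pushforward agrees with Lebesgue measure on half-open intervals, which determine it. *)
Lemma mpres_shift (c : R) : mpres lam (fun x : mR => x + c : mR).
Proof.
have mt : measurable_fun setT (fun x : mR => x + c : mR) by exact: measurable_funD.
split=> // f mf f0.
pose t : {mfun mR >-> mR} := HB.pack (fun x : mR => x + c : mR)
  (isMeasurableFun.Build _ _ _ _ (fun x : mR => x + c : mR) mt).
have := ge0_integral_pushforward mt lam measurableT mf (fun x _ => f0 x).
rewrite preimage_setT => <-.
apply: eq_measure_integral => A mA _; apply/esym.
apply: (@lebesgue_measure_unique R (pushforward lam t)) => // X [[a b] _ <-] /=.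
rewrite /pushforward/=.
have -> : t @^-1` `]a, b]%classic = `]a - c, b - c]%classic.
  by apply/seteqP; split => x /=; rewrite !in_itv/= ltrBlDr lerBrDr.
rewrite !lebesgue_measure_itv/= !lte_fin ltrD2r.
by case: ifP => // _; rewrite -!EFinD; congr (_%:E); ring.
Qed.

Lemma mpres_shift3 (c : R3 R) : mpres mu3 (fun x : R3 mR => x + c : R3 mR).
Proof.
case: c => [[c1 c2] c3].
exact: (mpres_prod (mpres_prod (mpres_shift c1) (mpres_shift c2)) (mpres_shift c3)).
Qed.

End LebesgueR3.

(** * The fundamental lemma of the calculus of variations *)

Lemma measurable_patch d (T : measurableType d) (R : realType) (f : T -> \bar R) A :
  measurable A -> measurable_fun setT f -> measurable_fun setT (f \_ A).
Proof.
by move=> mA mf; apply/(measurable_restrictT _ mA).1; exact: measurable_funTS.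
Qed.

Section FundamentalLemma.
Context {R : realType}.
Local Notation mR := (measurableTypeR R).
Local Notation mu := (@mu3 R).
Implicit Types (g : R3 R -> R) (lo hi : R3 R).

Let oboxes : set (set (R3 R)) := [set obox lo hi | lo in setT & hi in setT].

Lemma cube_obox c e : cube c e = obox (c - (e, e, e)) (c + (e, e, e)) :> set (R3 R).
Proof.
apply/seteqP; split => x /= H [[|[|[|//]]] i3]; have := H (Ordinal i3);
  by rewrite /crd/= ?ltr_distl.
Qed.

Lemma measurable_obox lo hi : measurable (obox lo hi : set (R3 mR)).
Proof.
pose A (i : 'I_3) := crd i @^-1` `]crd i lo, crd i hi[%classic : set (R3 mR).
have mA i : measurable (A i).
  by rewrite -[A i]setTI; apply: measurable_crd => //; exact: measurable_itv.
have -> : obox lo hi = A (@Ordinal 3 0 isT) `&` A (@Ordinal 3 1 isT) `&` A (@Ordinal 3 2 isT).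
  have AE i x : A i x = (crd i lo < crd i x < crd i hi) by rewrite /A/= in_itv/=.
  apply/seteqP; split => x /=; first by move=> H; rewrite !AE.
  by rewrite !AE => -[[H1 H2] H3] [[|[|[|//]]] ?]; rewrite /crd/=.
by apply: measurableI => //; exact: measurableI.
Qed.

Let open_g U : open U -> <<s oboxes >> U.
Proof.
move=> /open_bigcup_cube[F -> FP].
have S : sigma_algebra setT <<s oboxes >> by exact: smallest_sigma_algebra.
apply: (@countable_bigcupT_measurable _ (g_sigma_algebraType oboxes)) => [|k].
  exact: countableP.
have [->|[c [e ->]]] := FP k; first exact: measurable0.
apply: sub_gen_smallest; rewrite cube_obox.
by exists (c - (e, e, e)) => //; exists (c + (e, e, e)).
Qed.

(** The identity is measurable from the sigma-algebra generated by boxes, because its coordinates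
    are: they pull open sets back to open sets, which are countable unions of cubes. *)
Lemma measurable_obox_gen (A : set (R3 mR)) : measurable A -> <<s oboxes >> A.
Proof.
pose T := g_sigma_algebraType oboxes.
have mc (i : 'I_3) : measurable_fun setT (crd i : T -> mR).
  apply: (measurability _ (RGenOpens.measurableE R)).
  move=> _ [_ [a [b ->] <-]]; rewrite setTI; apply: open_g.
  have /continuousP := @continuous_crd R i; apply; exact: interval_open.
have mid : measurable_fun setT (id : T -> R3 mR).
  apply/measurable_fun_pairP; split.
    apply/measurable_fun_pairP; split.
      exact: (mc (@Ordinal 3 0 isT)).
    exact: (mc (@Ordinal 3 1 isT)).
  exact: (mc (@Ordinal 3 2 isT)).
by move=> mA; have := mid measurableT A mA; rewrite setTI.
Qed.

Lemma oboxI lo hi lo' hi' : obox lo hi `&` obox lo' hi' =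
  obox (Num.max lo.1.1 lo'.1.1, Num.max lo.1.2 lo'.1.2, Num.max lo.2 lo'.2)
       (Num.min hi.1.1 hi'.1.1, Num.min hi.1.2 hi'.1.2, Num.min hi.2 hi'.2).
Proof.
apply/seteqP; split => x /=.
  move=> [H H'] [[|[|[|//]]] i3]; have /andP[? ?] := H (Ordinal i3);
    have /andP[? ?] := H' (Ordinal i3); rewrite /crd/= lt_min gt_max;
    by apply/andP; split; apply/andP; split.
by move=> H; split => -[[|[|[|//]]] i3]; have := H (Ordinal i3);
  rewrite /crd/= lt_min gt_max => /andP[/andP[? ?] /andP[? ?]]; apply/andP; split.
Qed.

(** Dynkin's argument: boxes are stable under intersection, and the sets over which [f] has integral
    0 form a lambda-system. That the latter contains the whole space is the last hypothesis. *)
Lemma ae0_of_obox (f : R3 mR -> \bar R) : mu.-integrable setT f ->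
  (forall lo hi, \int[mu]_(x in obox lo hi) f x = 0)%E ->
  (\int[mu]_x f x = 0)%E -> {ae mu, forall x, f x = 0%E}.
Proof.
move=> intf f0 fT.
pose H := [set E : set (R3 mR) | measurable E /\ (\int[mu]_(x in E) f x = 0)%E].
have mf := measurable_int _ intf.
have HL : lambda_system setT H.
  split => //.
  - move=> A B BA [mA A0] [mB B0]; split; first exact: measurableD.
    have : (\int[mu]_(x in B `|` (A `\` B)) f x = \int[mu]_(x in A) f x)%E by rewrite setDUK.
    rewrite A0 integral_setU//; first by rewrite B0 add0e.
    + exact: measurableD.
    + by apply: measurable_funTS.
    + by apply/disj_setPS => x [Bx [_ /(_ Bx)]].
  - move=> F ndF HF; have mF i := (HF i).1.
    have mU : measurable (\bigcup_i F i) by exact: bigcupT_measurable.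
    split => //; rewrite integral_mkcond.
    have mfF A : measurable A -> measurable_fun setT (f \_ A).
      by move=> mA; exact: measurable_patch.
    have C1 : {ae mu, forall x, [set: R3 mR] x ->
        ((f \_ (F n)) x @[n --> \oo] --> (f \_ (\bigcup_i F i)) x)}.
      apply: aeW => x _; rewrite /patch; have [/set_mem[n _ Fnx]|xU] := boolP (x \in \bigcup_i F i).
        apply: cvg_near_cst; exists n => // k /= nk.
        by rewrite mem_set//; have /subsetPset := ndF _ _ nk; exact.
      apply: cvg_near_cst; apply: nearW => k; case: ifPn => // /set_mem Fk.
      by move/negP: xU; case; apply: mem_set; exists k.
    have C2 : mu.-integrable setT (fun x => `|f x|)%E by exact: integrable_abse.
    have C3 : {ae mu, forall x n, [set: R3 mR] x -> (`|(f \_ (F n)) x| <= `|f x|)%E}.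
      by apply: aeW => x n _; rewrite /patch; case: ifP => //; rewrite abse0.
    have [_ _] := dominated_convergence measurableT (fun n => mfF _ (mF n)) (mfF _ mU) C1 C2 C3.
    under eq_fun do rewrite -integral_mkcond (HF _).2.
    by move=> /cvg_lim <- //; rewrite lim_cst.
have sub : <<s oboxes >> `<=` H.
  apply: (lambda_system_subset _ HL) => //.
  - move=> _ _ [lo _ [hi _ <-]] [lo' _ [hi' _ <-]]; rewrite oboxI.
    by eexists => //; eexists.
  - by move=> _ [lo _ [hi _ <-]]; split; [exact: measurable_obox|exact: f0].
have := @integral_ae_eq _ _ _ mu setT measurableT (cst 0%E) f intf (measurable_cst _).
move=> /(_ _)[]; last first.
  by move=> N [mN N0 HN]; exists N; split => // x Hx; apply: HN => /= K; apply: Hx; exact: K.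
move=> E _ mE; rewrite integral0.
by have [] := sub E (measurable_obox_gen mE).
Qed.

End FundamentalLemma.

(** * Locally integrable functions that vanish against all test functions *)

Section LocallyIntegrable.
Context {R : realType}.
Local Notation mR := (measurableTypeR R).
Local Notation mu := (@mu3 R).
Implicit Types (g : R3 R -> R).

Lemma measurable_box M : measurable (box M : set (R3 mR)).
Proof. by apply: compact_measurable3; exact: compact_box. Qed.

Lemma loc_int_box g M : locally_integrable3 g -> mu.-integrable (box M) (EFin \o g).
Proof. by move=> [_ H]; apply: H; exact: compact_box. Qed.

Lemma loc_int_measurable g : locally_integrable3 g ->
  measurable_fun setT (g : R3 mR -> mR).
Proof. by case. Qed.

Lemma loc_intP g : measurable_fun setT (g : R3 mR -> mR) ->
  (forall M, mu.-integrable (box M) (EFin \o g)) -> locally_integrable3 g.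
Proof.
move=> mg H; split => // K cK; have [M M0 KM] := compact_sub_box cK.
have mK := compact_measurable3 cK.
exact: (integrableS (measurable_box M) mK KM (H M)).
Qed.

Lemma integrable_loc_bounded g h M C : locally_integrable3 g ->
  measurable_fun setT (h : R3 mR -> mR) -> (forall x, `|h x| <= C) ->
  (forall x, h x != 0 -> box M x) ->
  mu.-integrable setT (fun x => (g x * h x)%:E).
Proof.
move=> lg mh hC hM.
have E : (fun x => (g x * h x)%:E) = ((EFin \o g) \* (EFin \o h))%E \_ (box M).
  apply/funext => x; rewrite /patch; case: ifPn => [//|xM].
  have [->|/hM xM'] := eqVneq (h x) 0; first by rewrite mulr0.
  by move/negP: xM; case; exact: mem_set.
rewrite E; apply/(integrable_mkcond _ (measurable_box M)).1.
apply: integrableMl; [exact: measurable_box|exact: loc_int_box|exact: measurable_funTS|].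
exists C; split; first exact: num_real.
by move=> D CD x _ /=; rewrite (le_trans (hC x))// ltW.
Qed.

Lemma integrable_test g psi : locally_integrable3 g -> test_function psi ->
  mu.-integrable setT (fun x => (g x * psi x)%:E).
Proof.
move=> lg tpsi; have [M M0 HM] := test_box tpsi; have [C C0 HC] := test_bounded tpsi.
exact: (integrable_loc_bounded lg (test_measurable tpsi) HC HM).
Qed.

Lemma Rintegral0_integral (f : R3 mR -> R) : mu.-integrable setT (EFin \o f) ->
  \int[mu]_x f x = 0 -> (\int[mu]_x (f x)%:E = 0)%E.
Proof.
move=> intf; rewrite /Rintegral => H.
by rewrite -[LHS]fineK ?H//; exact: integrable_fin_num.
Qed.

(** Bump functions converge to indicators of boxes, so by dominated convergence [g] has integral 0
    over every box, and [ae0_of_obox] applies. *)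
Lemma fundamental_lemma g : locally_integrable3 g ->
  (forall psi, test_function psi -> \int[mu]_x (g x * psi x) = 0) ->
  {ae mu, forall x, g x = 0}.
Proof.
move=> lg H; have mg := loc_int_measurable lg.
have box0 lo hi : (\int[mu]_(x in obox lo hi) (g x)%:E = 0)%E.
  have [M M0 HM] := test_box (test_bump lo hi 1).
  have [M1 M10 HM1] := @compact_sub_box R [set lo] (@compact_set1 (R3 R) lo).
  have [M2 M20 HM2] := @compact_sub_box R [set hi] (@compact_set1 (R3 R) hi).
  have oM x : obox lo hi x -> box (M1 + M2) x.
    move=> ox i; have := HM1 lo erefl i; have := HM2 hi erefl i; have := ox i.
    by rewrite !ler_norml => /andP[? ?] /andP[? ?] /andP[? ?]; apply/andP; split; lra.
  have mo := measurable_obox lo hi.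
  have mgE : measurable_fun setT (EFin \o (g : R3 mR -> R)) by exact/measurable_EFinP.
  rewrite integral_mkcond.
  have mb n : measurable_fun setT (fun x : R3 mR => (g x * bumpf lo hi n x)%:E).
    by apply/measurable_EFinP; apply: measurable_funM => //; exact: test_measurable (test_bump _ _ _).
  have mf : measurable_fun setT ((EFin \o (g : R3 mR -> R)) \_ (obox lo hi)).
    exact: measurable_patch.
  have C1 : {ae mu, forall x, [set: R3 mR] x -> ((g x * bumpf lo hi n x)%:E @[n --> \oo] -->
      ((EFin \o (g : R3 mR -> R)) \_ (obox lo hi)) x)}.
    apply: aeW => x _; have -> : ((EFin \o (g : R3 mR -> R)) \_ (obox lo hi)) x = (g x * \1_(obox lo hi) x)%:E.
      by rewrite /patch indicE; case: ifPn => _; rewrite ?mulr1 ?mulr0.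
    apply: cvg_EFin; first exact: nearW.
    by apply: cvgM; [exact: cvg_cst|exact: bump_cvg].
  have C2 : mu.-integrable setT ((fun x => `|(g x)%:E|)%E \_ (box (M1 + M2))).
    apply/(integrable_mkcond _ (measurable_box _)).1.
    by apply: integrable_abse; exact: loc_int_box.
  have C3 : {ae mu, forall x n, [set: R3 mR] x -> (`|(g x * bumpf lo hi n x)%:E| <=
      ((fun x => `|(g x)%:E|)%E \_ (box (M1 + M2))) x)%E}.
    apply: aeW => x n _; rewrite /patch; case: ifPn => xM.
      rewrite lee_fin normrM -[leRHS]mulr1 ler_wpM2l//.
      by rewrite ger0_norm ?bump_ge0 ?bump_le1.
    have [->|/bump_neq0/oM xM'] := eqVneq (bumpf lo hi n x) 0; first by rewrite mulr0 abse0; exact: lexx.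
    by move/negP: xM; case; exact: mem_set.
  have [_ _] := dominated_convergence measurableT mb mf C1 C2 C3.
  have E n : (\int[mu]_x (g x * bumpf lo hi n x)%:E = 0)%E.
    by apply: Rintegral0_integral; [exact: integrable_test (test_bump _ _ _)|exact: H (test_bump _ _ _)].
  under eq_fun do rewrite E.
  by move=> /cvg_lim <- //; rewrite lim_cst.
(* [g] is integrable only locally, so the Dynkin argument is run on its restriction to a cube.
   Integrals of the restriction over boxes are integrals of [g] over intersections of boxes, which
   are boxes again. *)
have aeM (M : R) : {ae mu, forall x, obox (- M, - M, - M) (M, M, M) x -> g x = 0}.
  pose Q := obox (- M, - M, - M) (M, M, M) : set (R3 mR).
  have mQ : measurable Q by exact: measurable_obox.
  have /(@ae0_of_obox R)[] : mu.-integrable setT ((EFin \o (g : R3 mR -> R)) \_ Q).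
    apply/(integrable_mkcond _ mQ).1; apply: integrableS (loc_int_box M lg) => //.
      exact: measurable_box.
    move=> x Qx i; have := Qx i; rewrite ler_norml => /andP[H1 H2].
    case: i H1 H2 => [[|[|[|//]]] ?]; rewrite /crd/= => H1 H2; apply/andP; split; exact: ltW.
  - by move=> lo hi; rewrite -integral_mkcondr oboxI; exact: box0.
  - by rewrite -integral_mkcond; exact: box0.
  move=> N [mN N0 HN]; exists N; split => // x Hx; apply: HN => /= K; apply: Hx => Qx.
  by move: K; rewrite /patch mem_set//= => -[].
have := ae_foralln (fun n => aeM n%:R).
apply: filterS => x Hx.
have [n nP] : exists n : nat, forall i, `|crd i x| < n%:R.
  exists (Num.bound (`|x.1.1| + `|x.1.2| + `|x.2|)) => i.
  have B0 : 0 <= `|x.1.1| + `|x.1.2| + `|x.2| by rewrite !addr_ge0.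
  have := archi_boundP B0; apply: le_lt_trans.
  case: i => [[|[|[|//]]] ?]; rewrite /crd/=; have := normr_ge0 x.1.1;
   have := normr_ge0 x.1.2; have := normr_ge0 x.2; lra.
apply: (Hx n) => i; have := nP i; rewrite ltr_norml => /andP[H1 H2].
by case: i H1 H2 => [[|[|[|//]]] ?]; rewrite /crd/= => -> ->.
Qed.

End LocallyIntegrable.

(** * Weakly differentiable functions on lines *)

Lemma ae_imp d (T : measurableType d) (R : realType) (mu : {measure set T -> \bar R})
  (P Q : T -> Prop) : (forall x, P x -> Q x) ->
  {ae mu, forall x, P x} -> {ae mu, forall x, Q x}.
Proof. by move=> PQ; apply: filterS. Qed.

Lemma ae_imp2 d (T : measurableType d) (R : realType) (mu : {measure set T -> \bar R})
  (P Q S : T -> Prop) : (forall x, P x -> Q x -> S x) ->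
  {ae mu, forall x, P x} -> {ae mu, forall x, Q x} -> {ae mu, forall x, S x}.
Proof. by move=> PQS; apply: filterS2. Qed.

Section ProductIntegrals.
Local Open Scope ereal_scope.
Context d1 d2 (T1 : measurableType d1) (T2 : measurableType d2) (R : realType).
Context (m1 : {sigma_finite_measure set T1 -> \bar R}).
Context (m2 : {sigma_finite_measure set T2 -> \bar R}).

Lemma integrable_tensor (a : T1 -> R) (b : T2 -> R) :
  m1.-integrable setT (EFin \o a) -> m2.-integrable setT (EFin \o b) ->
  (m1 \x m2).-integrable setT (fun z => (a z.1 * b z.2)%:E).
Proof.
move=> ia ib; have /measurable_EFinP ma := measurable_int _ ia.
have /measurable_EFinP mb := measurable_int _ ib.
apply/integrable12ltyP.
  apply/measurable_EFinP; apply: measurable_funM.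
    exact: (measurableT_comp ma measurable_fst).
  exact: (measurableT_comp mb measurable_snd).
have ib' := integrable_abse ib; have := integrableP _ _ _ ib => -[_ ib2].
have E x : \int[m2]_y `|(a x * b y)%:E| = `|(a x)%:E| * \int[m2]_y `|(b y)%:E|.
  under eq_integral do rewrite EFinM abseM.
  rewrite ge0_integralZl//; exact: measurableT_comp (measurable_int _ ib).
under eq_integral do rewrite E.
rewrite ge0_integralZr//; last 2 first.
- by apply: measurableT_comp (measurable_int _ ia).
- exact: integral_ge0.
have /integrableP[_ ia2] := ia.
by apply: lte_mul_pinfty => //; [exact: integral_ge0|rewrite ge0_fin_numE//; exact: integral_ge0].
Qed.

(** The indicator of the complement of [S] has iterated integral 0 in one order, hence by Tonelli's
    theorem in the other. *)
Lemma ae_prod_swap (S : set (T1 * T2)) : measurable S ->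
  (forall x, {ae m2, forall y, S (x, y)}) ->
  {ae m2, forall y, {ae m1, forall x, S (x, y)}}.
Proof.
move=> mS HS; have mC : measurable (~` S) by exact: measurableC.
pose f (z : T1 * T2) : \bar R := (\1_(~` S) z)%:E.
have mf : measurable_fun setT f by exact/measurable_EFinP/measurable_indic.
have f0 z : 0 <= f z by rewrite lee_fin.
have H0 : \int[m2]_y \int[m1]_x f (x, y) = 0.
  rewrite -fubini_tonelli//; apply: integral0_eq => x _.
  rewrite (ae_eq_integral (cst 0))//; first by rewrite integral0.
    exact: (measurableT_comp mf (measurable_pair1 x)).
  apply: filterS (HS x) => y Sxy _ /=.
  by rewrite /f indicE memNset//; exact.
have mG : measurable_fun setT (fun y => \int[m1]_x f (x, y)).
  by have := @measurable_fun_fubini_tonelli_G _ _ _ _ _ m1 f mf f0.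
have : ae_eq m2 setT (fun y => \int[m1]_x f (x, y)) (cst 0).
  apply/ae_eq_integral_abs => //.
  by under eq_integral do rewrite gee0_abs ?integral_ge0//.
apply: filterS => y /(_ I) Hy.
have mf1 : measurable_fun setT (fun x => f (x, y)).
  exact: (measurableT_comp mf (measurable_pair2 y)).
have : ae_eq m1 setT (fun x => f (x, y)) (cst 0).
  apply/ae_eq_integral_abs => //.
  by under eq_integral do rewrite gee0_abs//.
apply: filterS => x /(_ I); rewrite /f indicE; have [//|nS] := pselect (S (x, y)).
by rewrite mem_set//= => -[] /eqP; rewrite oner_eq0.
Qed.

End ProductIntegrals.

Section Lines.
Context {R : realType}.
Local Notation mR := (measurableTypeR R).
Local Notation mu := (@mu3 R).
Local Notation lam := (@lebesgue_measure R).
Implicit Types (u g h : R3 R -> R) (i : 'I_3) (psi : R3 R -> R) (s t M C : R).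

Definition sh i (s : R) (x : R3 R) : R3 R := s *: e3 i + x.

Lemma crd_sh i j s (x : R3 R) : crd j (sh i s x) = (j == i)%:R * s + crd j x.
Proof. exact: crd_shift. Qed.

Lemma shK i s (x : R3 R) : sh i s (sh i (- s) x) = x.
Proof. by rewrite /sh addrA -scalerDl subrr scale0r add0r. Qed.

Lemma shNK i s (x : R3 R) : sh i (- s) (sh i s x) = x.
Proof. by rewrite /sh addrA -scalerDl addNr scale0r add0r. Qed.

Lemma sh0 i (x : R3 R) : sh i 0 x = x.
Proof. by rewrite /sh scale0r add0r. Qed.

Lemma partial_sh i psi s (x : R3 R) :
  partial i (fun x => psi (sh i s x)) x = partial i psi (sh i s x).
Proof.
have -> : (fun x => psi (sh i s x)) = (fun x => psi (x + s *: e3 i)).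
  by apply/funext => y; rewrite /sh addrC.
by rewrite partial_translate /sh addrC.
Qed.

Lemma mpres_sh i s : mpres mu (sh i s).
Proof.
have -> : sh i s = (fun x : R3 R => x + s *: e3 i) by apply/funext => x; rewrite /sh addrC.
exact: mpres_shift3.
Qed.

Lemma measurable_sh i : measurable_fun setT (fun z : mR * R3 mR => sh i z.1 z.2 : R3 mR).
Proof.
have mc (j : 'I_3) : measurable_fun setT (fun z : mR * R3 mR => crd j (sh i z.1 z.2) : mR).
  under eq_fun do rewrite crd_sh.
  apply: measurable_funD.
    by apply: measurable_funM => //; exact: measurable_fst.
  exact: (measurableT_comp (measurable_crd j) measurable_snd).
apply/measurable_fun_pairP; split.
  apply/measurable_fun_pairP; split.
    exact: (mc (@Ordinal 3 0 isT)).
  exact: (mc (@Ordinal 3 1 isT)).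
exact: (mc (@Ordinal 3 2 isT)).
Qed.

Lemma measurable_shN i : measurable_fun setT (fun z : mR * R3 mR => sh i (- z.1) z.2 : R3 mR).
Proof.
have mN : measurable_fun setT (fun z : mR * R3 mR => (- z.1, z.2) : mR * R3 mR).
  apply/measurable_fun_pairP; split; last exact: measurable_snd.
  by apply: measurable_funN; exact: measurable_fst.
exact: (measurableT_comp (measurable_sh i) mN).
Qed.

Lemma measurable_shs i (s : R) : measurable_fun setT (fun x : R3 mR => sh i s x : R3 mR).
Proof. by have [] := mpres_sh i s. Qed.

Lemma measurable_shx i (x : R3 mR) : measurable_fun setT (fun s : mR => sh i (- s) x : R3 mR).
Proof. exact: (measurableT_comp (measurable_shN i) (measurable_pair2 x)). Qed.

Lemma box_sh i s t M (x : R3 R) : 0 <= s <= t -> box M (sh i s x) -> box (M + t) x.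
Proof.
move=> /andP[s0 st] H j; have := H j; rewrite crd_sh !ler_norml => /andP[H1 H2].
have [ji|ji] := eqVneq j i; move: H1 H2; rewrite ?ji ?eqxx ?mul1r ?(negbTE ji) ?mul0r.
  by move=> *; apply/andP; split; lra.
by move=> *; apply/andP; split; lra.
Qed.

(** Dominated by the tensor product of the indicator of [0, t] with C |g| on a box enlarged by [t];
    this box holds every point that a shift by at most [t] moves into the support of [h]. *)
Lemma sh_integrable i g h M C t : 0 < t -> locally_integrable3 g ->
  measurable_fun setT (h : R3 mR -> mR) -> (forall x, `|h x| <= C) ->
  (forall x, h x != 0 -> box M x) ->
  (lam \x mu)%E.-integrable setT (fun z => (\1_(`[0, t]) z.1 * (g z.2 * h (sh i z.1 z.2)))%:E).
Proof.
move=> t0 lg mh hC hM.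
have mg := loc_int_measurable lg.
have C0 : 0 <= C by exact: le_trans (normr_ge0 _) (hC 0).
have mI : measurable_fun setT (\1_(`[0, t]) : mR -> mR) by exact: measurable_indic.
have I1 : lam.-integrable setT (EFin \o (\1_(`[0, t]) : mR -> R)).
  exact: integrable_indic_itv.
have I2 : mu.-integrable setT (EFin \o (fun x : R3 mR => `|g x * (C * \1_(box (M + t)) x)|)).
  have : mu.-integrable setT (fun x : R3 mR => (g x * (C * \1_(box (M + t)) x))%:E).
    apply: (@integrable_loc_bounded _ g _ (M + t) C) => //.
    - by apply: measurable_funM => //; apply: measurable_indic; exact: measurable_box.
    - move=> x; rewrite normrM (ger0_norm C0) -[leRHS]mulr1 ler_wpM2l//.
      by rewrite indicE; case: (_ \in _); rewrite ?normr1 ?normr0.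
    - move=> x; rewrite indicE; have [/set_mem//|_] := boolP (x \in _).
      by rewrite !mulr0 eqxx.
  by move=> /integrable_abse.
apply: le_integrable (integrable_tensor I1 I2) => //.
  apply/measurable_EFinP; apply: measurable_funM.
    exact: (measurableT_comp mI measurable_fst).
  apply: measurable_funM; first exact: (measurableT_comp mg measurable_snd).
  exact: (measurableT_comp mh (measurable_sh i)).
move=> [s x] _ /=; rewrite lee_fin indicE.
have [/set_mem/=|_] := boolP (s \in _); last by rewrite !mul0r.
rewrite in_itv/= => s0t; rewrite !mul1r normr_id !normrM ler_wpM2l//.
have [->|hx] := eqVneq (h (sh i s x)) 0.
  by rewrite normr0 mulr_ge0.
rewrite indicE mem_set; last exact: box_sh s0t (hM _ hx).
by rewrite normr1 mulr1 (ger0_norm C0).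
Qed.

Lemma shN_integrable i g h M C t : 0 < t -> locally_integrable3 g ->
  measurable_fun setT (h : R3 mR -> mR) -> (forall x, `|h x| <= C) ->
  (forall x, h x != 0 -> box M x) ->
  (lam \x mu)%E.-integrable setT (fun z => (\1_(`[0, t]) z.1 * (g (sh i (- z.1) z.2) * h z.2))%:E).
Proof.
move=> t0 lg mh hC hM; have mg := loc_int_measurable lg.
have mI : measurable_fun setT (\1_(`[0, t]) : mR -> mR) by exact: measurable_indic.
have I := sh_integrable i t0 lg mh hC hM.
apply/integrable12ltyP.
  apply/measurable_EFinP; apply: measurable_funM.
    exact: (measurableT_comp mI measurable_fst).
  apply: measurable_funM; first exact: (measurableT_comp mg (measurable_shN i)).
  exact: (measurableT_comp mh measurable_snd).
have /integrable12ltyP : measurable_fun setT (fun z : mR * R3 mR => (\1_(`[0, t]) z.1 * (g z.2 * h (sh i z.1 z.2)))%:E).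
  exact: measurable_int I.
move=> /(_ lam mu)[/(_ I) + _]; apply: le_lt_trans; rewrite le_eqVlt; apply/orP; left; apply/eqP.
apply: eq_integral => s _.
rewrite -((mpres_sh i s).2 (fun x => `|(\1_(`[0, t]) s * (g (sh i (- s) x) * h x))%:E|%E))//.
  by apply: eq_integral => x _; rewrite shNK.
apply: measurableT_comp => //; apply/measurable_EFinP; apply: measurable_funM => //.
by apply: measurable_funM => //; exact: (measurableT_comp mg (measurable_shs i (- s))).
Qed.

(** The segment runs backwards from [x], because a shift of the test function forwards becomes a
    shift of [g] backwards after a change of variables. *)
Definition pint i g t (x : R3 R) : R := \int[lam]_(s in `[0, t]) g (sh i (- s) x).

Lemma pintE i g t x : (pint i g t x)%:E = (fine (\int[lam]_s (\1_(`[0, t]) s * g (sh i (- s) x))%:E))%:E.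
Proof.
rewrite /pint Rintegral_mkcond; congr (_%:E); congr fine; apply: eq_integral => s _.
by rewrite /patch indicE; case: ifPn => _; rewrite ?mul1r ?mul0r.
Qed.

(** Joint measurability in the length and the point is what later permits exchanging almost every
    [t] with almost every [x]. The moving endpoint is turned into the measurable set 0 <= s <= t,
    and Tonelli's theorem is applied to the positive and negative parts. *)
Lemma measurable_pint i g : measurable_fun setT (g : R3 mR -> mR) ->
  measurable_fun setT (fun z : mR * R3 mR => pint i g z.1 z.2 : mR).
Proof.
move=> mg; pose f (w : mR * R3 mR * mR) : \bar R :=
  (\1_(`[0, w.1.1]) w.2 * g (sh i (- w.2) w.1.2))%:E.
have mf : measurable_fun setT f.
  apply/measurable_EFinP; apply: measurable_funM.
    have -> : (fun w : mR * R3 mR * mR => \1_(`[0, w.1.1]) w.2 : mR) =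
        (\1_([set w : mR * R3 mR * mR | 0 <= w.2 <= w.1.1]) : _ -> mR).
      by apply/funext => w; rewrite !indicE !mem_setE/= in_itv.
    apply: measurable_indic.
    have m1 : measurable_fun setT (fun w : mR * R3 mR * mR => w.1.1 : mR).
      exact: (measurableT_comp measurable_fst measurable_fst).
    have m2 : measurable_fun setT (fun w : mR * R3 mR * mR => w.2 : mR).
      exact: measurable_snd.
    have -> : [set w : mR * R3 mR * mR | 0 <= w.2 <= w.1.1] =
      (fun w : mR * R3 mR * mR => w.2 : mR) @^-1` `[0, +oo[ `&`
      (fun w : mR * R3 mR * mR => w.1.1 - w.2 : mR) @^-1` `[0, +oo[.
      apply/seteqP; split => w /=; rewrite !in_itv/= !andbT subr_ge0.
        by move=> /andP.
      by move=> [-> ->].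
    apply: measurableI.
      by rewrite -[_ @^-1` _]setTI; apply: m2.
    rewrite -[_ @^-1` _]setTI; apply: (measurable_funB m1 m2) => //.
  apply: (measurableT_comp mg).
  have mw : measurable_fun setT (fun w : mR * R3 mR * mR => (w.2, w.1.2) : mR * R3 mR).
    apply/measurable_fun_pairP; split; first exact: measurable_snd.
    exact: (measurableT_comp measurable_snd measurable_fst).
  exact: (measurableT_comp (measurable_shN i) mw).
have E z : pint i g z.1 z.2 = fine (\int[lam]_s f^\+ (z, s) - \int[lam]_s f^\- (z, s)).
  have := pintE i g z.1 z.2 => -[->]; rewrite integralE; congr (fine (_ - _));
  by apply: eq_integral => s _; rewrite ?funeposE ?funenegE.
under eq_fun do rewrite E.
apply: measurableT_comp => //; apply: emeasurable_funB.
  by have := @measurable_fun_fubini_tonelli_F _ _ _ _ _ lam (f^\+)%E (measurable_funepos mf) (funepos_ge0 f).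
by have := @measurable_fun_fubini_tonelli_F _ _ _ _ _ lam (f^\-)%E (measurable_funeneg mf) (funeneg_ge0 f).
Qed.

Lemma pint_loc_int i g t : 0 < t -> locally_integrable3 g -> locally_integrable3 (pint i g t).
Proof.
move=> t0 lg; have mg := loc_int_measurable lg.
have mp : measurable_fun setT (pint i g t : R3 mR -> mR).
  exact: (measurableT_comp (measurable_pint i mg) (measurable_pair1 t)).
apply: loc_intP => // M.
have mb : measurable_fun setT (\1_(box M) : R3 mR -> mR).
  by apply: measurable_indic; exact: measurable_box.
have H : (lam \x mu)%E.-integrable setT
    (fun z => (\1_(`[0, t]) z.1 * (g (sh i (- z.1) z.2) * \1_(box M) z.2))%:E).
  apply: (@shN_integrable i g (\1_(box M)) M 1) => // x; rewrite indicE.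
    by case: (_ \in _); rewrite ?normr1 ?normr0.
  by have [/set_mem//|_] := boolP (x \in _); rewrite eqxx.
apply/(integrable_mkcond _ (measurable_box M)).2; apply/integrableP; split.
  by apply: measurable_patch => //; [exact: measurable_box|exact/measurable_EFinP].
have /integrable21ltyP : measurable_fun setT (fun z : mR * R3 mR =>
    (\1_(`[0, t]) z.1 * (g (sh i (- z.1) z.2) * \1_(box M) z.2))%:E).
  exact: measurable_int H.
move=> /(_ lam mu)[/(_ H) + _]; apply: le_lt_trans.
apply: ge0_le_integral => //.
- apply: measurableT_comp => //.
  by apply: measurable_patch => //; [exact: measurable_box|exact/measurable_EFinP].
- apply: (@measurable_fun_fubini_tonelli_G _ _ _ _ _ lam (fun z => `|(\1_(`[0, t]) z.1 * (g (sh i (- z.1) z.2) * \1_(box M) z.2))%:E|%E)) => //.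
  by apply: measurableT_comp => //; exact: measurable_int H.
move=> x _; rewrite /patch; case: ifPn => xM; last by rewrite abse0 integral_ge0.
rewrite /= indicE xM.
under eq_integral do rewrite mulr1.
have -> : `|pint i g t x|%:E = `|(pint i g t x)%:E|%E by [].
have mgs : measurable_fun setT (fun s : mR => (\1_(`[0, t]) s * g (sh i (- s) x))%:E).
  apply/measurable_EFinP; apply: measurable_funM; first exact: measurable_indic.
  exact: (measurableT_comp mg (measurable_shx i x)).
have := @le_abse_integral _ _ _ lam setT _ measurableT mgs.
rewrite pintE; apply: le_trans.
(* [fine] sends an infinite integral to 0, so the bound holds there as well. *)
case: (\int[lam]_s _)%E => [r| |] //=.
by rewrite normr0 leey.
by rewrite normr0 leey.
Qed.

Lemma is_derive_sh psi i (x : R3 R) (s : R) : smooth psi ->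
  is_derive s (1 : R) (fun s : R => psi (sh i s x)) (partial i psi (sh i s x)).
Proof.
move=> spsi; apply: (@is_derive_along _ _ _ _ psi s 1 (sh i s x) (e3 i)).
  by move=> h; rewrite /sh (_ : h%:A = h) ?scalerDl ?addrA// /GRing.scale/= mulr1.
by apply: DeriveDef => //; exact: smooth_derivable.
Qed.

Lemma continuous_sh i (x : R3 R) : continuous (fun s : R => sh i s x).
Proof.
move=> s; apply: cvgD; last exact: cvg_cst.
by apply: cvgZr_tmp; exact: cvg_id.
Qed.

Lemma smooth_FTC psi i t (x : R3 R) : smooth psi -> 0 < t ->
  (\int[lam]_(s in `[0%R, t]) (partial i psi (sh i s x))%:E = (psi (sh i t x) - psi x)%:E)%E.
Proof.
move=> spsi t0.
have D s := is_derive_sh i x s spsi.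
have dc s : {for s, continuous (fun s : R => psi (sh i s x))}.
  apply: differentiable_continuous; apply/derivable1_diffP.
  exact: (@ex_derive _ _ _ _ _ _ _ (D s)).
rewrite (continuous_FTC2 (F := fun s : R => psi (sh i s x)) t0).
- by rewrite sh0 EFinB.
- apply: continuous_subspaceT => s.
  apply: (@continuous_comp _ _ _ (fun s : R => sh i s x)); first exact: continuous_sh.
  exact: (smooth_continuous (smooth_partial i spsi)).
- split.
  + by move=> s _; exact: (@ex_derive _ _ _ _ _ _ _ (D s)).
  + by apply: cvg_at_right_filter; exact: dc.
  + by apply: cvg_at_left_filter; exact: dc.
- by move=> s _; rewrite derive1E (@derive_val _ _ _ _ _ _ _ (D s)).
Qed.

(** Both sides are compared against a test function psi. Moving the shift onto psi produces psi(. +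
    t e) - psi, which is an integral of derivatives of shifted test functions; the weak derivative
    is used for each shift, and Fubini's theorem moves the result back onto [g]. The exceptional
    null set depends on [t]. *)
Lemma translation_identity i u g t : locally_integrable3 u -> locally_integrable3 g ->
  (forall psi, test_function psi ->
     \int[mu]_x (u x * partial i psi x) = - \int[mu]_x (g x * psi x)) ->
  0 < t -> {ae mu, forall x, u (sh i (- t) x) = u x - pint i g t x}.
Proof.
move=> lu lg H t0.
have mu_ := loc_int_measurable lu; have mg := loc_int_measurable lg.
have mpi : measurable_fun setT (pint i g t : R3 mR -> mR).
  exact: (measurableT_comp (measurable_pint i mg) (measurable_pair1 t)).
have tr_int psi s : test_function psi -> mu.-integrable setT (fun x : R3 mR => (u (sh i (- s) x) * psi x)%:E).
  move=> tpsi; have tp : test_function (fun x => psi (x + s *: e3 i)) by exact: test_translate.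
  have := mpres_integrable (mpres_sh i (- s)) (integrable_test lu tp).
  by congr (_.-integrable _ _); apply/funext => x /=; rewrite addrC -/(sh i s _) shK.
have lut : locally_integrable3 (fun x => u (sh i (- t) x)).
  apply: loc_intP; first exact: (measurableT_comp mu_ (measurable_shs i (- t))).
  move=> M; apply/(integrable_mkcond _ (measurable_box M)).2.
  have I : mu.-integrable setT (fun x : R3 mR => (u x * \1_(box M) (sh i t x))%:E).
    apply: (@integrable_loc_bounded _ u _ (M + t) 1) => //.
    - apply: (measurableT_comp _ (measurable_shs i t)).
      by apply: measurable_indic; exact: measurable_box.
    - by move=> x; rewrite indicE; case: (_ \in _); rewrite ?normr1 ?normr0.
    - move=> x; rewrite indicE; have [/set_mem xM _|_] := boolP (_ \in _); last by rewrite eqxx.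
      by apply: (@box_sh i t t M x) => //; rewrite lexx ltW.
  have := mpres_integrable (mpres_sh i (- t)) I.
  congr (_.-integrable _ _); apply/funext => x /=; rewrite shK /patch indicE.
  by case: ifPn => _; rewrite ?mulr1 ?mulr0.
pose w x := u (sh i (- t) x) - u x + pint i g t x.
have lp := pint_loc_int i t0 lg.
have lw : locally_integrable3 w.
  apply: loc_intP => [|M].
    apply: measurable_funD => //; apply: measurable_funB => //.
    exact: loc_int_measurable lut.
  have mB := @measurable_box R M.
  have -> : EFin \o w = ((EFin \o (fun x => u (sh i (- t) x))) \- (EFin \o u) \+ (EFin \o pint i g t))%E by [].
  by apply: integrableD => //; [apply: integrableB => //|]; exact: loc_int_box.
suff : {ae mu, forall x, w x = 0}.
  by apply: ae_imp => x; rewrite /w => wx; lra.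
apply: fundamental_lemma => // psi tpsi.
have [M M0 HM] := test_box tpsi; have [C C0 HC] := test_bounded tpsi.
have mpsi := test_measurable tpsi.
have tdpsi := test_partial i tpsi.
have [M' M'0 HM'] := test_box tdpsi; have [C' C'0 HC'] := test_bounded tdpsi.
have tpsit s : test_function (fun x => psi (sh i s x)).
  have -> : (fun x => psi (sh i s x)) = (fun x => psi (x + s *: e3 i)).
    by apply/funext => x; rewrite addrC.
  exact: test_translate.
(* integrate the identity u (psi(. + t e) - psi) = u int_0^t d_i psi(. + s e) ds *)
pose Phi (z : mR * R3 mR) : \bar R := (\1_(`[0, t]) z.1 * (u z.2 * partial i psi (sh i z.1 z.2)))%:E.
pose Psi (z : mR * R3 mR) : \bar R := (\1_(`[0, t]) z.1 * (g (sh i (- z.1) z.2) * psi z.2))%:E.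
have IPhi : (lam \x mu)%E.-integrable setT Phi.
  exact: (sh_integrable i t0 lu (test_measurable tdpsi) HC' HM').
have IPsi : (lam \x mu)%E.-integrable setT Psi.
  exact: (shN_integrable i t0 lg mpsi HC HM).
have E1 : (\int[mu]_x ((u (sh i (- t) x) - u x) * psi x)%:E = \int[(lam \x mu)%E]_z Phi z)%E.
  rewrite -(integral21_prod_meas1 IPhi).
  transitivity (\int[mu]_x ((u x * psi (sh i t x))%:E - (u x * psi x)%:E))%E.
    rewrite integralB//; [|exact: integrable_test|exact: integrable_test].
    rewrite -(mpres_integral (mpres_sh i (- t)) (measurable_int _ (integrable_test lu (tpsit t)))).
    rewrite -integralB//; last exact: integrable_test.
      by apply: eq_integral => x _; rewrite shK mulrBl EFinB.
    exact: (mpres_integrable (mpres_sh i (- t)) (integrable_test lu (tpsit t))).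
  apply: eq_integral => x _; rewrite /fubini_G /Phi/=.
  have -> : (\int[lam]_s (\1_(`[0%R, t]) s * (u x * partial i psi (sh i s x)))%:E =
     \int[lam]_(s in `[0%R, t]) ((u x)%:E * (partial i psi (sh i s x))%:E))%E.
    rewrite [RHS]integral_mkcond; apply: eq_integral => s _; rewrite /patch indicE.
    by case: ifPn => _; rewrite ?mul1r ?mul0r.
  have cp : continuous (fun s : R => partial i psi (sh i s x)).
    move=> s; apply: (@continuous_comp _ _ _ (fun s : R => sh i s x)); first exact: continuous_sh.
    exact: (smooth_continuous tdpsi.1).
  rewrite integralZl//; last first.
    apply: continuous_compact_integrable; first exact: segment_compact.
    exact: continuous_subspaceT.
  by rewrite smooth_FTC//; [rewrite -EFinB -EFinM; congr (_%:E); ring|exact: tpsi.1].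
(* For each fixed [s] the shifted psi is again a test function, to which the hypothesis on [u] and
   [g] applies. *)
have E2 : (\int[(lam \x mu)%E]_z Phi z = - \int[(lam \x mu)%E]_z Psi z)%E.
  rewrite -(integral12_prod_meas1 IPhi) -(integral12_prod_meas1 IPsi).
  transitivity (\int[lam]_s (- fubini_F mu Psi s))%E; last first.
    rewrite integralN//; apply: integrable_add_def => //.
    exact: (@integrable_fubini_F _ _ _ _ _ lam mu Psi IPsi).
  apply: eq_integral => s _; rewrite /fubini_F /Phi /Psi/=.
  have [s0t|s0t] := boolP (s \in (`[0, t]%classic : set R)); rewrite !indicE; last first.
    rewrite (negbTE s0t); under eq_integral do rewrite mul0r.
    by under [X in (- X)%E]eq_integral do rewrite mul0r; rewrite integral0 oppe0.
  rewrite s0t; under eq_integral do rewrite mul1r.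
  under [X in (- X)%E]eq_integral do rewrite mul1r.
  have W : \int[mu]_x (u x * partial i psi (sh i s x)) = - \int[mu]_x (g x * psi (sh i s x)).
    by rewrite -(H _ (tpsit s)); apply: eq_Rintegral => x _; rewrite partial_sh.
  have I1 : mu.-integrable setT (fun x : R3 mR => (u x * partial i psi (sh i s x))%:E).
    have -> : (fun x : R3 mR => (u x * partial i psi (sh i s x))%:E) =
        (fun x : R3 mR => (u x * partial i (fun y => psi (sh i s y)) x)%:E).
      by apply/funext => x; rewrite partial_sh.
    exact: (@integrable_test _ u (partial i (fun y => psi (sh i s y))) lu (test_partial i (tpsit s))).
  have I2 : mu.-integrable setT (fun x : R3 mR => (g x * psi (sh i s x))%:E).
    exact: (@integrable_test _ g (fun x => psi (sh i s x)) lg (tpsit s)).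
  have -> : (\int[mu]_x (g (sh i (- s) x) * psi x)%:E = \int[mu]_x (g x * psi (sh i s x))%:E)%E.
    rewrite -[RHS](mpres_integral (mpres_sh i (- s)) (measurable_int _ I2)).
    by apply: eq_integral => x _; rewrite shK.
  rewrite -[LHS]fineK ?(integrable_fin_num _ I1)// -[X in (- X)%E]fineK ?(integrable_fin_num _ I2)//.
  by rewrite -EFinN; congr (_%:E); exact: W.
have E3 : (\int[(lam \x mu)%E]_z Psi z = \int[mu]_x (pint i g t x * psi x)%:E)%E.
  rewrite -(integral21_prod_meas1 IPsi); apply: ae_eq_integral => //.
  - exact: (@measurable_fubini_G _ _ _ _ _ lam mu Psi IPsi).
  - by apply/measurable_EFinP; exact: measurable_funM.
  apply: filterS (ae_integrable2 IPsi) => x; rewrite /fubini_G /Psi/= => Ix _.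
  rewrite EFinM pintE.
  have [->|p0] := eqVneq (psi x) 0.
    by rewrite mule0; under eq_integral do rewrite !mulr0; rewrite integral0.
  have Ix' : lam.-integrable setT (fun s : mR => (\1_(`[0, t]) s * g (sh i (- s) x))%:E).
    have := integrableZl measurableT (psi x)^-1 Ix; congr (_.-integrable _ _).
    by apply/funext => s; rewrite -EFinM; congr (_%:E); field.
  rewrite fineK ?(integrable_fin_num _ Ix')// muleC -integralZl//.
  by apply: eq_integral => s _; rewrite -EFinM; congr (_%:E); ring.
have Iw := integrable_test lw tpsi; rewrite /Rintegral.
have -> : (\int[mu]_x (w x * psi x)%:E = \int[mu]_x (((u (sh i (- t) x) - u x) * psi x)%:E + (pint i g t x * psi x)%:E))%E.
  by apply: eq_integral => x _; rewrite /w mulrDl.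
have I3 := integrable_test lp tpsi.
have I4 : mu.-integrable setT (fun x : R3 mR => ((u (sh i (- t) x) - u x) * psi x)%:E).
  have -> : (fun x : R3 mR => ((u (sh i (- t) x) - u x) * psi x)%:E) =
      ((fun x : R3 mR => (u (sh i (- t) x) * psi x)%:E) \- (fun x : R3 mR => (u x * psi x)%:E))%E.
    by apply/funext => x; rewrite /= mulrBl EFinB.
  by apply: integrableB => //; [exact: tr_int|exact: integrable_test].
rewrite integralD//.
by rewrite E1 E2 E3 addeC subee//; exact: integrable_fin_num I3.
Qed.

(** Absolute continuity for a given representative: along the line it agrees with the continuous one
    only at almost every [t]. The value at [x] itself is kept exact, because |u x| is what the line
    integrals have to bound. *)
Definition line_ac i u g (x : R3 R) :=
  (forall T, lam.-integrable `[0, T] (fun s => (g (sh i (- s) x))%:E)) /\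
  {ae lam, forall t, 0 < t -> u (sh i (- t) x) = u x - pint i g t x}.

Lemma loc_int_line i g : locally_integrable3 g ->
  {ae mu, forall x, forall T, lam.-integrable `[0, T] (fun s => (g (sh i (- s) x))%:E)}.
Proof.
move=> lg.
have H (n : nat) : {ae mu, forall x, box n%:R x ->
    lam.-integrable `[0, n.+1%:R] (fun s => (g (sh i (- s) x))%:E)}.
  have n0 : 0 < n.+1%:R :> R by [].
  have : (lam \x mu)%E.-integrable setT
    (fun z => (\1_(`[0, n.+1%:R]) z.1 * (g (sh i (- z.1) z.2) * \1_(box n%:R) z.2))%:E).
    apply: (@shN_integrable i g (\1_(box n%:R)) n%:R 1) => //.
    - by apply: measurable_indic; exact: measurable_box.
    - by move=> x; rewrite indicE; case: (_ \in _); rewrite ?normr1 ?normr0.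
    - by move=> x; rewrite indicE; have [/set_mem//|_] := boolP (x \in _); rewrite eqxx.
  move=> /ae_integrable2; apply: filterS => x Hx xn.
  apply/integrable_mkcond => //; move: Hx; congr (_.-integrable _ _).
  apply/funext => s; rewrite /= !indicE (mem_set xn) mulr1 /patch.
  by case: ifPn => _; rewrite ?mul1r ?mul0r.
have := ae_foralln H; apply: filterS => x Hx T.
pose n := Num.bound (`|T| + (`|x.1.1| + `|x.1.2| + `|x.2|)).
have B0 : 0 <= `|T| + (`|x.1.1| + `|x.1.2| + `|x.2|) by rewrite !addr_ge0.
have nP : `|T| + (`|x.1.1| + `|x.1.2| + `|x.2|) < n%:R by exact: archi_boundP.
have xn : box n%:R x.
  move=> j; apply: ltW; apply: le_lt_trans nP.
  case: j => [[|[|[|//]]] ?]; rewrite /crd/=; have := normr_ge0 x.1.1;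
   have := normr_ge0 x.1.2; have := normr_ge0 x.2; have := normr_ge0 T; lra.
apply: integrableS (Hx n xn) => //; apply: subset_itvl; rewrite bnd_simp.
rewrite -natr1; have := ler_norm T; have := normr_ge0 x.1.1;
   have := normr_ge0 x.1.2; have := normr_ge0 x.2; lra.
Qed.

(** [translation_identity] holds for every [t] at almost every [x]; by Fubini's theorem almost every
    [x] then has it for almost every [t]. *)
Lemma weak_line_ac i u g : locally_integrable3 u -> locally_integrable3 g ->
  (forall psi, test_function psi ->
     \int[mu]_x (u x * partial i psi x) = - \int[mu]_x (g x * psi x)) ->
  {ae mu, forall x, line_ac i u g x}.
Proof.
move=> lu lg H; have mu_ := loc_int_measurable lu; have mg := loc_int_measurable lg.
pose S := [set z : mR * R3 mR | 0 < z.1 -> u (sh i (- z.1) z.2) = u z.2 - pint i g z.1 z.2].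
have mS : measurable S.
  pose F (z : mR * R3 mR) : mR := \1_(`]0, +oo[) z.1 * (u (sh i (- z.1) z.2) - (u z.2 - pint i g z.1 z.2)).
  have mF : measurable_fun setT F.
    apply: measurable_funM.
      apply: (measurableT_comp _ measurable_fst); exact: measurable_indic.
    apply: measurable_funB; first exact: (measurableT_comp mu_ (measurable_shN i)).
    apply: measurable_funB; first exact: (measurableT_comp mu_ measurable_snd).
    exact: measurable_pint.
  have -> : S = F @^-1` [set 0].
    apply/seteqP; split => z; rewrite /S /F /= indicE.
      have [/set_mem/=|_ _] := boolP (z.1 \in _); last by rewrite mul0r.
      by rewrite in_itv/= andbT => z0 /(_ z0) ->; rewrite subrr mulr0.
    move=> + z0; rewrite mem_set/= ?in_itv/= ?andbT// mul1r => /eqP.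
    by rewrite subr_eq0 => /eqP.
  by rewrite -[_ @^-1` _]setTI; exact: mF.
have aeS s : {ae mu, forall x, S (s, x)}.
  have [s0|s0] := ltP 0 s.
    by have := translation_identity lu lg H s0; apply: ae_imp => x Hx _.
  by apply: aeW => x; rewrite /S/= ltNge s0.
have H1 := @ae_prod_swap _ _ _ _ _ lam mu S mS aeS.
 by apply: ae_imp2 H1 (loc_int_line i lg) => x H1 H2; split.
Qed.

Lemma smooth_line_ac i psi (x : R3 R) : smooth psi -> line_ac i psi (partial i psi) x.
Proof.
move=> spsi; split=> [T|].
  apply: continuous_compact_integrable; first exact: segment_compact.
  apply: continuous_subspaceT => s.
  apply: (@continuous_comp _ _ _ (fun s : R => sh i (- s) x) (partial i psi)).
    apply: (@continuous_comp _ _ _ (-%R : R -> R) (fun s : R => sh i s x)).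
      exact: opp_continuous.
    exact: continuous_sh.
  exact: (smooth_continuous (smooth_partial i spsi)).
apply: aeW => t t0.
have D (s : R) : is_derive s (1 : R) (fun s : R => - psi (sh i (- s) x)) (partial i psi (sh i (- s) x)).
  have H1 := is_derive_sh i x (- s) spsi.
  have H2 : is_derive s (1 : R) (fun s : R => - s) (- 1) by apply: is_deriveNid.
  have := @is_deriveN _ _ _ _ _ _ _ (@is_derive1_comp R (fun s : R => psi (sh i s x)) -%R s _ _ H1 H2).
  by rewrite mulrN1 opprK.
have dc s : {for s, continuous (fun s : R => - psi (sh i (- s) x))}.
  apply: differentiable_continuous; apply/derivable1_diffP.
  exact: (@ex_derive _ _ _ _ _ _ _ (D s)).
rewrite /pint /Rintegral (continuous_FTC2 (F := fun s : R => - psi (sh i (- s) x)) t0) /=.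
- by rewrite oppr0 sh0; ring.
- apply: continuous_subspaceT => s.
  apply: (@continuous_comp _ _ _ (fun s : R => sh i (- s) x) (partial i psi)).
    apply: (@continuous_comp _ _ _ (-%R : R -> R) (fun s : R => sh i s x)).
      exact: opp_continuous.
    exact: continuous_sh.
  exact: (smooth_continuous (smooth_partial i spsi)).
- split.
  + by move=> s _; exact: (@ex_derive _ _ _ _ _ _ _ (D s)).
  + by apply: cvg_at_right_filter; exact: dc.
  + by apply: cvg_at_left_filter; exact: dc.
- by move=> s _; rewrite derive1E (@derive_val _ _ _ _ _ _ _ (D s)).
Qed.

End Lines.

(** * The Loomis-Whitney inequality *)

Section CauchySchwarz.
Local Open Scope ereal_scope.
Context d (T : measurableType d) (R : realType) (mu : {measure set T -> \bar R}).
Implicit Types f g : T -> \bar R.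

Local Notation half := (2^-1)%R.

Let half0 : (half != 0 :> R)%R. Proof. by rewrite invr_eq0. Qed.

Lemma measurable_half f : measurable_fun setT f ->
  measurable_fun setT (fun x => f x `^ half).
Proof. by move=> mf; exact: (measurableT_comp (measurable_poweR _)). Qed.

(** The arithmetic-geometric mean inequality for [l a] and [b / l], in the extended reals because
    line integrals may be infinite. *)
Lemma amgm (a b : \bar R) (l : R) : (0 < l)%R -> 0 <= a -> 0 <= b ->
  a `^ half * b `^ half <= half%:E * (l%:E * a + l^-1%:E * b).
Proof.
move=> l0; have li0 : (0 < l^-1)%R by rewrite invr_gt0.
have h0 : (0 < half :> R)%R by rewrite invr_gt0.
case: a => [a| |//]; case: b => [b| |//]; rewrite ?lee_fin => a0 b0.
- have A : (0 <= l * a)%R by rewrite mulr_ge0// ltW.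
  have B : (0 <= l^-1 * b)%R by rewrite mulr_ge0// ltW.
  have -> : (a `^ half * b `^ half = (l * a) `^ half * (l^-1 * b) `^ half)%R.
    rewrite -!powRM//; congr powR; field; lra.
  set x := ((l * a) `^ half)%R; set y := ((l^-1 * b) `^ half)%R.
  have -> : (l * a = x ^+ 2)%R by rewrite -powR_mulrn ?powR_ge0// -powRrM mulVf// powRr1.
  have -> : (l^-1 * b = y ^+ 2)%R by rewrite -powR_mulrn ?powR_ge0// -powRrM mulVf// powRr1.
  by have := sqr_ge0 (x - y)%R; nra.
- by rewrite (@gt0_muley _ l^-1%:E) ?lte_fin// addey// gt0_muley ?lte_fin// leey.
- by rewrite (@gt0_muley _ l%:E) ?lte_fin// addye// gt0_muley ?lte_fin// leey.
- by rewrite (@gt0_muley _ l%:E) ?lte_fin// (@gt0_muley _ l^-1%:E) ?lte_fin// gt0_muley ?lte_fin// leey.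
Qed.

Lemma integral_sqrt_null f g : measurable_fun setT f -> measurable_fun setT g ->
  (forall x, 0 <= f x) -> \int[mu]_x f x = 0 ->
  \int[mu]_x (f x `^ half * g x `^ half) = 0.
Proof.
move=> mf mg f0 F0.
rewrite (ae_eq_integral (cst 0))//; first by rewrite integral0.
  by apply: emeasurable_funM; exact: measurable_half.
have : ae_eq mu setT f (cst 0).
  by apply/ae_eq_integral_abs => //; under eq_integral do rewrite gee0_abs//.
by apply: filterS => x Hx _; rewrite Hx// poweR0r// mul0e.
Qed.

(** [amgm] is integrated for every weight [l], and then [l] is optimised. Integrals equal to 0 or to
    infinity have no optimal weight and are treated apart. *)
Lemma cauchy_schwarz f g : measurable_fun setT f -> measurable_fun setT g ->
  (forall x, 0 <= f x) -> (forall x, 0 <= g x) ->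
  \int[mu]_x (f x `^ half * g x `^ half) <=
  (\int[mu]_x f x) `^ half * (\int[mu]_x g x) `^ half.
Proof.
move=> mf mg f0 g0.
have F0 : 0 <= \int[mu]_x f x by exact: integral_ge0.
have G0 : 0 <= \int[mu]_x g x by exact: integral_ge0.
have [F00|Fn0] := eqVneq (\int[mu]_x f x) 0.
  by rewrite integral_sqrt_null// mule_ge0 ?poweR_ge0.
have [G00|Gn0] := eqVneq (\int[mu]_x g x) 0.
  under eq_integral do rewrite muleC.
  by rewrite integral_sqrt_null// mule_ge0 ?poweR_ge0.
have AG (l : R) : (0 < l)%R -> \int[mu]_x (f x `^ half * g x `^ half) <=
    half%:E * (l%:E * \int[mu]_x f x + l^-1%:E * \int[mu]_x g x).
  move=> l0; have li0 : (0 <= l^-1)%R by rewrite invr_ge0 ltW.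
  have ml : measurable_fun setT (fun x => l%:E * f x) by exact: measurable_funeM.
  have mli : measurable_fun setT (fun x => l^-1%:E * g x) by exact: measurable_funeM.
  have l0' : 0 <= l%:E by rewrite lee_fin ltW.
  rewrite -ge0_integralZl// -[X in _ + X]ge0_integralZl// -ge0_integralD//; last 2 first.
  - by move=> x _; rewrite mule_ge0.
  - by move=> x _; rewrite mule_ge0.
  rewrite -ge0_integralZl//; last 2 first.
  - exact: emeasurable_funD.
  - by move=> x _; rewrite adde_ge0 ?mule_ge0.
  apply: ge0_le_integral => //.
  - by move=> x _; rewrite mule_ge0 ?poweR_ge0.
  - by apply: emeasurable_funM; exact: measurable_half.
  - by apply: measurable_funeM; exact: emeasurable_funD.
  - by move=> x _; exact: amgm.
have [Foo|Ffin] := eqVneq (\int[mu]_x f x) +oo.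
  by rewrite Foo poweRyr// gt0_mulye ?leey// poweR_gt0// lt0e Gn0.
have [Goo|Gfin] := eqVneq (\int[mu]_x g x) +oo.
  by rewrite Goo poweRyr// gt0_muley ?leey// poweR_gt0// lt0e Fn0.
move: AG; rewrite -[X in X `^ half * _]fineK ?ge0_fin_numE ?ltey// -[X in _ * X `^ half]fineK ?ge0_fin_numE ?ltey//.
have Fp : (0 < fine (\int[mu]_x f x))%R by rewrite fine_gt0// lt0e Fn0 F0 ltey Ffin.
have Gp : (0 < fine (\int[mu]_x g x))%R by rewrite fine_gt0// lt0e Gn0 G0 ltey Gfin.
(* The optimal weight is (G / F)^(1/2). *)
move: Fp Gp; set F := fine _; set G := fine _ => Fp Gp /(_ (F `^ (- half) * G `^ half)%R).
rewrite mulr_gt0 ?powR_gt0// => /(_ isT) H; apply: le_trans H _.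
rewrite -[X in _ * (_ * X + _)]fineK ?ge0_fin_numE ?ltey// -/F.
rewrite -[X in _ * (_ + _ * X)]fineK ?ge0_fin_numE ?ltey// -/G.
rewrite -[leLHS]/((half * ((F `^ (- half) * G `^ half) * F + (F `^ (- half) * G `^ half)^-1 * G))%:E).
rewrite -[leRHS]/((F `^ half * G `^ half)%:E) lee_fin powRN.
have Fh0 : (0 < F `^ half)%R by exact: powR_gt0.
have Gh0 : (0 < G `^ half)%R by exact: powR_gt0.
have FE : (F = (F `^ half) ^+ 2)%R by rewrite -powR_mulrn ?powR_ge0// -powRrM mulVf// powRr1// ltW.
have GE : (G = (G `^ half) ^+ 2)%R by rewrite -powR_mulrn ?powR_ge0// -powRrM mulVf// powRr1// ltW.
rewrite [X in (_ * (_ * X + _))%R]FE [X in (_ * (_ + _ * X))%R]GE.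
move: Fh0 Gh0; move: (F `^ half)%R (G `^ half)%R => x y x0 y0.
have -> : (half * (x^-1 * y * x ^+ 2 + (x^-1 * y)^-1 * y ^+ 2) = x * y :> R)%R.
  by field; rewrite (lt0r_neq0 x0) (lt0r_neq0 y0).
by [].
Qed.

End CauchySchwarz.

Section LoomisWhitney.
Local Open Scope ereal_scope.
Context d1 d2 d3 (T1 : measurableType d1) (T2 : measurableType d2) (T3 : measurableType d3).
Context (R : realType).
Context (m1 : {sigma_finite_measure set T1 -> \bar R}).
Context (m2 : {sigma_finite_measure set T2 -> \bar R}).
Context (m3 : {sigma_finite_measure set T3 -> \bar R}).
Local Notation half := (2^-1)%R.

(** Cauchy-Schwarz in [x], then in [y], then in [z]: at each integration exactly two of the
    remaining factors depend on the variable. *)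
Lemma loomis_whitney (M1 : T2 * T3 -> \bar R) (M2 : T1 * T3 -> \bar R) (M3 : T1 * T2 -> \bar R) :
  measurable_fun setT M1 -> measurable_fun setT M2 -> measurable_fun setT M3 ->
  (forall x, 0 <= M1 x) -> (forall x, 0 <= M2 x) -> (forall x, 0 <= M3 x) ->
  \int[m3]_z \int[m2]_y \int[m1]_x
     (M1 (y, z) `^ half * (M2 (x, z) `^ half * M3 (x, y) `^ half)) <=
  (\int[m2 \x m3]_w M1 w) `^ half *
  ((\int[m1 \x m3]_w M2 w) `^ half * (\int[m1 \x m2]_w M3 w) `^ half).
Proof.
move=> mM1 mM2 mM3 p1 p2 p3.
pose A z := \int[m1]_x M2 (x, z).
pose B y := \int[m1]_x M3 (x, y).
pose C z := \int[m2]_y M1 (y, z).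
have mA : measurable_fun setT A by exact: (@measurable_fun_fubini_tonelli_G _ _ _ _ _ m1 M2).
have mB : measurable_fun setT B by exact: (@measurable_fun_fubini_tonelli_G _ _ _ _ _ m1 M3).
have mC : measurable_fun setT C by exact: (@measurable_fun_fubini_tonelli_G _ _ _ _ _ m2 M1).
have A0 z : 0 <= A z by exact: integral_ge0.
have B0 y : 0 <= B y by exact: integral_ge0.
have C0 z : 0 <= C z by exact: integral_ge0.
have m1z z : measurable_fun setT (fun y => M1 (y, z)) by exact: (measurableT_comp mM1 (measurable_pair2 z)).
have m2z z : measurable_fun setT (fun x => M2 (x, z)) by exact: (measurableT_comp mM2 (measurable_pair2 z)).
have m3y y : measurable_fun setT (fun x => M3 (x, y)) by exact: (measurableT_comp mM3 (measurable_pair2 y)).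
pose H (w : T2 * T3) := \int[m1]_x (M2 (x, w.2) `^ half * M3 (x, w.1) `^ half).
have mH : measurable_fun setT H.
  apply: (@measurable_fun_fubini_tonelli_G _ _ _ (T2 * T3)%type _ m1
    (fun v : T1 * (T2 * T3) => M2 (v.1, v.2.2) `^ half * M3 (v.1, v.2.1) `^ half)).
    apply: emeasurable_funM; apply: measurable_half.
      apply: (measurableT_comp mM2); apply/measurable_fun_pairP; split; first exact: measurable_fst.
      exact: (measurableT_comp measurable_snd measurable_snd).
    apply: (measurableT_comp mM3); apply/measurable_fun_pairP; split; first exact: measurable_fst.
    exact: (measurableT_comp measurable_fst measurable_snd).
  by move=> v; rewrite mule_ge0 ?poweR_ge0.
have H0 w : 0 <= H w by apply: integral_ge0 => x _; rewrite mule_ge0 ?poweR_ge0.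
have E1 y z : \int[m1]_x (M1 (y, z) `^ half * (M2 (x, z) `^ half * M3 (x, y) `^ half)) =
    M1 (y, z) `^ half * H (y, z).
  rewrite ge0_integralZl ?poweR_ge0//.
    by apply: emeasurable_funM; exact: measurable_half.
  by move=> x _; rewrite mule_ge0 ?poweR_ge0.
have S1 y z : H (y, z) <= A z `^ half * B y `^ half by exact: cauchy_schwarz.
have mMH : measurable_fun setT (fun w => M1 w `^ half * H w).
  by apply: emeasurable_funM => //; exact: measurable_half.
have S2 z : \int[m2]_y (M1 (y, z) `^ half * H (y, z)) <=
    A z `^ half * (C z `^ half * (\int[m1 \x m2]_w M3 w) `^ half).
  apply: (@le_trans _ _ (\int[m2]_y (A z `^ half * (M1 (y, z) `^ half * B y `^ half)))).
    apply: ge0_le_integral => //.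
    - by move=> y _; rewrite mule_ge0 ?poweR_ge0.
    - exact: (measurableT_comp mMH (measurable_pair2 z)).
    - by apply: measurable_funeM; apply: emeasurable_funM; exact: measurable_half.
    - by move=> y _; rewrite muleCA; apply: lee_wpmul2l; rewrite ?poweR_ge0.
  rewrite ge0_integralZl ?poweR_ge0//; last 2 first.
  - by apply: emeasurable_funM; exact: measurable_half.
  - by move=> y _; rewrite mule_ge0 ?poweR_ge0.
  apply: lee_wpmul2l; first exact: poweR_ge0.
  rewrite fubini_tonelli2//; exact: cauchy_schwarz.
apply: (@le_trans _ _ (\int[m3]_z (A z `^ half * C z `^ half * (\int[m1 \x m2]_w M3 w) `^ half))).
  apply: ge0_le_integral => //.
  - move=> z _; apply: integral_ge0 => y _; apply: integral_ge0 => x _.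
    by rewrite !mule_ge0 ?poweR_ge0.
  - under eq_fun do (under eq_integral do rewrite E1).
    apply: (@measurable_fun_fubini_tonelli_G _ _ _ _ _ m2 (fun w => M1 w `^ half * H w)) => //.
    by move=> w; rewrite mule_ge0 ?poweR_ge0.
  - apply: emeasurable_funM; last exact: measurable_cst.
    by apply: emeasurable_funM; exact: measurable_half.
  - move=> z _; rewrite -muleA; under eq_integral do rewrite E1; exact: S2.
rewrite ge0_integralZr ?poweR_ge0//; last 2 first.
- by apply: emeasurable_funM; exact: measurable_half.
- by move=> y _; rewrite mule_ge0 ?poweR_ge0.
rewrite [leRHS]muleA; apply: lee_wpmul2r; first exact: poweR_ge0.
rewrite muleC fubini_tonelli2// [X in _ <= _ * X `^ _]fubini_tonelli2//.
exact: cauchy_schwarz.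
Qed.

End LoomisWhitney.

(** * Integrals along lines *)

Section ChainRule.
Context {R : realType}.
Local Notation mR := (measurableTypeR R).
Local Notation lam := (@lebesgue_measure R).
Implicit Types (g v : R -> R) (a b s t T c : R).

Lemma continuous_powR_norm (k : R) : 0 <= k -> continuous (fun x : R => `|x| `^ k).
Proof.
rewrite le_eqVlt => /predU1P[<-|k0] x.
  by under eq_fun do rewrite powRr0; exact: cvg_cst.
have [->|x0] := eqVneq x 0.
  apply/cvgrPdist_lt => e e0; rewrite normr0 powR0 ?gt_eqF//.
  have d0 : 0 < e `^ k^-1 by exact: powR_gt0.
  apply/nbhs_ballP; exists (e `^ k^-1) => //= y.
  rewrite /ball/= !sub0r !normrN => ye; rewrite ger0_norm ?powR_ge0//.
  have -> : e = (e `^ k^-1) `^ k by rewrite -powRrM mulVf ?gt_eqF// powRr1// ltW.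
  by apply: (gt0_ltr_powR k0); rewrite ?nnegrE ?powR_ge0.
apply: (@continuous_comp _ _ _ (fun x : R => `|x|) (fun y => y `^ k)).
  exact: norm_continuous.
apply: differentiable_continuous; apply/derivable1_diffP.
by apply: derivable_powR; rewrite in_itv/= andbT normr_gt0.
Qed.

Lemma powR_tangent_norm (gam a b : R) : 1 <= gam ->
  `|a| `^ gam - `|b| `^ gam <= gam * `|a| `^ (gam - 1) * `|a - b|.
Proof.
move=> g1; have [->|a0] := eqVneq a 0.
  rewrite normr0 powR0 ?sub0r; last by apply/eqP; lra.
  apply: (@le_trans _ _ 0); first by rewrite oppr_le0 powR_ge0.
  by rewrite !mulr_ge0 ?powR_ge0//; lra.
have {}a0 : 0 < `|a| by rewrite normr_gt0.
have := powR_tangent g1 a0 (normr_ge0 b).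
have H : gam * `|a| `^ (gam - 1) * (`|a| - `|b|) <= gam * `|a| `^ (gam - 1) * `|a - b|.
  by rewrite ler_wpM2l ?mulr_ge0 ?powR_ge0 ?lerB_dist//; lra.
by move: H; rewrite !mulrBr; lra.
Qed.

Let subI a b T : 0 <= a -> b <= T -> `]a, b] `<=` `[0, T]%classic.
Proof.
move=> a0 bT s /=; rewrite !in_itv/= => /andP[? ?]; apply/andP; split; lra.
Qed.

Lemma Rint_diff g T a b : lam.-integrable `[0, T] (EFin \o g) -> 0 <= a -> a <= b -> b <= T ->
  \int[lam]_(s in `[0, b]) g s - \int[lam]_(s in `[0, a]) g s = \int[lam]_(s in `]a, b]) g s.
Proof.
move=> ig a0 ab bT; apply: Rintegral_itvB; rewrite ?bnd_simp//.
by apply: integrableS ig => //; apply: subset_itvl; rewrite bnd_simp.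
Qed.

Let near_le (x y z e : R) : `|z - x| < e / 2 -> `|z - y| < e / 2 -> x <= y + e.
Proof. by rewrite !ltr_norml => /andP[? ?] /andP[? ?]; lra. Qed.

Let telescope_le (x y z a b : R) : x - y <= a -> y - z <= b - a -> x - z <= b.
Proof. by lra. Qed.

(** The chain rule for |V|^gam in integrated form, without differentiating [V] almost everywhere: on
    a short interval |V|^(gam-1) is nearly constant, so the tangent inequality bounds the decrease
    of |V|^gam up to a factor eps, and a supremum argument joins the intervals. *)
Lemma line_chain (U0 : R) g (T gam : R) : 1 <= gam -> 0 <= T ->
  lam.-integrable `[0, T] (EFin \o g) ->
  let V t := U0 - \int[lam]_(s in `[0, t]) g s in
  lam.-integrable `[0, T] (EFin \o (fun s => `|V s| `^ (gam - 1) * `|g s|)) /\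
  `|U0| `^ gam <= `|V T| `^ gam + gam * \int[lam]_(s in `[0, T]) (`|V s| `^ (gam - 1) * `|g s|).
Proof.
move=> g1 T0 ig V.
have gam10 : 0 <= gam - 1 by lra.
pose h s := `|V s| `^ (gam - 1).
have cV : {within `[0, T], continuous V}.
  move=> x; apply: (@cvgB _ _ _ _ _ (fun=> U0)); first exact: cvg_cst.
  exact: (parameterized_integral_continuous T0 ig).
have ch : {within `[0, T], continuous h}.
  move=> x; apply: (@cvg_comp _ _ _ V (fun y => `|y| `^ (gam - 1)) _ (nbhs (V x))); first exact: cV.
  exact: continuous_powR_norm.
have mh : measurable_fun `[0, T] h by exact: subspace_continuous_measurable_fun.
have iag : lam.-integrable `[0, T] (EFin \o (fun s => `|g s|)) by exact: integrable_norm.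
have ihg : lam.-integrable `[0, T] (EFin \o (fun s => h s * `|g s|)).
  have := integrableMr (mu := lam) (D := `[0, T]%classic) (measurable_itv _) mh _ iag.
  apply; have /compact_bounded[M [_ HM]] : compact (h @` `[0, T]).
    by apply: continuous_compact => //; exact: segment_compact.
  exists M; split; first exact: num_real.
  by move=> N MN s sT /=; apply: (HM N MN); exists s.
split => //.
(* The error eps int |g| pays for the oscillation of |V|^(gam-1) on the short intervals. *)
suff main eps : 0 < eps -> `|U0| `^ gam - `|V T| `^ gam <=
    gam * (\int[lam]_(s in `[0, T]) (h s * `|g s|) + eps * \int[lam]_(s in `[0, T]) `|g s|).
  rewrite -lerBlDl; apply/ler_addgt0Pr => e e0.
  set N := \int[lam]_(s in `[0, T]) `|g s| in main.
  have N0 : 0 <= N by exact: Rintegral_ge0.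
  have D0 : 0 < gam * (N + 1) by rewrite mulr_gt0//; lra.
  apply: le_trans (main (e / (gam * (N + 1))) _) _; first by rewrite divr_gt0.
  rewrite mulrDr lerD2l mulrA (mulrC gam) -mulrA mulrAC -mulrA.
  by rewrite ger_pMr// ler_pdivrMr// mul1r; nra.
move=> e0.
have iZ : lam.-integrable `[0, T] (EFin \o (fun s => eps * `|g s|)).
  have -> : EFin \o (fun s => eps * `|g s|) = (fun s => eps%:E * (`|g s|)%:E)%E by [].
  exact: integrableZl.
pose w s := h s * `|g s| + eps * `|g s|.
have iw : lam.-integrable `[0, T] (EFin \o w).
  apply: (@integrableD _ _ _ lam _ _ (EFin \o (fun s => h s * `|g s|)) (EFin \o (fun s => eps * `|g s|))) => //.
pose Q t := gam * \int[lam]_(s in `[0, t]) w s.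
have V0 : V 0 = U0 by rewrite /V set_itv1 Rintegral_set1 subr0.
have Q0 : Q 0 = 0 by rewrite /Q set_itv1 Rintegral_set1 mulr0.
have QT : Q T = gam * (\int[lam]_(s in `[0, T]) (h s * `|g s|) + eps * \int[lam]_(s in `[0, T]) `|g s|).
  rewrite /Q; congr (_ * _).
  rewrite RintegralD//.
  by rewrite RintegralZl.
rewrite -QT.
have local c : 0 <= c <= T -> exists2 d, 0 < d & forall s s', 0 <= s -> s <= s' -> s' <= T ->
    c - d < s -> s' < c + d -> `|V s| `^ gam - `|V s'| `^ gam <= Q s' - Q s.
  move=> cT.
  have /cvgrPdist_lt/(_ (eps / 2)) := ch c.
  rewrite divr_gt0// => /(_ isT).
  have cin : `[0, T]%classic c by rewrite /= in_itv.
  move=> Hn; have {}Hn : nbhs (c : subspace `[0, T]) [set r | `|h c - h r| < eps / 2] := Hn.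
  move: Hn; rewrite -[nbhs _]/(nbhs_subspace c) -(nbhs_subspace_in cin).
  move=> /nbhs_ballP[d /= d0 Hd]; exists d => // s s' s0 ss' s'T cs s'c.
  have Hr r : s <= r -> r <= s' -> `|h c - h r| < eps / 2.
    move=> sr rs'; apply: Hd.
      by rewrite /ball/= ltr_norml; apply/andP; split; lra.
    by rewrite /= in_itv/=; apply/andP; split; lra.
  apply: le_trans (powR_tangent_norm _ _ g1) _.
  rewrite -mulrBr -mulrA ler_wpM2l//; first lra.
  have VV : V s - V s' = \int[lam]_(r in `]s, s']) g r.
    by rewrite -(Rint_diff ig s0 ss' s'T) /V; ring.
  rewrite (Rint_diff iw s0 ss' s'T) VV -/(h s).
  have isub f : lam.-integrable `[0, T] (EFin \o f) -> lam.-integrable `]s, s'] (EFin \o f).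
    by move=> H; apply: integrableS H => //; exact: subI.
  apply: (@le_trans _ _ (h s * \int[lam]_(r in `]s, s']) `|g r|)).
    by rewrite ler_wpM2l ?powR_ge0//; apply: le_normr_Rintegral => //; exact: isub.
  rewrite -RintegralZl//; last exact: isub.
  have iHs : lam.-integrable `]s, s'] (EFin \o (fun r => h s * `|g r|)).
    have -> : EFin \o (fun r => h s * `|g r|) = (fun r => (h s)%:E * (`|g r|)%:E)%E by [].
    by apply: integrableZl; [exact: measurable_itv|exact: isub].
  suff hw r : `]s, s']%classic r -> h s * `|g r| <= w r.
    exact: (@le_Rintegral _ _ _ lam `]s, s']%classic (fun r => h s * `|g r|) w (measurable_itv _) iHs (isub _ iw) hw).
  move=> /=; rewrite in_itv/= => /andP[sr rs'].
  rewrite /w -mulrDl ler_wpM2r//.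
  exact: near_le (Hr s (lexx _) ss') (Hr r (ltW sr) rs').
(* From a point of [A] just below its supremum [c], the local estimate leads beyond [c], unless [T]
   is met first. *)
pose A := [set t | 0 <= t <= T /\ `|U0| `^ gam - `|V t| `^ gam <= Q t].
have A0 : A 0 by split; [rewrite lexx|rewrite V0 Q0 subrr].
have supA : has_sup A by split; [exists 0|exists T => t [/andP[]]].
pose c := sup A.
have c0 : 0 <= c by exact: (ub_le_sup supA.2 A0).
have cT : c <= T by apply: ge_sup => //; [exists 0|move=> t [/andP[]]].
have [d d0 Hd] := local c ltac:(apply/andP; split => //).
have [s [sT sA] cs] := sup_adherent d0 supA.
have sc : s <= c by apply: (ub_le_sup supA.2); split.
have [s0 sT'] := andP sT.
pose s' := Num.min T (c + d / 2).
have s's : s <= s' by rewrite le_min sT'/=; lra.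
have s'T : s' <= T by rewrite ge_min lexx.
have s'd : s' < c + d by rewrite gt_min; apply/orP; right; lra.
have As' : A s'.
  split; first by rewrite s'T andbT; exact: le_trans s's.
  exact: telescope_le sA (Hd s s' s0 s's s'T cs s'd).
have : s' <= c by exact: (ub_le_sup supA.2).
have [TE|TE] := leP T (c + d / 2).
  have -> : T = s' by rewrite /s' min_l.
  by move=> _; exact: As'.2.
have -> : s' = c + d / 2 by exact/min_r/ltW.
by rewrite gerDl leNgt divr_gt0.
Qed.

(** Otherwise |v|^k >= e^k almost everywhere on the half-line, and its integral exceeds e^k n for
    every n. The point found serves as an endpoint with a small boundary term. *)
Lemma vanishing_at_infinity (v V : R -> R) (k : R) : 0 < k ->
  measurable_fun setT (v : mR -> mR) ->
  {ae lam, forall t, 0 <= t -> v t = V t} ->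
  (\int[lam]_s (`|v s| `^ k)%:E < +oo)%E ->
  forall e, 0 < e -> exists2 T, 0 < T & `|V T| < e.
Proof.
move=> k0 mv vV fin e e0; apply: contrapT => H.
have {}H T : 0 < T -> e <= `|V T|.
  by move=> T0; rewrite leNgt; apply/negP => VT; apply: H; exists T.
have mvk : measurable_fun setT (fun s : mR => (`|v s| `^ k)%:E).
  apply/measurable_EFinP; apply: (measurableT_comp (measurable_powR k)).
  exact: measurableT_comp.
have I0 : (0 <= \int[lam]_s (`|v s| `^ k)%:E)%E.
  by apply: integral_ge0 => s _; rewrite lee_fin powR_ge0.
have lb (n : nat) : ((e `^ k * n%:R)%:E <= \int[lam]_s (`|v s| `^ k)%:E)%E.
  have E : (\int[lam]_(s in `]0%R, n%:R]) (e `^ k)%:E = (e `^ k * n%:R)%:E)%E.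
    rewrite integral_cst//= lebesgue_measure_itv/= lte_fin.
    by case: ltP => [n0|n0]; rewrite ?sube0//; have -> : n%:R = 0 :> R by apply/eqP; rewrite eq_le n0 ler0n.
  rewrite -E; apply: (@le_trans _ _ (\int[lam]_(s in `]0%R, n%:R]) (`|v s| `^ k)%:E)%E); last first.
    by apply: ge0_subset_integral => // s _; rewrite lee_fin powR_ge0.
  apply: ae_ge0_le_integral => //.
  - by move=> s _; rewrite lee_fin powR_ge0.
  - exact: measurable_funTS.
  move: vV; apply: ae_imp => s vVs; rewrite /= in_itv/= => /andP[s0 _].
  rewrite lee_fin (vVs (ltW s0)); apply: ler_powRl; [exact: ltW|exact: ltW|exact: H].
have F : (\int[lam]_s (`|v s| `^ k)%:E)%E \is a fin_num by rewrite ge0_fin_numE.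
move: lb I0; rewrite -(fineK F); set J := fine _ => lb; rewrite lee_fin => J0.
have ek0 : 0 < e `^ k by exact: powR_gt0.
have B0 : 0 <= J / e `^ k by rewrite divr_ge0// ltW.
have := archi_boundP B0; rewrite ltr_pdivrMr// mulrC.
by have := lb (Num.bound (J / e `^ k)); rewrite lee_fin => /le_lt_trans/[apply]; rewrite ltxx.
Qed.

(** [line_chain] is applied to the continuous representative [V], which starts at [v 0], up to a
    point where |V|^gam <= e; this boundary term then tends to 0. *)
Lemma line_bound (v g : R -> R) (k gam : R) : 0 < k -> 1 <= gam ->
  measurable_fun setT (v : mR -> mR) -> measurable_fun setT (g : mR -> mR) ->
  (forall T, lam.-integrable `[0, T] (EFin \o g)) ->
  {ae lam, forall t, 0 < t -> v t = v 0 - \int[lam]_(s in `[0, t]) g s} ->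
  (\int[lam]_s (`|v s| `^ k)%:E < +oo)%E ->
  ((`|v 0| `^ gam)%:E <= \int[lam]_s (gam * (`|v s| `^ (gam - 1) * `|g s|))%:E)%E.
Proof.
move=> k0 g1 mv mg ig ae0 fin.
pose V t := v 0 - \int[lam]_(s in `[0, t]) g s.
have V0 : V 0 = v 0 by rewrite /V set_itv1 Rintegral_set1 subr0.
have vV : {ae lam, forall t, 0 <= t -> v t = V t}.
  move: ae0; apply: ae_imp => t Ht; rewrite le_eqVlt => /predU1P[<-|/Ht//].
  by rewrite V0.
have mvg : measurable_fun setT (fun s : mR => (gam * (`|v s| `^ (gam - 1) * `|g s|))%:E).
  apply/measurable_EFinP; apply: measurable_funM => //; apply: measurable_funM.
    by apply: (measurableT_comp (measurable_powR _)); exact: measurableT_comp.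
  exact: measurableT_comp.
apply/lee_addgt0Pr => e e0.
have d0 : 0 < e `^ gam^-1 by exact: powR_gt0.
have [T T0 VT] := vanishing_at_infinity k0 mv vV fin d0.
have [iV] := line_chain (v 0) g1 (ltW T0) (ig T); rewrite -/(V T) => H.
have VTe : `|V T| `^ gam <= e.
  have -> : e = (e `^ gam^-1) `^ gam by rewrite -powRrM mulVf ?powRr1 ?ltW//; apply/eqP; lra.
  by apply: ler_powRl => //; [lra|exact: ltW].
apply: (@le_trans _ _ ((gam * \int[lam]_(s in `[0, T]) (`|V s| `^ (gam - 1) * `|g s|))%:E + e%:E)%E).
  by rewrite -EFinD lee_fin; apply: le_trans H _; lra.
rewrite leeD2r//; apply: (@le_trans _ _ (\int[lam]_(s in `[0%R, T]) (gam * (`|v s| `^ (gam - 1) * `|g s|))%:E)%E); last first.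
  apply: ge0_subset_integral => // s _.
  by rewrite lee_fin !mulr_ge0 ?powR_ge0//; lra.
rewrite EFinM /Rintegral fineK; last exact: integrable_fin_num iV.
rewrite -integralZl// le_eqVlt; apply/orP; left; apply/eqP.
apply: ae_eq_integral => //.
- by apply: measurable_funeM; exact: measurable_int iV.
- exact: measurable_funTS.
move: vV; apply: ae_imp => s vVs; rewrite /= in_itv/= => /andP[s0 _].
by rewrite (vVs s0) EFinM.
Qed.

End ChainRule.

(** * Integrals along the lines of R^3 and the Loomis-Whitney inequality for them *)

Section SobolevStep.
Context {R : realType}.
Local Notation mR := (measurableTypeR R).
Local Notation mu := (@mu3 R).
Local Notation lam := (@lebesgue_measure R).
Implicit Types (i : 'I_3).

Lemma mpres_refl (c : R) : mpres lam (fun x : mR => c - x : mR).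
Proof.
have mt : measurable_fun setT (fun x : mR => c - x : mR) by exact: measurable_funB.
split=> // f mf f0.
pose t : {mfun mR >-> mR} := HB.pack (fun x : mR => c - x : mR)
  (isMeasurableFun.Build _ _ _ _ (fun x : mR => c - x : mR) mt).
have := ge0_integral_pushforward mt lam measurableT mf (fun x _ => f0 x).
rewrite preimage_setT => <-.
apply: eq_measure_integral => A mA _; apply/esym.
apply: (@lebesgue_measure_unique R (pushforward lam t)) => // X [[a b] _ <-] /=.
rewrite /pushforward/=.
have -> : t @^-1` `]a, b]%classic = `[c - b, c - a[%classic.
  apply/seteqP; split => x /=; rewrite !in_itv/= => /andP[? ?]; apply/andP; split; lra.
rewrite !lebesgue_measure_itv/= !lte_fin.
have -> : (c - b < c - a) = (a < b) by apply/idP/idP => ?; lra.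
by case: ifP => // _; rewrite -!EFinD; congr (_%:E); ring.
Qed.

Local Open Scope ereal_scope.

Let eq_indic (X Y : Type) (A : set X) (B : set Y) x y : A x = B y -> \1_A x = \1_B y :> R.
Proof.
move=> h; rewrite !indicE; have -> // : (x \in A) = (y \in B).
by apply/idP/idP => /set_mem; [rewrite h|rewrite -h] => /mem_set.
Qed.

Let integral_indic_itv (n : nat) :
  \int[lam]_x (\1_(`[(- n%:R)%R, n%:R%R]%classic : set mR) x)%:E = (2 * n%:R)%:E.
Proof.
rewrite (integral_indic lam measurableT); last exact: measurable_itv.
rewrite setIT.
transitivity (lam [set` `[(- n%:R)%R, n%:R%R]]); first by [].
rewrite lebesgue_measure_itv/= lte_fin.
case: ltP => n0; first by rewrite -EFinB; congr (_%:E); ring.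
by have -> : n%:R = 0%R :> R; [apply/eqP; rewrite eq_le ler0n andbT; lra|rewrite mulr0].
Qed.

Definition line_int i (F : R3 mR -> \bar R) (x : R3 mR) := \int[lam]_s F (sh i (- s) x).

Lemma measurable_line_int i F : measurable_fun setT F -> (forall x, 0 <= F x) ->
  measurable_fun setT (line_int i F).
Proof.
move=> mF F0.
apply: (@measurable_fun_fubini_tonelli_G _ _ _ _ _ lam (fun z : mR * R3 mR => F (sh i (- z.1) z.2))) => //.
exact: (measurableT_comp mF (measurable_shN i)).
Qed.

(** A line integral is constant in direction [i], so it must be localised before it can be
    integrated over the space. On the slab |x_i| <= n its integral is 2n times that of [F], since
    each line meets the slab in length 2n. *)
Lemma line_int_finite i F : measurable_fun setT F -> (forall x, 0 <= F x) ->
  \int[mu]_x F x < +oo -> {ae mu, forall x, line_int i F x < +oo}.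
Proof.
move=> mF F0 fin; have mL := measurable_line_int i mF F0.
pose K (n : nat) : set mR := `[(- n%:R)%R, n%:R%R]%classic.
pose S (n : nat) : set (R3 mR) := crd i @^-1` K n.
have mS n : measurable (S n).
  by rewrite -[S n]setTI; apply: measurable_crd => //; exact: measurable_itv.
pose Phi n (z : mR * R3 mR) := (\1_(S n) z.2)%:E * F (sh i (- z.1) z.2).
have mPhi n : measurable_fun setT (Phi n).
  apply: emeasurable_funM.
    by apply/measurable_EFinP; apply: (measurableT_comp _ measurable_snd); exact: measurable_indic.
  exact: (measurableT_comp mF (measurable_shN i)).
have Phi0 n z : 0 <= Phi n z by rewrite mule_ge0// lee_fin.
have H n : \int[mu]_x ((\1_(S n) x)%:E * line_int i F x) < +oo.
  have -> : \int[mu]_x ((\1_(S n) x)%:E * line_int i F x) = \int[mu]_x \int[lam]_s Phi n (s, x).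
    apply: eq_integral => x _; rewrite /Phi/= ge0_integralZl//.
    exact: (measurableT_comp mF (measurable_shx i x)).
  rewrite -(@fubini_tonelli _ _ _ _ _ lam mu (Phi n))//.
  have -> : \int[lam]_s \int[mu]_x Phi n (s, x) = \int[lam]_s \int[mu]_x ((\1_(S n) (sh i s x))%:E * F x).
    apply: eq_integral => s _.
    rewrite -((mpres_sh i s).2 (fun x => Phi n (s, x)))//.
      by apply: eq_integral => x _; rewrite /Phi/= shNK.
    exact: (measurableT_comp (mPhi n) (measurable_pair1 s)).
  pose Psi (z : mR * R3 mR) := (\1_(S n) (sh i z.1 z.2))%:E * F z.2.
  have mPsi : measurable_fun setT Psi.
    apply: emeasurable_funM; last exact: (measurableT_comp mF measurable_snd).
    apply/measurable_EFinP; apply: (measurableT_comp _ (measurable_sh i)).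
    exact: measurable_indic.
  rewrite (@fubini_tonelli _ _ _ _ _ lam mu Psi)//; last by move=> z; rewrite mule_ge0// lee_fin.
  have E x : \int[lam]_s Psi (s, x) = (2 * n%:R)%:E * F x.
    rewrite /Psi/= ge0_integralZr//; last first.
      apply/measurable_EFinP.
      apply: (@measurableT_comp _ _ _ _ _ _ (\1_(S n) : R3 mR -> mR) _ (fun s : mR => sh i s x : R3 mR)).
        exact: measurable_indic.
      exact: (measurableT_comp (measurable_sh i) (measurable_pair2 x)).
    congr (_ * _).
    have -> : \int[lam]_s (\1_(S n) (sh i s x))%:E = \int[lam]_s (\1_(K n) (s + crd i x)%R)%:E.
      apply: eq_integral => s _; congr (_%:E); apply: eq_indic.
      by rewrite /S/= crd_sh eqxx mul1r.
    rewrite ((mpres_shift (crd i x)).2 (fun s => (\1_(K n) s)%:E))//; last first.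
      by apply/measurable_EFinP; apply: measurable_indic; exact: measurable_itv.
    exact: integral_indic_itv.
  under eq_integral do rewrite E.
  by rewrite ge0_integralZl// lte_mul_pinfty// lee_fin.
have aeS n : {ae mu, forall x, S n x -> line_int i F x < +oo}.
  have iL : mu.-integrable setT (fun x => (\1_(S n) x)%:E * line_int i F x).
    apply/integrableP; split.
      by apply: emeasurable_funM => //; apply/measurable_EFinP; exact: measurable_indic.
    under eq_integral do rewrite gee0_abs ?mule_ge0 ?lee_fin// ?integral_ge0//.
    exact: H.
  have := integrable_ae measurableT iL; apply: ae_imp => x /(_ I) + Sx.
  by rewrite indicE mem_set// mul1e ge0_fin_numE// integral_ge0.
have := ae_foralln aeS; apply: ae_imp => x Hx.
apply: (Hx (Num.bound `|crd i x|)).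
have : (`|crd i x| <= (Num.bound `|crd i x|)%:R)%R by apply: ltW; apply: archi_boundP.
by rewrite ler_norml => ?; rewrite /S /K /preimage /mkset /= in_itv.
Qed.

Local Notation half := (2^-1)%R.

(** [line_int i] is a function of the other two coordinates only, as [loomis_whitney] requires. The
    reflection [mpres_refl] removes the sign and the offset of the line parameter. *)
Lemma line_int_LW (F : 'I_3 -> R3 mR -> \bar R) :
  (forall i, measurable_fun setT (F i)) -> (forall i x, 0 <= F i x) ->
  \int[mu]_x (line_int (@Ordinal 3 0 isT) (F (@Ordinal 3 0 isT)) x `^ half *
     (line_int (@Ordinal 3 1 isT) (F (@Ordinal 3 1 isT)) x `^ half *
      line_int (@Ordinal 3 2 isT) (F (@Ordinal 3 2 isT)) x `^ half)) <=
  (\int[mu]_x F (@Ordinal 3 0 isT) x) `^ half *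
   ((\int[mu]_x F (@Ordinal 3 1 isT) x) `^ half *
    (\int[mu]_x F (@Ordinal 3 2 isT) x) `^ half).
Proof.
move=> mF F0.
pose f0 := F (@Ordinal 3 0 isT); pose f1 := F (@Ordinal 3 1 isT); pose f2 := F (@Ordinal 3 2 isT).
have m0 : measurable_fun setT f0 by exact: mF.
have m1 : measurable_fun setT f1 by exact: mF.
have m2 : measurable_fun setT f2 by exact: mF.
have p0 x : 0 <= f0 x by exact: F0.
have p1 x : 0 <= f1 x by exact: F0.
have p2 x : 0 <= f2 x by exact: F0.
have L0 a b c : line_int (@Ordinal 3 0 isT) f0 (a, b, c) = \int[lam]_t f0 (t, b, c).
  rewrite -((mpres_refl a).2 (fun t => f0 (t, b, c)))//; last first.
    by apply: (measurableT_comp m0); apply: measurable_fun_pair.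
  apply: eq_integral => s _; congr f0; apply: crdP => j; rewrite crd_sh.
  by case: j => [[|[|[|//]]] ?]; rewrite /crd/=; ring.
have L1 a b c : line_int (@Ordinal 3 1 isT) f1 (a, b, c) = \int[lam]_t f1 (a, t, c).
  rewrite -((mpres_refl b).2 (fun t => f1 (a, t, c)))//; last first.
    by apply: (measurableT_comp m1); apply: measurable_fun_pair.
  apply: eq_integral => s _; congr f1; apply: crdP => j; rewrite crd_sh.
  by case: j => [[|[|[|//]]] ?]; rewrite /crd/=; ring.
have L2 a b c : line_int (@Ordinal 3 2 isT) f2 (a, b, c) = \int[lam]_t f2 (a, b, t).
  rewrite -((mpres_refl c).2 (fun t => f2 (a, b, t)))//; last first.
    by apply: (measurableT_comp m2); exact: measurable_fun_pair.
  apply: eq_integral => s _; congr f2; apply: crdP => j; rewrite crd_sh.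
  by case: j => [[|[|[|//]]] ?]; rewrite /crd/=; ring.
have mL0 := measurable_line_int (@Ordinal 3 0 isT) m0 p0.
have mL1 := measurable_line_int (@Ordinal 3 1 isT) m1 p1.
have mL2 := measurable_line_int (@Ordinal 3 2 isT) m2 p2.
pose M1 (w : mR * mR) := \int[lam]_t f0 (t, w.1, w.2).
pose M2 (w : mR * mR) := \int[lam]_t f1 (w.1, t, w.2).
pose M3 (w : mR * mR) := \int[lam]_t f2 (w.1, w.2, t).
have q0 : measurable_fun setT (fun v : mR * (mR * mR) => (v.1, v.2.1, v.2.2) : R3 mR).
  apply/measurable_fun_pairP; split; last exact: (measurableT_comp measurable_snd measurable_snd).
  apply/measurable_fun_pairP; split; first exact: measurable_fst.
  exact: (measurableT_comp measurable_fst measurable_snd).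
have q1 : measurable_fun setT (fun v : mR * (mR * mR) => (v.2.1, v.1, v.2.2) : R3 mR).
  apply/measurable_fun_pairP; split; last exact: (measurableT_comp measurable_snd measurable_snd).
  apply/measurable_fun_pairP; split; last exact: measurable_fst.
  exact: (measurableT_comp measurable_fst measurable_snd).
have mM1 : measurable_fun setT M1.
  apply: (@measurable_fun_fubini_tonelli_G _ _ _ (mR * mR)%type _ lam (fun v : mR * (mR * mR) => f0 (v.1, v.2.1, v.2.2))) => //.
  exact: (measurableT_comp m0 q0).
have mM2 : measurable_fun setT M2.
  apply: (@measurable_fun_fubini_tonelli_G _ _ _ (mR * mR)%type _ lam (fun v : mR * (mR * mR) => f1 (v.2.1, v.1, v.2.2))) => //.
  exact: (measurableT_comp m1 q1).
have mM3 : measurable_fun setT M3.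
  have := @measurable_fun_fubini_tonelli_F _ _ (mR * mR)%type _ _ lam f2 m2 p2.
  by apply: eq_measurable_fun => -[a b] _.
have := @loomis_whitney _ _ _ _ _ _ _ lam lam lam M1 M2 M3 mM1 mM2 mM3.
have M10 w : 0 <= M1 w by exact: integral_ge0.
have M20 w : 0 <= M2 w by exact: integral_ge0.
have M30 w : 0 <= M3 w by exact: integral_ge0.
move=> /(_ M10 M20 M30).
have -> : \int[lam \x lam]_w M1 w = \int[mu]_x f0 x.
  rewrite fubini_tonelli2//.
  have e : \int[mu]_x f0 x = \int[lam]_c \int[(lam \x lam)%E]_w f0 (w, c).
    by rewrite (@fubini_tonelli2 _ _ _ _ _ (prodm lam lam) lam f0).
  rewrite e; apply: eq_integral => c _; rewrite fubini_tonelli2//.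
  exact: (measurableT_comp m0 (measurable_pair2 c)).
have -> : \int[lam \x lam]_w M2 w = \int[mu]_x f1 x.
  rewrite fubini_tonelli2//.
  have e : \int[mu]_x f1 x = \int[lam]_c \int[(lam \x lam)%E]_w f1 (w, c).
    by rewrite (@fubini_tonelli2 _ _ _ _ _ (prodm lam lam) lam f1).
  rewrite e; apply: eq_integral => c _; rewrite fubini_tonelli1//.
  exact: (measurableT_comp m1 (measurable_pair2 c)).
have -> : \int[lam \x lam]_w M3 w = \int[mu]_x f2 x.
  rewrite (@fubini_tonelli1 _ _ _ _ _ (prodm lam lam) lam f2)//.
  by apply: eq_integral => -[a b] _.
apply: le_trans; rewrite le_eqVlt; apply/orP; left; apply/eqP.
pose G x := line_int (@Ordinal 3 0 isT) f0 x `^ half *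
     (line_int (@Ordinal 3 1 isT) f1 x `^ half * line_int (@Ordinal 3 2 isT) f2 x `^ half).
have mG : measurable_fun setT G.
  apply: emeasurable_funM; first exact: measurable_half.
  by apply: emeasurable_funM; exact: measurable_half.
have G0 x : 0 <= G x by rewrite !mule_ge0 ?poweR_ge0.
have e1 := @fubini_tonelli2 _ _ _ _ _ (prodm lam lam) lam G mG G0.
transitivity (\int[lam]_c fubini_G (prodm lam lam) G c); first exact: e1.
apply: eq_integral => c _.
have e2 := @fubini_tonelli2 _ _ _ _ _ lam lam (fun w => G (w, c))
  (measurableT_comp mG (measurable_pair2 c)) (fun w => G0 _).
transitivity (\int[lam]_b fubini_G lam (fun w => G (w, c)) b); first exact: e2.
by apply: eq_integral => b _; apply: eq_integral => a _; rewrite /G L0 L1 L2.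
Qed.

End SobolevStep.

(** * Lebesgue spaces *)

Record lp d (T : measurableType d) (R : realType) (mu : {measure set T -> \bar R})
    (t : R) (f : T -> R) : Prop := Lp {
  lp_measurable : measurable_fun setT (f : T -> measurableTypeR R) ;
  lp_integrable : mu.-integrable setT (EFin \o (fun x => `|f x| `^ t)) }.

(* Locked because unification otherwise compares the underlying integrals. *)
HB.lock Definition nm d (T : measurableType d) (R : realType) (mu : {measure set T -> \bar R})
    (t : R) (f : T -> R) : R := (\int[mu]_x (`|f x| `^ t)) `^ t^-1.

Section LpSpaces.
Context d (T : measurableType d) (R : realType) (mu : {measure set T -> \bar R}).
Local Notation mR := (measurableTypeR R).
Implicit Types (f g h : T -> R) (t a b c k : R).

Lemma Rint_ae_eq f g : measurable_fun setT (f : T -> mR) -> measurable_fun setT (g : T -> mR) ->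
  {ae mu, forall x, f x = g x} -> \int[mu]_x f x = \int[mu]_x g x.
Proof.
move=> mf mg fg; congr fine; apply: ae_eq_integral => //; try exact/measurable_EFinP.
by move: fg; apply: ae_imp => x ->.
Qed.

Lemma integrable_ae_eq f g : measurable_fun setT (g : T -> mR) ->
  {ae mu, forall x, f x = g x} ->
  mu.-integrable setT (EFin \o f) -> mu.-integrable setT (EFin \o g).
Proof.
move=> mg fg /integrableP[mf If]; apply/integrableP; split; first exact/measurable_EFinP.
apply: le_lt_trans If; apply: ae_ge0_le_integral => //.
- by apply: measurableT_comp => //; exact/measurable_EFinP.
- exact: measurableT_comp.
- by move: fg; apply: ae_imp => x /= ->.
Qed.

Lemma Rint_ae_le f g : mu.-integrable setT (EFin \o f) -> mu.-integrable setT (EFin \o g) ->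
  {ae mu, forall x, f x <= g x} -> \int[mu]_x f x <= \int[mu]_x g x.
Proof.
move=> If Ig fg.
have /measurable_EFinP mf := measurable_int _ If.
have /measurable_EFinP mg := measurable_int _ Ig.
(* The minimum lies below [g] at every point, not only at almost every one, as [le_Rintegral]
   requires. *)
have mn : measurable_fun setT (fun x => Num.min (f x) (g x) : mR) by exact: measurable_minr.
have e : {ae mu, forall x, f x = Num.min (f x) (g x)}.
  by move: fg; apply: ae_imp => x fgx; rewrite min_l.
rewrite (Rint_ae_eq mf mn e); apply: le_Rintegral => //.
  exact: integrable_ae_eq e If.
by move=> x _; rewrite ge_min lexx orbT.
Qed.

Lemma integrable_ae_le f g : measurable_fun setT (f : T -> mR) ->
  {ae mu, forall x, `|f x| <= g x} ->
  mu.-integrable setT (EFin \o g) -> mu.-integrable setT (EFin \o f).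
Proof.
move=> mf fg /integrableP[mg Ig]; apply/integrableP; split; first exact/measurable_EFinP.
apply: le_lt_trans Ig; apply: ae_ge0_le_integral => //.
- by apply: measurableT_comp => //; exact/measurable_EFinP.
- exact: measurableT_comp.
- by move: fg; apply: ae_imp => x fgx /= _; rewrite lee_fin (le_trans fgx)// ler_norm.
Qed.

Lemma integrable_add f g : mu.-integrable setT (EFin \o f) -> mu.-integrable setT (EFin \o g) ->
  mu.-integrable setT (EFin \o (fun x => f x + g x)).
Proof. by move=> If Ig; exact: (@integrableD _ _ _ mu _ _ _ _ If Ig). Qed.

Lemma integrable_scale k f : mu.-integrable setT (EFin \o f) ->
  mu.-integrable setT (EFin \o (fun x => k * f x)).
Proof. by move=> If; exact: (@integrableZl _ _ _ mu _ _ k _ If). Qed.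

Lemma Rint_add f g : mu.-integrable setT (EFin \o f) -> mu.-integrable setT (EFin \o g) ->
  \int[mu]_x (f x + g x) = \int[mu]_x f x + \int[mu]_x g x.
Proof. by move=> If Ig; rewrite RintegralD. Qed.

Lemma Rint_lin k f g : mu.-integrable setT (EFin \o f) -> mu.-integrable setT (EFin \o g) ->
  \int[mu]_x (k * f x + g x) = k * \int[mu]_x f x + \int[mu]_x g x.
Proof.
move=> If Ig; rewrite RintegralD//; last exact: integrable_scale.
by rewrite RintegralZl.
Qed.

Lemma Rint_lin2 k c f g : mu.-integrable setT (EFin \o f) -> mu.-integrable setT (EFin \o g) ->
  \int[mu]_x (k * f x + c * g x) = k * \int[mu]_x f x + c * \int[mu]_x g x.
Proof.
move=> If Ig; rewrite Rint_lin//; last exact: integrable_scale.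
by rewrite RintegralZl.
Qed.

Local Notation lp := (lp mu).
Local Notation nm := (nm mu).

Lemma measurable_norm_powR t f : measurable_fun setT (f : T -> mR) ->
  measurable_fun setT (fun x => `|f x| `^ t : mR).
Proof. by move=> mf; apply: (measurableT_comp (measurable_powR t)); exact: measurableT_comp. Qed.

Lemma nm_ge0 t f : 0 <= nm t f. Proof. by rewrite nm.unlock powR_ge0. Qed.
Hint Resolve nm_ge0 : core.

Lemma Iabs_ge0 t f : 0 <= \int[mu]_x (`|f x| `^ t).
Proof. by apply: Rintegral_ge0 => x _; exact: powR_ge0. Qed.

Lemma nm_powR t f : 0 < t -> nm t f `^ t = \int[mu]_x (`|f x| `^ t).
Proof. by move=> t0; rewrite nm.unlock -powRrM mulVf ?gt_eqF// powRr1// Iabs_ge0. Qed.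

Lemma nm_le t f C : 0 < t -> 0 <= C -> \int[mu]_x (`|f x| `^ t) <= C `^ t -> nm t f <= C.
Proof.
move=> t0 C0 H; have -> : C = (C `^ t) `^ t^-1 by rewrite -powRrM mulfV ?gt_eqF// powRr1.
by rewrite nm.unlock; apply: ler_powRl => //; rewrite ?invr_ge0 ?Iabs_ge0// ltW.
Qed.

Lemma lp_ae_le t f g : 0 < t -> measurable_fun setT (f : T -> mR) ->
  {ae mu, forall x, `|f x| <= `|g x|} -> lp t g -> lp t f /\ nm t f <= nm t g.
Proof.
move=> t0 mf fg [mg Ig].
have E : {ae mu, forall x, `|f x| `^ t <= `|g x| `^ t}.
  by move: fg; apply: ae_imp => x; exact/ler_powRl/normr_ge0/ltW.
have If : mu.-integrable setT (EFin \o (fun x => `|f x| `^ t)).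
  apply: integrable_ae_le Ig; first exact: measurable_norm_powR.
  by move: E; apply: ae_imp => x H; rewrite ger0_norm ?powR_ge0.
split; first by split.
apply: nm_le => //; rewrite nm_powR//; exact: Rint_ae_le.
Qed.

Lemma lp_le t f g : 0 < t -> measurable_fun setT (f : T -> mR) ->
  (forall x, `|f x| <= `|g x|) -> lp t g -> lp t f /\ nm t f <= nm t g.
Proof. by move=> t0 mf fg; apply: lp_ae_le => //; exact: aeW. Qed.

Lemma lp_ae_eq t f g : 0 < t -> measurable_fun setT (f : T -> mR) ->
  {ae mu, forall x, f x = g x} -> lp t g -> lp t f /\ nm t f = nm t g.
Proof.
move=> t0 mf fg lg; have [|lf le1] := lp_ae_le t0 mf _ lg; first by move: fg; apply: ae_imp => x ->.
split => //; apply/eqP; rewrite eq_le le1/=.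
by have [|] := lp_ae_le t0 (lp_measurable lg) _ lf; first by move: fg; apply: ae_imp => x ->.
Qed.

Lemma lp_scale t k f : 0 < t -> lp t f ->
  lp t (fun x => k * f x) /\ nm t (fun x => k * f x) = `|k| * nm t f.
Proof.
move=> t0 [mf If].
have E : (fun x => `|k * f x| `^ t) = (fun x => `|k| `^ t * `|f x| `^ t).
  by apply/funext => x; rewrite normrM powRM.
split; first by split; [exact: measurable_funM|rewrite E; exact: integrable_scale].
rewrite nm.unlock E RintegralZl// powRM ?powR_ge0 ?Iabs_ge0//.
by rewrite -powRrM mulfV ?gt_eqF// powRr1.
Qed.

Lemma lp_abs_powR t k f : 0 < t -> 0 < k -> lp (k * t) f ->
  lp t (fun x => `|f x| `^ k) /\ nm t (fun x => `|f x| `^ k) = nm (k * t) f `^ k.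
Proof.
move=> t0 k0 [mf If].
have E : (fun x => `| `|f x| `^ k| `^ t) = (fun x => `|f x| `^ (k * t)).
  by apply/funext => x; rewrite ger0_norm ?powR_ge0// powRrM.
split; first by split; [exact: measurable_norm_powR|rewrite E].
by rewrite nm.unlock E -powRrM invfM mulrAC mulVf ?gt_eqF// mul1r.
Qed.

(* A cheap substitute for Minkowski's inequality; the constant is immaterial. *)
Lemma lp_add t f g : 1 <= t -> lp t f -> lp t g ->
  lp t (fun x => f x + g x) /\ nm t (fun x => f x + g x) <= 4 * (nm t f + nm t g).
Proof.
move=> t1 lf lg; have t0 : 0 < t by lra.
have m1 : measurable_fun setT (fun x => f x + g x : mR) by exact: (measurable_funD (lp_measurable lf) (lp_measurable lg)).
have E x : `|f x + g x| `^ t <= 2 `^ t * `|f x| `^ t + 2 `^ t * `|g x| `^ t.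
  rewrite -!powRM//; apply: le_trans (powR_add_le _ _ _) => //; last exact: ltW.
  by apply: ler_powRl; rewrite ?ler_normD// ltW.
have I1 := integrable_scale (2 `^ t) (lp_integrable lf); have I2 := integrable_scale (2 `^ t) (lp_integrable lg).
have I3 := integrable_add I1 I2.
have I4 : mu.-integrable setT (EFin \o (fun x => `|f x + g x| `^ t)).
  apply: integrable_ae_le I3; first exact: measurable_norm_powR.
  by apply: aeW => x; rewrite ger0_norm ?powR_ge0.
split; first by split.
apply: nm_le; rewrite ?mulr_ge0 ?addr_ge0//.
have H : \int[mu]_x (`|f x + g x| `^ t) <= 2 `^ t * nm t f `^ t + 2 `^ t * nm t g `^ t.
  rewrite !nm_powR// -(Rint_lin2 _ _ (lp_integrable lf) (lp_integrable lg)).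
  exact: le_Rintegral.
apply: le_trans H _; rewrite -mulrDr.
(* This factor 2 and the 2 of the pointwise bound give the constant 4. *)
have sup (x y : R) : 0 <= x -> 0 <= y -> x `^ t + y `^ t <= (2 * (x + y)) `^ t.
  move=> x0 y0; rewrite powRM ?addr_ge0//.
  have xt : x `^ t <= (x + y) `^ t by apply: ler_powRl => //; lra.
  have yt : y `^ t <= (x + y) `^ t by apply: ler_powRl => //; lra.
  have : 2 <= 2 `^ t :> R by rewrite -[leLHS]powRr1//; apply: ler_powR; lra.
  by have := powR_ge0 (x + y) t; nra.
have -> : (4 * (nm t f + nm t g)) `^ t = 2 `^ t * (2 * (nm t f + nm t g)) `^ t.
  by rewrite -powRM ?mulr_ge0 ?addr_ge0// mulrA; congr (_ `^ _); ring.
by rewrite ler_wpM2l ?powR_ge0// sup.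
Qed.

Lemma lp_sub t f g : 1 <= t -> lp t f -> lp t g ->
  lp t (fun x => f x - g x) /\ nm t (fun x => f x - g x) <= 4 * (nm t f + nm t g).
Proof.
move=> t1 lf lg; have t0 : 0 < t by lra.
have [lN nN] := lp_scale (-1) t0 lg.
have e : (fun x => f x - g x) = (fun x => f x + -1 * g x) by apply/funext => x; rewrite mulN1r.
by rewrite e; have := lp_add t1 lf lN; rewrite nN normrN1 mul1r.
Qed.

Lemma nmE t f : 0 < t -> lp t f -> (nm t f)%:E = Lnorm mu t%:E (EFin \o f).
Proof.
move=> t0 [mf If]; rewrite nm.unlock Lnorm.unlock /= -poweR_EFin /Rintegral fineK//.
exact: integrable_fin_num If.
Qed.

Lemma lpP t f : 0 < t -> measurable_fun setT (f : T -> mR) ->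
  (Lnorm mu t%:E (EFin \o f) < +oo)%E -> lp t f.
Proof.
move=> t0 mf; rewrite unlock /= => H; split => //; apply/integrableP; split.
  by apply/measurable_EFinP; exact: measurable_norm_powR.
have -> : (\int[mu]_x `|(EFin \o (fun y => (`|f y| `^ t)%R)) x| = \int[mu]_x `|(EFin \o f) x| `^ t)%E.
  by apply: eq_integral => x _ /=; rewrite ger0_norm ?powR_ge0.
rewrite ltey; apply: contraTneq H => ->.
by rewrite poweRyr ?gt_eqF ?invr_gt0.
Qed.

Lemma lp_of_Lfun t f : 0 < t -> f \in Lfun mu t%:E -> lp t f.
Proof.
move=> t0 /andP[/set_mem mf /set_mem nf]; exact: lpP.
Qed.

Lemma lp_Lfun t f : 0 < t -> lp t f -> f \in Lfun mu t%:E.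
Proof.
move=> t0 lf; apply/andP; split; apply: mem_set; first exact: (lp_measurable lf).
by rewrite /= /finite_norm -nmE// ltry.
Qed.

Lemma hoelder1 a b f g : 0 < a -> 0 < b -> a^-1 + b^-1 = 1 -> lp a f -> lp b g ->
  mu.-integrable setT (EFin \o (fun x => f x * g x)) /\
  \int[mu]_x `|f x * g x| <= nm a f * nm b g.
Proof.
move=> a0 b0 ab lf lg.
have := hoelder mu (lp_measurable lf) (lp_measurable lg) a0 b0 ab.
have mfg : measurable_fun setT (fun x => f x * g x : mR) by exact: (measurable_funM (lp_measurable lf) (lp_measurable lg)).
rewrite -(nmE a0 lf) -(nmE b0 lg) Lnorm1 => H.
have I1 : mu.-integrable setT (EFin \o (fun x => f x * g x)).
  apply/integrableP; split; first exact/measurable_EFinP.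
  exact: le_lt_trans H (ltry _).
split => //; rewrite -lee_fin; apply: le_trans H.
by rewrite /Rintegral fineK//; exact: (integrable_fin_num measurableT (integrable_norm I1)).
Qed.

Lemma hoelder_le a b f g : 0 < a -> 0 < b -> a^-1 + b^-1 = 1 -> lp a f -> lp b g ->
  `|\int[mu]_x (f x * g x)| <= nm a f * nm b g.
Proof.
move=> a0 b0 ab lf lg; have [I1 H] := hoelder1 a0 b0 ab lf lg.
by apply: le_trans H; exact: le_normr_Rintegral.
Qed.

(** Hoelder's inequality for |f|^c and |g|^c with exponents [a / c] and [b / c]. *)
Lemma lp_mul a b c f g : 0 < a -> 0 < b -> 0 < c -> a^-1 + b^-1 = c^-1 -> lp a f -> lp b g ->
  lp c (fun x => f x * g x) /\ nm c (fun x => f x * g x) <= nm a f * nm b g.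
Proof.
move=> a0 b0 c0 abc lf lg.
have ca : c * (a / c) = a by rewrite mulrC divfK ?gt_eqF.
have cb : c * (b / c) = b by rewrite mulrC divfK ?gt_eqF.
have a'0 : 0 < a / c by rewrite divr_gt0.
have b'0 : 0 < b / c by rewrite divr_gt0.
have ab : (a / c)^-1 + (b / c)^-1 = 1 by rewrite !invfM !invrK -mulrDl abc mulVf ?gt_eqF.
have [lf' nf] : lp (a / c) (fun x => `|f x| `^ c) /\ nm (a / c) (fun x => `|f x| `^ c) = nm a f `^ c.
  by have := @lp_abs_powR (a / c) c f a'0 c0; rewrite ca; apply.
have [lg' ng] : lp (b / c) (fun x => `|g x| `^ c) /\ nm (b / c) (fun x => `|g x| `^ c) = nm b g `^ c.
  by have := @lp_abs_powR (b / c) c g b'0 c0; rewrite cb; apply.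
have [I1 H] := hoelder1 a'0 b'0 ab lf' lg'.
have e : (fun x => `|f x * g x| `^ c) = (fun x => `|f x| `^ c * `|g x| `^ c).
  by apply/funext => x; rewrite normrM powRM.
split; first by split; [exact: (measurable_funM (lp_measurable lf) (lp_measurable lg))|rewrite e].
apply: nm_le => //; first exact: mulr_ge0.
rewrite powRM// -nf -ng; apply: le_trans H; rewrite e le_eqVlt; apply/orP; left; apply/eqP.
by apply: eq_Rintegral => x _; rewrite [RHS]ger0_norm// mulr_ge0 ?powR_ge0.
Qed.

(** Comparing y with [n] gives y^t <= n^(t-a) y^a + n^(t-b) y^b. With [n] a common scale of the two
    norms the conclusion is homogeneous, and no logarithmic convexity is involved. *)
Lemma lp_interp a b t f : 0 < a -> a <= t -> t <= b -> lp a f -> lp b f -> forall A B n : R,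
  0 <= A -> 0 <= B -> 0 < n -> nm a f <= A * n -> nm b f <= B * n ->
  lp t f /\ nm t f <= (A `^ a + B `^ b) `^ t^-1 * n.
Proof.
move=> a0 at1 tb lf lf' A B n A0 B0 n0 HA HB.
have t0 : 0 < t by lra. have b0 : 0 < b by lra.
have pt (y : R) : 0 <= y -> y `^ t <= n `^ (t - a) * y `^ a + n `^ (t - b) * y `^ b.
  move=> y0; have [yn|ny] := leP y n.
    rewrite -[leLHS]addr0 lerD ?mulr_ge0 ?powR_ge0//.
    have [->|y1] := eqVneq y 0; first by rewrite !powR0 ?gt_eqF// mulr0.
    have -> : y `^ t = y `^ (t - a) * y `^ a by rewrite -powRD ?subrK// y1 implybT.
    by rewrite ler_wpM2r ?powR_ge0// ler_powRl//; lra.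
  rewrite -[leLHS]add0r lerD ?mulr_ge0 ?powR_ge0//.
  have y1 : y != 0 by rewrite gt_eqF//; lra.
  have -> : y `^ t = y `^ (t - b) * y `^ b by rewrite -powRD ?subrK// y1 implybT.
  by rewrite ler_wpM2r ?powR_ge0//; apply: ler_powRl_neg => //; [lra|exact: ltW].
have Ia := integrable_scale (n `^ (t - a)) (lp_integrable lf).
have Ib := integrable_scale (n `^ (t - b)) (lp_integrable lf').
have Iab := integrable_add Ia Ib.
have It : mu.-integrable setT (EFin \o (fun x => `|f x| `^ t)).
  apply: integrable_ae_le Iab; first exact: (measurable_norm_powR _ (lp_measurable lf)).
  by apply: aeW => x; rewrite ger0_norm ?powR_ge0// pt.
split; first by split; [exact: (lp_measurable lf)|].
apply: nm_le => //; first by rewrite mulr_ge0 ?powR_ge0// ltW.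
rewrite powRM ?powR_ge0 ?(ltW n0)// -powRrM mulVf ?gt_eqF// powRr1 ?addr_ge0 ?powR_ge0//.
have H : \int[mu]_x (`|f x| `^ t) <= n `^ (t - a) * nm a f `^ a + n `^ (t - b) * nm b f `^ b.
  rewrite !nm_powR// -(Rint_lin2 _ _ (lp_integrable lf) (lp_integrable lf')).
  by apply: le_Rintegral => // x _; exact: pt.
apply: (le_trans H).
have nn (c : R) : n `^ (t - c) * n `^ c = n `^ t by rewrite -powRD ?subrK// gt_eqF ?implybT.
rewrite mulrDl -{1}(nn a) -(nn b) lerD//.
  rewrite mulrCA ler_wpM2l ?powR_ge0// -powRM ?ler_powRl// ltW//.
rewrite mulrCA ler_wpM2l ?powR_ge0// -powRM ?ler_powRl// ltW//.
Qed.

End LpSpaces.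
#[global] Hint Resolve nm_ge0 : core.

(** * The Sobolev inequality *)

Section SobolevInequality.
Context {R : realType}.
Local Notation mR := (measurableTypeR R).
Local Notation mu := (@mu3 R).
Local Notation lam := (@lebesgue_measure R).
Implicit Types (i : 'I_3) (u G : R3 mR -> R).

(** Membership in L^k makes the integral of |u|^k finite on almost every line, so that [line_bound]
    applies there. *)
Lemma line_power_bound i u g (k gam : R) : 0 < k -> 1 <= gam ->
  measurable_fun setT (u : R3 mR -> mR) -> measurable_fun setT (g : R3 mR -> mR) ->
  {ae mu, forall x, line_ac i u g x} -> lp mu k u ->
  {ae mu, forall x, ((`|u x| `^ gam)%:E <=
     line_int i (fun y => (gam * (`|u y| `^ (gam - 1) * `|g y|))%:E) x)%E}.
Proof.
move=> k0 g1 mfu mg ac [_ iu].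
have mk : measurable_fun setT (fun x : R3 mR => (`|u x| `^ k)%:E).
  exact: measurable_int iu.
have fin : (\int[mu]_x (`|u x| `^ k)%:E < +oo)%E.
  have /integrableP[_] := iu.
  by under eq_integral do rewrite /= ger0_norm ?powR_ge0//.
have ge0 (x : R3 mR) : (0 <= (`|u x| `^ k)%:E)%E by rewrite lee_fin powR_ge0.
move: ac (line_int_finite i mk ge0 fin); apply: ae_imp2 => x [ix ax] fx.
have mv : measurable_fun setT (fun s : mR => u (sh i (- s) x) : mR).
  exact: (measurableT_comp mfu (measurable_shx i x)).
have mgv : measurable_fun setT (fun s : mR => g (sh i (- s) x) : mR).
  exact: (measurableT_comp mg (measurable_shx i x)).
have := line_bound k0 g1 mv mgv ix _ fx.
by rewrite oppr0 sh0; apply.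
Qed.

(** |u|^(3 gam/2) is the product of the square roots of three copies of |u|^gam, each bounded by the
    line integral in one direction. The Loomis-Whitney inequality bounds its integral by B^(3/2). *)
Lemma sobolev_step u (g : 'I_3 -> R3 mR -> R) G (k gam : R) : 0 < k -> 1 <= gam ->
  measurable_fun setT (u : R3 mR -> mR) ->
  (forall i, measurable_fun setT (g i : R3 mR -> mR)) ->
  (forall i, {ae mu, forall x, line_ac i u (g i) x}) -> lp mu k u ->
  (forall i x, `|g i x| <= G x) ->
  mu.-integrable setT (EFin \o (fun x => `|u x| `^ (gam - 1) * G x)) ->
  lp mu (gam * (3 / 2)) u /\
  nm mu (gam * (3 / 2)) u `^ gam <= gam * \int[mu]_x (`|u x| `^ (gam - 1) * G x).
Proof.
move=> k0 g1 mfu mg ac lu gG iG.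
have G0 x : 0 <= G x by apply: le_trans (gG (@Ordinal 3 0 isT) x).
have gam0 : 0 < gam by lra.
pose B := gam * \int[mu]_x (`|u x| `^ (gam - 1) * G x).
pose F i x := (gam * (`|u x| `^ (gam - 1) * `|g i x|))%:E.
have F0 i x : (0 <= F i x)%E by rewrite lee_fin !mulr_ge0 ?powR_ge0// ltW.
have mF i : measurable_fun setT (F i).
  apply/measurable_EFinP; apply: measurable_funM => //; apply: measurable_funM.
    exact: measurable_norm_powR.
  by apply: (measurableT_comp _ (mg i)).
have B0 : 0 <= B.
  by rewrite mulr_ge0 ?(ltW gam0)//; apply: Rintegral_ge0 => x _; rewrite mulr_ge0 ?powR_ge0.
have FB i : (\int[mu]_x F i x <= B%:E)%E.
  rewrite /B -RintegralZl// /Rintegral fineK; last first.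
    by apply: (integrable_fin_num measurableT); exact: (integrable_scale gam iG).
  apply: ge0_le_integral => //.
  - by apply/measurable_EFinP; apply: measurable_funM => //; apply/measurable_EFinP; exact: measurable_int iG.
  - by move=> x _; rewrite lee_fin !ler_wpM2l ?powR_ge0// ltW.
have LB i := line_power_bound k0 g1 mfu (mg i) (ac i) lu.
pose o0 := @Ordinal 3 0 isT; pose o1 := @Ordinal 3 1 isT; pose o2 := @Ordinal 3 2 isT.
pose P x := (line_int o0 (F o0) x `^ 2^-1 *
     (line_int o1 (F o1) x `^ 2^-1 * line_int o2 (F o2) x `^ 2^-1))%E.
have LI0 i x : (0 <= line_int i (F i) x)%E by exact: integral_ge0.
have mP : measurable_fun setT P.
  have mL i := measurable_line_int i (mF i) (F0 i).
  apply: emeasurable_funM; first exact: measurable_half.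
  by apply: emeasurable_funM; exact: measurable_half.
have pt : {ae mu, forall x, ((`|u x| `^ (gam * (3 / 2)))%:E <= P x)%E}.
  move: (LB o0) (LB o1) (LB o2) => L0 L1 L2.
  have L01 : {ae mu, forall x, ((`|u x| `^ gam)%:E <= line_int o0 (F o0) x)%E /\
     ((`|u x| `^ gam)%:E <= line_int o1 (F o1) x)%E} by move: L0 L1; exact: ae_imp2.
  move: L01 L2; apply: ae_imp2 => x [H0 H1] H2.
  have -> : (`|u x| `^ (gam * (3 / 2)))%:E = ((`|u x| `^ gam)%:E `^ 2^-1 *
      ((`|u x| `^ gam)%:E `^ 2^-1 * (`|u x| `^ gam)%:E `^ 2^-1))%E.
    rewrite poweR_EFin -!EFinM; congr (_%:E).
    have [->|u0] := eqVneq `|u x| 0; first by rewrite !powR0 ?mulr0 ?gt_eqF//; lra.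
    rewrite -!powRrM -!powRD ?u0 ?implybT//; congr (_ `^ _); lra.
  have mono i : ((`|u x| `^ gam)%:E <= line_int i (F i) x)%E ->
      ((`|u x| `^ gam)%:E `^ 2^-1 <= line_int i (F i) x `^ 2^-1)%E.
    by move=> H; apply: gt0_ler_poweR => //; rewrite in_itv/= leey andbT ?lee_fin ?powR_ge0.
  by rewrite lee_pmul ?mule_ge0 ?poweR_ge0// ?mono// lee_pmul ?poweR_ge0// mono.
have mu32 := measurable_norm_powR (gam * (3 / 2)) mfu.
have I1 : (\int[mu]_x (`|u x| `^ (gam * (3 / 2)))%:E <= (B `^ (3 / 2))%:E)%E.
  apply: (@le_trans _ _ (\int[mu]_x P x)%E).
    apply: ae_ge0_le_integral => //.
    - exact/measurable_EFinP.
    - by move=> x _; rewrite !mule_ge0 ?poweR_ge0.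
    - by move: pt; apply: ae_imp.
  apply: le_trans (line_int_LW mF F0) _.
  have -> : (B `^ (3 / 2))%:E = (B%:E `^ 2^-1 * (B%:E `^ 2^-1 * B%:E `^ 2^-1))%E.
    rewrite poweR_EFin -!EFinM; congr (_%:E).
    have [->|b0] := eqVneq B 0; first by rewrite !powR0 ?mulr0 ?gt_eqF//; lra.
    rewrite -!powRD ?b0 ?implybT//; congr (_ `^ _); lra.
  have mono i : ((\int[mu]_x F i x) `^ 2^-1 <= B%:E `^ 2^-1)%E.
    by apply: gt0_ler_poweR => //; rewrite in_itv/= leey andbT ?lee_fin ?integral_ge0.
  by rewrite lee_pmul ?mule_ge0 ?poweR_ge0// lee_pmul ?poweR_ge0.
have lu' : lp mu (gam * (3 / 2)) u.
  split => //; apply/integrableP; split; first exact/measurable_EFinP.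
  under eq_integral do rewrite /= ger0_norm ?powR_ge0//.
  exact: le_lt_trans I1 (ltry _).
split => //.
have H : \int[mu]_x (`|u x| `^ (gam * (3 / 2))) <= B `^ (3 / 2).
  rewrite -lee_fin; apply: le_trans I1; rewrite /Rintegral fineK//.
  exact: (integrable_fin_num measurableT (lp_integrable lu')).
have e : nm mu (gam * (3 / 2)) u `^ gam = (\int[mu]_x (`|u x| `^ (gam * (3 / 2)))) `^ (3 / 2)^-1.
  by rewrite nm.unlock -powRrM; congr (_ `^ _); field; lra.
rewrite e; have -> : gam * \int[mu]_x (`|u x| `^ (gam - 1) * G x) = (B `^ (3 / 2)) `^ (3 / 2)^-1.
  by rewrite -powRrM divff ?powRr1//; lra.
by apply: ler_powRl => //; exact: Iabs_ge0.
Qed.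

End SobolevInequality.

(** * Power functionals on vector fields *)

Section VectorFields.
Context d (T : measurableType d) (R : realType) (mu : {measure set T -> \bar R}).
Local Notation mR := (measurableTypeR R).
Local Notation V3 := 'rV[R]_3.
Implicit Types (f g h : T -> R) (A B H K : T -> V3) (t s a b c k : R).

Definition mvec A := forall i, measurable_fun setT (fun x => A x 0 i : mR).

Lemma mvec_lin k A B : mvec A -> mvec B -> mvec (fun x => k *: A x + B x).
Proof.
move=> mA mB i; under eq_fun do rewrite !mxE.
exact: (measurable_funD (measurable_funM (measurable_cst k) (mA i)) (mB i)).
Qed.

Lemma mvec_sub A B : mvec A -> mvec B -> mvec (fun x => A x - B x).
Proof.
move=> mA mB; have -> : (fun x => A x - B x) = (fun x => -1 *: B x + A x).
  by apply/funext => x; rewrite scaleN1r addrC.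
exact: mvec_lin.
Qed.

Lemma mvec_add A B : mvec A -> mvec B -> mvec (fun x => A x + B x).
Proof.
move=> mA mB; have -> : (fun x => A x + B x) = (fun x => 1 *: A x + B x).
  by apply/funext => x; rewrite scale1r.
exact: mvec_lin.
Qed.

Lemma measurable_edot A B : mvec A -> mvec B ->
  measurable_fun setT (fun x => edot (A x) (B x) : mR).
Proof.
move=> mA mB; apply: (@measurable_sum _ _ _ _ _ (index_enum 'I_3) (fun i x => A x 0 i * B x 0 i)).
by move=> i; exact: (measurable_funM (mA i) (mB i)).
Qed.

Lemma measurable_enorm A : mvec A -> measurable_fun setT (fun x => enorm (A x) : mR).
Proof. 
move=> mA; rewrite (_ : (fun x => _) = (fun x => edot (A x) (A x) `^ 2^-1)).
  by apply: (measurableT_comp (measurable_powR _)); exact: measurable_edot.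
by apply/funext => x; rewrite powR12_sqrt ?edot_ge0.
Qed.

Lemma mvec_scale f A : measurable_fun setT (f : T -> mR) -> mvec A ->
  mvec (fun x => f x *: A x).
Proof. by move=> mf mA i; under eq_fun do rewrite !mxE; exact: (measurable_funM mf (mA i)). Qed.

Lemma mvec_vpow t A : mvec A -> mvec (fun x => vpow t (A x)).
Proof.
move=> mA; apply: mvec_scale => //.
by apply: (measurableT_comp (measurable_powR _)); exact: measurable_enorm.
Qed.

Definition nrm A x := enorm (A x).

Definition lpv t A := mvec A /\ lp mu t (nrm A).

Lemma nrm_abs A x : `|nrm A x| = enorm (A x).
Proof. by rewrite ger0_norm// enorm_ge0. Qed.

Lemma lpv_add t A B : 1 <= t -> lpv t A -> lpv t B -> lpv t (fun x => A x + B x) /\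
  nm mu t (nrm (fun x => A x + B x)) <= 4 * (nm mu t (nrm A) + nm mu t (nrm B)).
Proof.
move=> t1 [mA lA] [mB lB]; have t0 : 0 < t by lra.
have mAB := mvec_add mA mB; have [lAB nAB] := lp_add t1 lA lB.
have [|l n] := lp_le t0 (measurable_enorm mAB) _ lAB.
  move=> x; rewrite ger0_norm ?enorm_ge0// (le_trans (enormD _ _))// ler_norm//.
by split; [split|exact: le_trans nAB].
Qed.

Lemma lpv_scale t k A : 0 < t -> lpv t A -> lpv t (fun x => k *: A x) /\
  nm mu t (nrm (fun x => k *: A x)) = `|k| * nm mu t (nrm A).
Proof.
move=> t0 [mA lA]; have [l n] := lp_scale `|k| t0 lA.
have e : nrm (fun x => k *: A x) = (fun x => `|k| * nrm A x).
  by apply/funext => x; rewrite /nrm enormZ.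
by rewrite /lpv e n normr_id; split=> //; split=> //; apply: mvec_scale.
Qed.

Lemma lpv_sub t A B : 1 <= t -> lpv t A -> lpv t B -> lpv t (fun x => A x - B x) /\
  nm mu t (nrm (fun x => A x - B x)) <= 4 * (nm mu t (nrm A) + nm mu t (nrm B)).
Proof.
move=> t1 lA lB; have t0 : 0 < t by lra.
have [lB' nB'] := lpv_scale (-1) t0 lB.
have e : (fun x => A x - B x) = (fun x => A x + -1 *: B x) by apply/funext => x; rewrite scaleN1r.
by rewrite e; have := lpv_add t1 lA lB'; rewrite nB' normrN1 mul1r.
Qed.

Lemma lp_edot a b A B : 0 < a -> 0 < b -> a^-1 + b^-1 = 1 -> lpv a A -> lpv b B ->
  mu.-integrable setT (EFin \o (fun x => edot (A x) (B x))) /\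
  `|\int[mu]_x edot (A x) (B x)| <= nm mu a (nrm A) * nm mu b (nrm B).
Proof.
move=> a0 b0 ab [mA lA] [mB lB].
have [I1 H1] := hoelder1 a0 b0 ab lA lB.
have me := measurable_edot mA mB.
have I2 : mu.-integrable setT (EFin \o (fun x => edot (A x) (B x))).
  apply: integrable_ae_le (integrable_norm I1) => //.
  by apply: aeW => x /=; rewrite normrM !nrm_abs edot_norm_le.
split => //; apply: le_trans H1; apply: (le_trans (le_normr_Rintegral measurableT I2)).
apply: le_Rintegral => //; [exact: integrable_norm I2|exact: integrable_norm I1|].
by move=> x _; rewrite normrM !nrm_abs edot_norm_le.
Qed.

Lemma lpv_vpow t s A : 0 < t -> 1 < s -> lpv t A -> lpv (t / (s - 1)) (fun x => vpow s (A x)) /\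
  nm mu (t / (s - 1)) (nrm (fun x => vpow s (A x))) = nm mu t (nrm A) `^ (s - 1).
Proof.
move=> t0 s1 [mA lA]; have s10 : 0 < s - 1 by lra.
have e : nrm (fun x => vpow s (A x)) = (fun x => `|nrm A x| `^ (s - 1)).
  by apply/funext => x; rewrite nrm_abs /nrm enorm_vpow.
have := @lp_abs_powR _ _ _ mu (t / (s - 1)) (s - 1) (nrm A).
have -> : (s - 1) * (t / (s - 1)) = t by rewrite mulrC divfK// gt_eqF.
move=> /(_ (divr_gt0 t0 s10) s10 lA)[l n].
by rewrite /lpv e; split => //; split => //; exact: mvec_vpow.
Qed.

Let frac_le (e x : R) : 0 < e -> 0 <= x -> e / (8 * (x + 1)) * x <= e / 8.
Proof.
move=> e0 x0; have -> : e / (8 * (x + 1)) * x = e / 8 * (x / (x + 1)) by field; lra.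
by rewrite ler_piMr ?divr_ge0 ?(ltW e0)// ler_pdivrMr; lra.
Qed.

Let sum_le (e x y : R) : 0 < e -> x <= e / 8 -> y <= e / 8 -> 4 * (x + y) <= e.
Proof. by lra. Qed.

(** Continuity of A |-> V(A) from L^t to L^(t/(s-1)). In [vpow_continuity] the parameter is fixed by
    the norm of [A], and delta afterwards by the resulting constant [C]. The 8 is 2 * 4, where 4 is
    the constant of [lp_add]. *)
Lemma nemytskii t s A : 0 < t -> 1 < s -> s - 1 <= t -> lpv t A ->
  forall e, 0 < e -> exists2 delta, 0 < delta & forall H, lpv t H -> nm mu t (nrm H) < delta ->
    nm mu (t / (s - 1)) (nrm (fun x => vpow s (A x + H x) - vpow s (A x))) <= e.
Proof.
move=> t0 s1 st lA e e0; have s10 : 0 < s - 1 by lra.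
have ts : 1 <= t / (s - 1) by rewrite ler_pdivlMr// mul1r.
have ts0 : 0 < t / (s - 1) by lra.
pose N := nm mu t (nrm A) `^ (s - 1).
have N0 : 0 <= N by exact: powR_ge0.
have eta0 : 0 < e / (8 * (N + 1)) by rewrite divr_gt0//; lra.
have [C C0 HC] := vpow_continuity s1 eta0.
pose delta := (e / (8 * (C + 1))) `^ (s - 1)^-1.
have d0 : 0 < delta by rewrite powR_gt0// divr_gt0//; lra.
exists delta => // H lH nH.
have st1 : (s - 1) * (t / (s - 1)) = t by rewrite mulrC divfK// gt_eqF.
have [lA' nA'] : lp mu (t / (s - 1)) (fun x => `|nrm A x| `^ (s - 1)) /\
    nm mu (t / (s - 1)) (fun x => `|nrm A x| `^ (s - 1)) = N.
  by have := @lp_abs_powR _ _ _ mu (t / (s - 1)) (s - 1) (nrm A) ts0 s10; rewrite st1; apply; case: lA.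
have [lH' nH'] : lp mu (t / (s - 1)) (fun x => `|nrm H x| `^ (s - 1)) /\
    nm mu (t / (s - 1)) (fun x => `|nrm H x| `^ (s - 1)) = nm mu t (nrm H) `^ (s - 1).
  by have := @lp_abs_powR _ _ _ mu (t / (s - 1)) (s - 1) (nrm H) ts0 s10; rewrite st1; apply; case: lH.
have [l1 n1] := lp_scale (e / (8 * (N + 1))) ts0 lA'.
have [l2 n2] := lp_scale C ts0 lH'.
have [l3 n3] := lp_add ts l1 l2.
have mD : mvec (fun x => vpow s (A x + H x) - vpow s (A x)).
  by apply: mvec_sub; apply: mvec_vpow; [apply: mvec_add; [case: lA|case: lH]|case: lA].
have [|_ n4] := lp_le ts0 (measurable_enorm mD) _ l3.
  move=> x; rewrite [X in X <= _]ger0_norm ?enorm_ge0//; apply: le_trans (HC _ _) _.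
  by rewrite !nrm_abs [A x + H x]addrC addrK ler_norm.
apply: le_trans n4 _; apply: le_trans n3 _; rewrite n1 n2 nA' nH'.
rewrite (ger0_norm (ltW eta0)) (ger0_norm C0).
have h1 := frac_le e0 N0.
have h2 : C * nm mu t (nrm H) `^ (s - 1) <= e / 8.
  have hd : delta `^ (s - 1) = e / (8 * (C + 1)).
    by rewrite -powRrM mulVf ?(gt_eqF s10)// powRr1// divr_ge0 ?(ltW e0)// mulr_ge0// addr_ge0.
  apply: (@le_trans _ _ (C * delta `^ (s - 1))).
    by rewrite ler_wpM2l// ler_powRl// ltW.
  by rewrite hd mulrC; exact: frac_le.
exact: sum_le.
Qed.

Let conj_sum t : 1 < t -> (t / (t - 1))^-1 + t^-1 = 1.
Proof. by move=> t1; field; apply/andP; split; apply/eqP; lra. Qed.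

Lemma power_diff t A : 1 < t -> lpv t A -> forall e, 0 < e ->
  exists2 delta, 0 < delta & forall H, lpv t H -> nm mu t (nrm H) < delta ->
    `|\int[mu]_x (enorm (A x + H x) `^ t) - \int[mu]_x (enorm (A x) `^ t)
       - t * \int[mu]_x edot (vpow t (A x)) (H x)| <= e * nm mu t (nrm H).
Proof.
move=> t1 lA e e0; have t0 : 0 < t by lra.
have et0 : 0 < e / t by rewrite divr_gt0.
have [delta d0 Hd] := @nemytskii t t A t0 t1 ltac:(lra) lA _ et0.
exists delta => // H lH nH; have := Hd H lH nH => {}Hd.
have [lAH _] := lpv_add (ltW t1) lA lH.
have [lV _] := lpv_vpow t0 t1 lA; have [lVH _] := lpv_vpow t0 t1 lAH.
have t'1 : 1 <= t / (t - 1) by rewrite ler_pdivlMr; lra.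
have t'0 : 0 < t / (t - 1) by lra.
have [lD _] := lpv_sub t'1 lVH lV.
have [I1 _] := lp_edot t'0 t0 (conj_sum t1) lV lH.
have [I2 H2] := lp_edot t'0 t0 (conj_sum t1) lD lH.
have IA : mu.-integrable setT (EFin \o (fun x => enorm (A x) `^ t)).
  have [_ [_ I]] := lA; have -> // : (fun x => enorm (A x) `^ t) = (fun x => `|nrm A x| `^ t).
  by apply/funext => x; rewrite nrm_abs.
have IAH : mu.-integrable setT (EFin \o (fun x => enorm (A x + H x) `^ t)).
  have [_ [_ I]] := lAH; have -> // : (fun x => enorm (A x + H x) `^ t) = (fun x => `|nrm (fun x => A x + H x) x| `^ t).
  by apply/funext => x; rewrite nrm_abs.
have IA1 := @integrable_scale _ _ _ mu (-1) (fun x => enorm (A x) `^ t) IA.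
have I1t := @integrable_scale _ _ _ mu (- t) (fun x => edot (vpow t (A x)) (H x)) I1.
have IAt := integrable_add IA1 I1t.
have IS := integrable_add IAH IAt.
have -> : \int[mu]_x (enorm (A x + H x) `^ t) - \int[mu]_x (enorm (A x) `^ t)
       - t * \int[mu]_x edot (vpow t (A x)) (H x) =
   \int[mu]_x (enorm (A x + H x) `^ t + (-1 * enorm (A x) `^ t + - t * edot (vpow t (A x)) (H x))).
  by rewrite (Rint_add IAH IAt) (Rint_lin2 _ _ IA I1) mulN1r mulNr addrA.
(* The tangent inequality at [A x] gives the lower bound, the one at [A x + H x] the upper bound. *)
have pt x : 0 <= enorm (A x + H x) `^ t + (-1 * enorm (A x) `^ t + - t * edot (vpow t (A x)) (H x))
    <= t * edot (vpow t (A x + H x) - vpow t (A x)) (H x).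
  have := vpow_convex (A x) (A x + H x) t1; have := vpow_convex (A x + H x) (A x) t1.
  rewrite opprD addrA subrr sub0r [A x + H x]addrC addrK edotBl -scaleN1r edotZr.
  by move=> ? ?; apply/andP; split; lra.
rewrite ger0_norm; last by apply: Rintegral_ge0 => x _; have /andP[] := pt x.
apply: (@le_trans _ _ (t * \int[mu]_x edot (vpow t (A x + H x) - vpow t (A x)) (H x))).
  rewrite -RintegralZl//; apply: le_Rintegral => //; first exact: integrable_scale.
  by move=> x _; have /andP[] := pt x.
apply: (@le_trans _ _ (t * (e / t * nm mu t (nrm H)))).
  rewrite ler_wpM2l ?(ltW t0)//; apply: le_trans (ler_norm _) _; apply: le_trans H2 _.
  by rewrite ler_wpM2r ?nm_ge0.
by rewrite mulrA mulrCA divff ?mulr1// gt_eqF.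
Qed.

Lemma power_diff_cont t A : 1 < t -> lpv t A -> forall e, 0 < e ->
  exists2 delta, 0 < delta & forall H, lpv t H -> nm mu t (nrm H) < delta ->
    forall K, lpv t K ->
    `|\int[mu]_x edot (vpow t (A x + H x)) (K x) - \int[mu]_x edot (vpow t (A x)) (K x)|
       <= e * nm mu t (nrm K).
Proof.
move=> t1 lA e e0; have t0 : 0 < t by lra.
have [delta d0 Hd] := @nemytskii t t A t0 t1 ltac:(lra) lA _ e0.
exists delta => // H lH nH K lK; have := Hd H lH nH => {}Hd.
have [lAH _] := lpv_add (ltW t1) lA lH.
have [lV _] := lpv_vpow t0 t1 lA; have [lVH _] := lpv_vpow t0 t1 lAH.
have t'1 : 1 <= t / (t - 1) by rewrite ler_pdivlMr; lra.
have t'0 : 0 < t / (t - 1) by lra.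
have [lD _] := lpv_sub t'1 lVH lV.
have [I1 _] := lp_edot t'0 t0 (conj_sum t1) lV lK.
have [I2 _] := lp_edot t'0 t0 (conj_sum t1) lVH lK.
have [I3 H3] := lp_edot t'0 t0 (conj_sum t1) lD lK.
have -> : \int[mu]_x edot (vpow t (A x + H x)) (K x) - \int[mu]_x edot (vpow t (A x)) (K x)
    = \int[mu]_x edot (vpow t (A x + H x) - vpow t (A x)) (K x).
  by under [RHS]eq_Rintegral do rewrite edotBl; rewrite RintegralB.
by apply: le_trans H3 _; rewrite ler_wpM2r ?nm_ge0.
Qed.

End VectorFields.

(** * The embedding of W^{1,p} *)

Section WeakGradients.
Context {R : realType}.
Local Notation mR := (measurableTypeR R).
Local Notation mu := (@mu3 R).
Implicit Types (i : 'I_3) (u v w : R3 R -> R) (G H : R3 R -> 'rV[R]_3) (p t : R).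

Lemma wgradP u : weakly_differentiable u -> weak_gradient u (wgrad u).
Proof. exact: xgetPex. Qed.

Lemma loc_int_lin (a : R) v w : locally_integrable3 v -> locally_integrable3 w ->
  locally_integrable3 (fun x => a * v x + w x).
Proof.
move=> lv lw; have mv := loc_int_measurable lv; have mw := loc_int_measurable lw.
apply: loc_intP => [|M].
  exact: (measurable_funD (measurable_funM (measurable_cst a) mv) mw).
have mB := @measurable_box R M.
have Iv := integrableZl mB a (loc_int_box M lv).
exact: (integrableD mB Iv (loc_int_box M lw)).
Qed.

Lemma weak_gradient_lin (a : R) v w G H : weak_gradient v G -> weak_gradient w H ->
  weak_gradient (fun x => a * v x + w x) (fun x => a *: G x + H x).
Proof.
move=> [lv lG HG] [lw lH HH]; split => [|i|psi tpsi i].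
- exact: loc_int_lin.
- rewrite (_ : (fun x => _) = (fun x => a * G x 0 i + H x 0 i)); first exact: loc_int_lin.
  by apply/funext => x; rewrite !mxE.
have tp := test_partial i tpsi.
have EG : \int[mu]_x (v x * partial i psi x) = - \int[mu]_x (G x 0 i * psi x) := HG psi tpsi i.
have EH : \int[mu]_x (w x * partial i psi x) = - \int[mu]_x (H x 0 i * psi x) := HH psi tpsi i.
have -> : (fun x => (a * v x + w x) * partial i psi x) =
    (fun x => a * (v x * partial i psi x) + w x * partial i psi x).
  by apply/funext => x; rewrite mulrDl mulrA.
have -> : (fun x => (a *: G x + H x) 0 i * psi x) =
    (fun x => a * (G x 0 i * psi x) + H x 0 i * psi x).
  by apply/funext => x; rewrite !mxE mulrDl mulrA.
have E1 := Rint_lin a (integrable_test lv tp) (integrable_test lw tp).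
have E2 := Rint_lin a (integrable_test (lG i) tpsi) (integrable_test (lH i) tpsi).
transitivity (a * \int[mu]_x (v x * partial i psi x) + \int[mu]_x (w x * partial i psi x)).
  exact: E1.
rewrite EG EH mulrN -opprD; congr (- _); exact/esym/E2.
Qed.

Lemma weak_gradient_unique u G H : weak_gradient u G -> weak_gradient u H ->
  {ae mu, forall x, G x = H x}.
Proof.
move=> [lu lG HG] [_ lH HH].
have E i : {ae mu, forall x, G x 0 i = H x 0 i}.
  have ld := loc_int_lin (-1) (lH i) (lG i).
  have : {ae mu, forall x, -1 * H x 0 i + G x 0 i = 0}.
    apply: (fundamental_lemma ld) => psi tpsi.
    have -> : (fun x => (-1 * H x 0 i + G x 0 i) * psi x) =
        (fun x => -1 * (H x 0 i * psi x) + G x 0 i * psi x).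
      by apply/funext => x; rewrite mulrDl mulrA.
    have EG : \int[mu]_x (u x * partial i psi x) = - \int[mu]_x (G x 0 i * psi x) := HG psi tpsi i.
    have EH : \int[mu]_x (u x * partial i psi x) = - \int[mu]_x (H x 0 i * psi x) := HH psi tpsi i.
    transitivity (-1 * \int[mu]_x (H x 0 i * psi x) + \int[mu]_x (G x 0 i * psi x)).
      exact: (Rint_lin (-1) (integrable_test (lH i) tpsi) (integrable_test (lG i) tpsi)).
    by rewrite mulN1r -EH EG addNr.
  by apply: ae_imp => x /eqP; rewrite mulN1r addrC subr_eq0 => /eqP.
have E01 : {ae mu, forall x, G x 0 (@Ordinal 3 0 isT) = H x 0 (@Ordinal 3 0 isT) /\
    G x 0 (@Ordinal 3 1 isT) = H x 0 (@Ordinal 3 1 isT)}.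
  by move: (E (@Ordinal 3 0 isT)) (E (@Ordinal 3 1 isT)); exact: ae_imp2.
move: E01 (E (@Ordinal 3 2 isT)); apply: ae_imp2 => x [H0 H1] H2.
apply/rowP => -[[|[|[|//]]] i3].
- by rewrite (_ : Ordinal i3 = @Ordinal 3 0 isT) //; exact: val_inj.
- by rewrite (_ : Ordinal i3 = @Ordinal 3 1 isT) //; exact: val_inj.
- by rewrite (_ : Ordinal i3 = @Ordinal 3 2 isT) //; exact: val_inj.
Qed.

Lemma weakly_differentiable_lin (a : R) v w :
  weakly_differentiable v -> weakly_differentiable w ->
  weakly_differentiable (fun x => a * v x + w x).
Proof.
move=> [G HG] [H HH]; exists (fun x => a *: G x + H x).
exact: weak_gradient_lin.
Qed.

(** Equality holds only almost everywhere, since each of the three gradients is a separately chosen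
    representative. *)
Lemma wgrad_lin (a : R) v w : weakly_differentiable v -> weakly_differentiable w ->
  {ae mu, forall x, wgrad (fun x => a * v x + w x) x = a *: wgrad v x + wgrad w x}.
Proof.
move=> dv dw; apply: weak_gradient_unique (weak_gradient_lin a (wgradP dv) (wgradP dw)).
by apply: wgradP; exact: weakly_differentiable_lin.
Qed.

Lemma mvec_wgrad u : weakly_differentiable u -> mvec (wgrad u : R3 mR -> 'rV[R]_3).
Proof. by move=> /wgradP[_ lG _] i; exact: loc_int_measurable (lG i). Qed.

Lemma W1p_lp p u : 0 < p -> W1p p u -> lp mu p u.
Proof. by move=> p0 [lu _ _]; exact: (@lp_of_Lfun _ _ _ mu p u p0 lu). Qed.

Lemma W1p_lpv p u : 0 < p -> W1p p u -> lpv mu p (wgrad u).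
Proof.
move=> p0 [_ du lg]; split; first exact: mvec_wgrad.
exact: (@lp_of_Lfun _ _ _ mu p (nrm (wgrad u)) p0 lg).
Qed.

Lemma nrm_powR_integrable p G : lpv mu p G ->
  mu.-integrable setT (EFin \o (fun x => enorm (G x) `^ p)).
Proof.
move=> [_ [_ I]]; have -> // : (fun x => enorm (G x) `^ p) = (fun x => `|nrm G x| `^ p).
by apply/funext => x; rewrite nrm_abs.
Qed.

Lemma nm_nrm p G : 0 < p -> nm mu p (nrm G) `^ p = \int[mu]_x (enorm (G x) `^ p).
Proof.
move=> p0; apply: etrans (nm_powR mu (nrm G) p0) _.
by apply: eq_Rintegral => x _; rewrite nrm_abs.
Qed.

Lemma normW1p_powR p u : 0 < p -> W1p p u ->
  normW1p p u `^ p = nm mu p (nrm (wgrad u)) `^ p + nm mu p u `^ p.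
Proof.
move=> p0 wu; have lu := W1p_lp p0 wu; have lg := W1p_lpv p0 wu.
have -> : normW1p p u `^ p = \int[mu]_x (enorm (wgrad u x) `^ p + `|u x| `^ p).
  rewrite /normW1p -powRrM mulVf ?gt_eqF// powRr1//.
  by apply: Rintegral_ge0 => x _; rewrite addr_ge0 ?powR_ge0.
by rewrite nm_nrm// nm_powR// (Rint_add (nrm_powR_integrable lg) (lp_integrable lu)).
Qed.

Lemma normW1p_ge0 p u : 0 <= normW1p p u. Proof. exact: powR_ge0. Qed.

Lemma le_powRK p (a b : R) : 0 < p -> 0 <= a -> 0 <= b -> a `^ p <= b `^ p -> a <= b.
Proof.
move=> p0 a0 b0; rewrite !leNgt; apply: contra => ba.
exact: (gt0_ltr_powR p0).
Qed.

Lemma nm_le_normW1p p u : 0 < p -> W1p p u -> nm mu p u <= normW1p p u.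
Proof.
move=> p0 wu; apply: (le_powRK p0); rewrite ?normW1p_ge0// ?nm_ge0//.
by rewrite normW1p_powR// lerDr powR_ge0.
Qed.

Lemma nm_wgrad_le_normW1p p u : 0 < p -> W1p p u -> nm mu p (nrm (wgrad u)) <= normW1p p u.
Proof.
move=> p0 wu; apply: (le_powRK p0); rewrite ?normW1p_ge0// ?nm_ge0//.
by rewrite normW1p_powR// lerDl powR_ge0.
Qed.

Lemma lpv_ae_eq p G H : 0 < p -> mvec (G : R3 mR -> _) -> {ae mu, forall x, G x = H x} -> lpv mu p H ->
  lpv mu p G /\ nm mu p (nrm G) = nm mu p (nrm H).
Proof.
move=> p0 mG GH [mH lH].
have e : {ae mu, forall x, nrm G x = nrm H x} by move: GH; apply: ae_imp => x; rewrite /nrm => ->.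
by have [l ->] := lp_ae_eq p0 (measurable_enorm mG) e lH.
Qed.

Lemma W1p_lin p (a : R) v w : 1 <= p -> W1p p v -> W1p p w -> W1p p (fun x => a * v x + w x).
Proof.
move=> p1 wv ww; have p0 : 0 < p by lra.
have [_ dv _] := wv; have [_ dw _] := ww.
have d := weakly_differentiable_lin a dv dw.
split => //.
  have [l1 _] := lp_scale a p0 (W1p_lp p0 wv).
  have [l2 _] := lp_add p1 l1 (W1p_lp p0 ww).
  exact: (@lp_Lfun _ _ _ mu p _ p0 l2).
have [l1 _] := lpv_scale a p0 (W1p_lpv p0 wv).
have [l2 _] := lpv_add p1 l1 (W1p_lpv p0 ww).
have [[_ l3] _] := lpv_ae_eq p0 (mvec_wgrad d) (wgrad_lin a dv dw) l2.
exact: (@lp_Lfun _ _ _ mu p (nrm (wgrad (fun x => a * v x + w x))) p0 l3).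
Qed.

Lemma W1p_line_ac p u i : W1p p u ->
  {ae mu, forall x, line_ac i u (fun x => wgrad u x 0 i) x}.
Proof.
move=> [_ du _]; have [lu lg H] := wgradP du.
by apply: weak_line_ac => // psi tpsi; exact: H.
Qed.

(** Isolated as a property of the exponent, so that the gain of integrability can be iterated by
    induction. *)
Definition embedded p t := exists2 C : R, 0 <= C & forall u, W1p p u ->
  lp mu t u /\ nm mu t u <= C * normW1p p u.

Lemma embedded_base p : 0 < p -> embedded p p.
Proof.
move=> p0; exists 1 => // u wu; rewrite mul1r.
by split; [exact: W1p_lp|exact: nm_le_normW1p].
Qed.

(** With gam = 1 + t/p' the power |u|^(gam-1) of a function in L^t lies in L^{p'}, the dual of the
    space of the gradient; [sobolev_step] then yields the exponent 3 gam/2. *)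
Lemma embedded_step p t : 1 < p -> 0 < t -> embedded p t ->
  embedded p (3 / 2 + 3 * (p - 1) / (2 * p) * t).
Proof.
move=> p1 t0 [C C0 HC]; have p0 : 0 < p by lra.
have p10 : 0 < p - 1 by lra.
pose p' := p / (p - 1).
have p'0 : 0 < p' by rewrite divr_gt0.
have pp' : p'^-1 + p^-1 = 1 by rewrite /p'; field; rewrite !gt_eqF.
pose gam := 1 + t / p'.
have tp'0 : 0 < t / p' by rewrite divr_gt0.
have g1 : 1 <= gam by rewrite /gam; lra.
have g0 : 0 < gam by lra.
have -> : 3 / 2 + 3 * (p - 1) / (2 * p) * t = gam * (3 / 2).
  by rewrite /gam /p'; field; rewrite !gt_eqF.
exists ((gam * C `^ (gam - 1)) `^ gam^-1); first exact: powR_ge0.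
move=> u wu; have [lu nu] := HC u wu; have lg := W1p_lpv p0 wu.
have gt : gam - 1 = t / p' by rewrite /gam; ring.
have [lP nP] : lp mu p' (fun x => `|u x| `^ (gam - 1)) /\
    nm mu p' (fun x => `|u x| `^ (gam - 1)) = nm mu t u `^ (gam - 1).
  have := @lp_abs_powR _ _ _ mu p' (gam - 1) u p'0; rewrite gt divfK ?gt_eqF//.
  exact.
have [IG HG] := hoelder1 p'0 p0 pp' lP lg.2.
have [_ du _] := wu.
have ac i := W1p_line_ac i wu.
have cG i (x : R3 mR) : `|wgrad u x 0 i| <= nrm (wgrad u) x by exact: abs_coord_le.
have [l n] := sobolev_step t0 g1 (lp_measurable lu) (mvec_wgrad du) ac lu cG IG.
split => //; apply: (le_powRK g0); rewrite ?mulr_ge0 ?powR_ge0 ?nm_ge0//.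
apply: le_trans n _; rewrite powRM ?powR_ge0//.
rewrite -powRrM mulVf ?gt_eqF// powRr1 ?mulr_ge0 ?powR_ge0 ?(ltW g0)//.
rewrite -mulrA ler_wpM2l ?(ltW g0)//.
have N0 := normW1p_ge0 p u.
have -> : normW1p p u `^ gam = normW1p p u `^ (gam - 1) * normW1p p u.
  have [->|Nn] := eqVneq (normW1p p u) 0; first by rewrite mulr0 powR0 ?gt_eqF.
  by rewrite -{3}(powRr1 N0) -powRD ?subrK// Nn implybT.
apply: (@le_trans _ _ (nm mu t u `^ (gam - 1) * nm mu p (nrm (wgrad u)))).
  rewrite -nP; apply: le_trans HG; rewrite le_eqVlt; apply/orP; left; apply/eqP.
  by apply: eq_Rintegral => x _; rewrite [RHS]ger0_norm// mulr_ge0 ?powR_ge0 ?enorm_ge0.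
rewrite mulrA ler_pM ?powR_ge0 ?nm_ge0 ?nm_wgrad_le_normW1p//.
by rewrite -powRM// ler_powRl ?nm_ge0//; lra.
Qed.

Lemma sobolev_exp_gt p : 0 < p < 3 -> p < sobolev_exp p.
Proof. by move=> /andP[p0 p3]; rewrite /sobolev_exp ltr_pdivlMr; nra. Qed.

(** The map of exponents t |-> 3/2 + kap t has fixed point p^* and slope [kap] below 1 because
    [p < 3], so n steps from p leave the distance kap^n (p^* - p) to the fixed point. Once an
    exponent beyond [t] is reached, interpolation with L^p gives [t]. *)
Lemma sobolev_embedding p t : 1 < p < 3 -> p <= t < sobolev_exp p -> embedded p t.
Proof.
move=> /andP[p1 p3] /andP[pt tp]; have p0 : 0 < p by lra.
pose ps := sobolev_exp p; pose kap := 3 * (p - 1) / (2 * p).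
have pps : p < ps by apply: sobolev_exp_gt; rewrite p0.
have k0 : 0 < kap by rewrite /kap divr_gt0//; lra.
have k1 : kap < 1 by rewrite /kap ltr_pdivrMr; lra.
have fixp : 3 / 2 + kap * ps = ps.
  by rewrite /kap /ps /sobolev_exp; field; rewrite !gt_eqF//; lra.
have it n : embedded p (ps - kap ^+ n * (ps - p)).
  elim: n => [|n IH]; first by rewrite expr0 mul1r subKr; exact: embedded_base.
  have -> : ps - kap ^+ n.+1 * (ps - p) = 3 / 2 + kap * (ps - kap ^+ n * (ps - p)).
    by rewrite [kap * (_ - _)]mulrBr addrA fixp exprS mulrA.
  apply: embedded_step => //.
  have : kap ^+ n <= 1 by apply: exprn_ile1; rewrite ltW.
  by have : 0 < kap ^+ n by [exact: exprn_gt0]; nra.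
have [n kn] : exists n, kap ^+ n * (ps - p) < ps - t.
  have : kap ^+ n @[n --> \oo] --> (0 : R) by apply: cvg_expr; rewrite ger0_norm ?ltW.
  move=> /cvgrPdist_lt/(_ ((ps - t) / (ps - p))); rewrite divr_gt0 ?subr_gt0// => /(_ isT)[N _ HN].
  exists N; have := HN N (leqnn _); rewrite /= sub0r normrN ger0_norm ?exprn_ge0 ?(ltW k0)//.
  by rewrite ltr_pdivlMr ?subr_gt0.
have [C C0 HC] := it n; set b := ps - _ in HC.
have tb : t <= b by rewrite /b; lra.
exists ((1 `^ p + C `^ b) `^ t^-1); first exact: powR_ge0.
move=> u wu; have [lb nb] := HC u wu; have la := W1p_lp p0 wu.
(* [lp_interp] needs a positive scale, whereas the norm of [u] may be 0; the added [e] is sent to 0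
   below. *)
have Hn e : 0 < e -> lp mu t u /\ nm mu t u <= (1 `^ p + C `^ b) `^ t^-1 * (normW1p p u + e).
  move=> e0; have N0 := normW1p_ge0 p u.
  apply: (lp_interp p0 pt tb la lb) => //; first lra.
    by rewrite mul1r; have := nm_le_normW1p p0 wu; lra.
  by apply: le_trans nb _; rewrite ler_wpM2l// lerDl ltW.
split; first by have [] := Hn 1 ltr01.
set K := _ `^ t^-1 in Hn *; have K0 : 0 <= K by exact: powR_ge0.
apply/ler_addgt0Pr => e e0.
have [|_ H] := Hn (e / (K + 1)); first by rewrite divr_gt0//; lra.
apply: le_trans H _; rewrite mulrDr lerD2l mulrCA ler_piMr ?(ltW e0)//.
by rewrite ler_pdivrMr; lra.
Qed.

End WeakGradients.

(** * The space D^{1,q} *)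

Section TestLp.
Context {R : realType}.
Local Notation mR := (measurableTypeR R).
Local Notation mu := (@mu3 R).
Local Notation lam := (@lebesgue_measure R).
Implicit Types (i : 'I_3) (u v w psi : R3 R -> R) (t : R).

(** In substance, boxes have finite measure. The case [c = 1] makes bounded functions of bounded
    support integrable. *)
Lemma loc_int_cst (c : R) : locally_integrable3 (fun _ : R3 R => c).
Proof.
apply: loc_intP => [|M]; first exact: measurable_cst.
pose I : set mR := `[- M, M]%classic.
have mI : measurable I by exact: measurable_itv.
pose one : mR -> R := \1_I.
have i1 : lam.-integrable setT (EFin \o one).
  exact: integrable_indic_itv.
have i2 : (prodm lam lam).-integrable setT (fun z : mR * mR => (one z.1 * one z.2)%:E).
  exact: integrable_tensor.
have i3 : mu.-integrable setT (fun z : R3 mR => (one z.1.1 * one z.1.2 * one z.2)%:E).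
  exact: (@integrable_tensor _ _ _ _ _ (prodm lam lam) lam (fun z : mR * mR => one z.1 * one z.2) one i2 i1).
apply/(integrable_mkcond _ (@measurable_box R M)).
have -> : (EFin \o (fun _ : R3 R => c)) \_ (box M) =
    (fun z : R3 mR => c%:E * (one z.1.1 * one z.1.2 * one z.2)%:E)%E.
  apply/funext => x; rewrite /patch /one !indicE.
  have E (y : R) : (y \in I) = (`|y| <= M).
    by rewrite ler_norml; apply/idP/idP => [/set_mem|H]; [|apply: mem_set]; rewrite /I/= in_itv.
  have -> : (x \in box M) = [&& `|x.1.1| <= M, `|x.1.2| <= M & `|x.2| <= M].
    apply/idP/idP => [/set_mem H|/and3P[H0 H1 H2]].
      by apply/and3P; split; [exact: (H (@Ordinal 3 0 isT))|exact: (H (@Ordinal 3 1 isT))|exact: (H (@Ordinal 3 2 isT))].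
    by apply: mem_set => -[[|[|[|//]]] j3].
  rewrite !E; case: (`|x.1.1| <= M); case: (`|x.1.2| <= M); case: (`|x.2| <= M) => /=;
    by rewrite ?mulr0 ?mul0r ?mulr1 ?mule1 ?mule0.
exact: integrableZl.
Qed.

Lemma test_lp t psi : 0 < t -> test_function psi -> lp mu t psi.
Proof.
move=> t0 tpsi; have mpsi := test_measurable tpsi.
have [C C0 HC] := test_bounded tpsi; have [M _ HM] := test_box tpsi.
split => //; have := @integrable_loc_bounded R (fun _ => 1) (fun x => `|psi x| `^ t) M (C `^ t).
move=> /(_ (loc_int_cst 1) (measurable_norm_powR t mpsi)).
rewrite (_ : (fun x => (1 * `|psi x| `^ t)%:E) = (EFin \o (fun x => `|psi x| `^ t))); last first.
  by apply/funext => x; rewrite /= mul1r.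
apply=> [x|x H].
  by rewrite ger0_norm ?powR_ge0// ler_powRl// ltW.
apply: HM; apply: contra_neq H => ->.
by rewrite normr0 powR0// gt_eqF.
Qed.

Let enorm_le_sum (a : 'rV[R]_3) : enorm a <=
  `|a 0 (@Ordinal 3 0 isT)| + `|a 0 (@Ordinal 3 1 isT)| + `|a 0 (@Ordinal 3 2 isT)|.
Proof.
rewrite -(@ler_pXn2r _ 2) ?nnegrE ?addr_ge0 ?enorm_ge0// enorm_sqr /edot.
rewrite !big_ord_recl big_ord0 addr0.
set o0 := ord0; have -> : o0 = @Ordinal 3 0 isT by exact: val_inj.
have -> : lift (@Ordinal 3 0 isT) (ord0 : 'I_2) = @Ordinal 3 1 isT by exact: val_inj.
have -> : lift (@Ordinal 3 0 isT) (lift (ord0 : 'I_2) (ord0 : 'I_1)) = @Ordinal 3 2 isT by exact: val_inj.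
rewrite -!expr2 -(real_normK (num_real (a 0 (@Ordinal 3 0 isT)))).
rewrite -(real_normK (num_real (a 0 (@Ordinal 3 1 isT)))) -(real_normK (num_real (a 0 (@Ordinal 3 2 isT)))).
have := normr_ge0 (a 0 (@Ordinal 3 0 isT)); have := normr_ge0 (a 0 (@Ordinal 3 1 isT)).
have := normr_ge0 (a 0 (@Ordinal 3 2 isT)).
move: `|a 0 (@Ordinal 3 0 isT)| `|a 0 (@Ordinal 3 1 isT)| `|a 0 (@Ordinal 3 2 isT)| => z y x.
by nra.
Qed.

Lemma test_grad_lpv t psi : 1 <= t -> test_function psi -> lpv mu t (grad psi).
Proof.
move=> t1 tpsi; have t0 : 0 < t by lra.
have mg : mvec (grad psi : R3 mR -> 'rV[R]_3).
  by move=> i; under eq_fun do rewrite mxE; exact: (test_measurable (test_partial i tpsi)).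
split => //.
pose o0 := @Ordinal 3 0 isT; pose o1 := @Ordinal 3 1 isT; pose o2 := @Ordinal 3 2 isT.
have lab i : lp mu t (fun x => `|partial i psi x|).
  have l := test_lp t0 (test_partial i tpsi).
  have m : measurable_fun setT (fun x : R3 mR => `|partial i psi x| : mR).
    exact: (measurableT_comp _ (lp_measurable l)).
  by have [] := lp_le t0 m _ l => // x; rewrite normr_id.
have [l1 _] := lp_add t1 (lab o0) (lab o1).
have [l2 _] := lp_add t1 l1 (lab o2).
have [] := lp_le t0 (measurable_enorm mg) _ l2 => // x.
rewrite ger0_norm ?enorm_ge0//; apply: le_trans (ler_norm _).
by have := enorm_le_sum (grad psi x); rewrite !mxE.
Qed.

(** The choice gam = 2q/(3 - q) is the one with (gam - 1) q/(q - 1) = 3 gam/2 = q^*. Hence the power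
    gam - 1 of the same norm stands on both sides of [sobolev_step], and it cancels, being finite
    for a test function. *)
Lemma test_sobolev q psi : 1 < q < 3 -> test_function psi ->
  nm mu (sobolev_exp q) psi <= 2 * q / (3 - q) * nm mu q (nrm (grad psi)).
Proof.
move=> /andP[q1 q3] tpsi; have q0 : 0 < q by lra.
have q10 : 0 < q - 1 by lra. have q30 : 0 < 3 - q by lra.
pose q' := q / (q - 1); pose gam := 2 * q / (3 - q); pose qs := sobolev_exp q.
have q'0 : 0 < q' by rewrite divr_gt0.
have qq' : q'^-1 + q^-1 = 1 by rewrite /q'; field; rewrite !gt_eqF.
have g1 : 1 < gam by rewrite /gam ltr_pdivlMr; lra.
have g10 : 0 < gam - 1 by lra.
have qs0 : 0 < qs by rewrite /qs /sobolev_exp divr_gt0//; lra.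
have ge : (gam - 1) * q' = qs by rewrite /gam /q' /qs /sobolev_exp; field; rewrite !gt_eqF.
have gs : gam * (3 / 2) = qs by rewrite /gam /qs /sobolev_exp; field; rewrite gt_eqF.
have lpsi := test_lp qs0 tpsi; have [mg lg] := test_grad_lpv (ltW q1) tpsi.
have [lP nP] : lp mu q' (fun x => `|psi x| `^ (gam - 1)) /\
    nm mu q' (fun x => `|psi x| `^ (gam - 1)) = nm mu qs psi `^ (gam - 1).
  by have := @lp_abs_powR _ _ _ mu q' (gam - 1) psi q'0 g10; rewrite ge; exact.
have [IG HG] := hoelder1 q'0 q0 qq' lP lg.
have ac i : {ae mu, forall x, line_ac i psi (fun x => grad psi x 0 i) x}.
  apply: aeW => x; rewrite (_ : (fun x => _) = partial i psi); last by apply/funext => y; rewrite mxE.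
  by apply: smooth_line_ac; case: tpsi.
have cG i (x : R3 mR) : `|grad psi x 0 i| <= nrm (grad psi) x by exact: abs_coord_le.
have [_] := sobolev_step qs0 (ltW g1) (test_measurable tpsi) mg ac lpsi cG IG.
rewrite gs -/gam -/qs => n.
have [N0|N0] := eqVneq (nm mu qs psi) 0.
  by rewrite N0 mulr_ge0 ?nm_ge0//; lra.
have Np : 0 < nm mu qs psi `^ (gam - 1) by rewrite powR_gt0// lt_neqAle eq_sym N0 nm_ge0.
have e : nm mu qs psi `^ gam = nm mu qs psi * nm mu qs psi `^ (gam - 1).
  by rewrite -{2}(powRr1 (nm_ge0 mu qs psi)) -powRD ?N0 ?implybT//; congr (_ `^ _); ring.
rewrite -(ler_pM2r Np) -e; apply: le_trans n _.
rewrite -[X in _ <= X]mulrA ler_wpM2l//; first lra.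
rewrite mulrC -nP; apply: le_trans HG; rewrite le_eqVlt; apply/orP; left; apply/eqP.
by apply: eq_Rintegral => x _; rewrite [RHS]ger0_norm// mulr_ge0 ?powR_ge0 ?enorm_ge0.
Qed.

End TestLp.

(** * From test functions to D^{1,q} by approximation *)

Section D1qSpace.
Context {R : realType}.
Local Notation mR := (measurableTypeR R).
Local Notation mu := (@mu3 R).
Implicit Types (i : 'I_3) (u v w psi phi : R3 R -> R) (t e : R).

(** One approximation in both norms at once, with real norms in place of the extended limits of
    [D1q]; [D1q_approx] and [D1q_intro] translate between the two. *)
Definition D1q_near (q : R) phi e psi := test_function psi /\
  [/\ lpv mu q (fun x => grad psi x - wgrad phi x),
      nm mu q (nrm (fun x => grad psi x - wgrad phi x)) < e,
      lp mu (sobolev_exp q) (fun x => psi x - phi x) &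
      nm mu (sobolev_exp q) (fun x => psi x - phi x) < e].

Lemma sobolev_exp_ge1 (q : R) : 1 < q < 3 -> 1 < sobolev_exp q.
Proof.
move=> /andP[q1 q3]; have := @sobolev_exp_gt R q; rewrite q3 andbT => /(_ (lt_trans ltr01 q1)).
exact: lt_trans.
Qed.

Variable q : R.
Hypothesis q13 : 1 < q < 3.

Let q1 : 1 < q. Proof. by case/andP: q13. Qed.
Let q0 : 0 < q. Proof. by have := q1; lra. Qed.
Let qs1 : 1 < sobolev_exp q. Proof. exact: sobolev_exp_ge1. Qed.
Let qs0 : 0 < sobolev_exp q. Proof. by have := qs1; lra. Qed.

Let mgrad psi : test_function psi -> mvec (grad psi : R3 mR -> 'rV[R]_3).
Proof. by move=> tpsi; have [] := test_grad_lpv (ltW q1) tpsi. Qed.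

Lemma D1q_lp phi : D1q q phi -> lp mu (sobolev_exp q) phi.
Proof. by move=> [l _ _]; exact: (@lp_of_Lfun _ _ _ mu _ phi qs0 l). Qed.

Lemma D1q_approx phi e : D1q q phi -> 0 < e -> exists psi, D1q_near q phi e psi.
Proof.
move=> dphi e0; have lphi := D1q_lp dphi.
have [_ wphi [psi [tpsi H1 H2]]] := dphi.
have e0' : (0%R%:E < e%:E)%E by rewrite lte_fin.
have A1 : \forall n \near \oo, (Lnorm mu q%:E (EFin \o nrm (fun x : R3 mR => (grad (psi n) x - wgrad phi x)%R)) < e%:E)%E.
  exact: H1 _ (open_ereal_lt' e0').
have A2 : \forall n \near \oo, (Lnorm mu (sobolev_exp q)%:E (EFin \o (fun x : R3 mR => (psi n x - phi x)%R)) < e%:E)%E.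
  exact: H2 _ (open_ereal_lt' e0').
have [n [h1 h2]] := filter_ex (filterI A1 A2).
have mG : mvec (fun x : R3 mR => grad (psi n) x - wgrad phi x).
  by apply: mvec_sub; [exact: mgrad|exact: mvec_wgrad].
have mD : measurable_fun setT (fun x : R3 mR => psi n x - phi x : mR).
  exact: (measurable_funB (test_measurable (tpsi n)) (lp_measurable lphi)).
have l1 := lpP q0 (measurable_enorm mG) (lt_trans h1 (ltry e)).
have l2 := lpP qs0 mD (lt_trans h2 (ltry e)).
exists (psi n); split => //; split => //.
- by rewrite -lte_fin (nmE q0 l1).
- by rewrite -lte_fin (nmE qs0 l2).
Qed.

Lemma Lnorm_cvg0 t (f : nat -> R3 mR -> R) : 0 < t -> (forall n, lp mu t (f n)) ->
  (forall n, nm mu t (f n) < n.+1%:R^-1) ->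
  (Lnorm mu t%:E (EFin \o f n) @[n --> \oo] --> 0%E).
Proof.
move=> t0 lf H; rewrite (_ : (fun n => _) = (fun n => (nm mu t (f n))%:E)); last first.
  by apply/funext => n; rewrite (nmE t0 (lf n)).
apply: cvg_EFin; first exact: nearW.
apply/cvgrPdist_lt => e e0; have := near_infty_natSinv_lt (PosNum e0).
apply: filterS => n /= Hn; rewrite sub0r normrN ger0_norm ?nm_ge0//.
exact: lt_trans (H n) Hn.
Qed.

Lemma D1q_intro phi : lp mu (sobolev_exp q) phi -> weakly_differentiable phi ->
  (forall e, 0 < e -> exists psi, D1q_near q phi e psi) -> D1q q phi.
Proof.
move=> lphi wphi H; split => //.
  exact: (@lp_Lfun _ _ _ mu _ phi qs0 lphi).
have /choice[psi Hpsi] : forall n : nat, exists psi, D1q_near q phi n.+1%:R^-1 psi.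
  by move=> n; apply: H; rewrite invr_gt0.
exists psi; split => [n||]; first by have [] := Hpsi n.
- apply: (@Lnorm_cvg0 q (fun n => nrm (fun x => grad (psi n) x - wgrad phi x)) q0) => n.
    by have [_ [[]]] := Hpsi n.
  by have [_ []] := Hpsi n.
- apply: (@Lnorm_cvg0 (sobolev_exp q) (fun n x => psi n x - phi x) qs0) => n.
    by have [_ []] := Hpsi n.
  by have [_ []] := Hpsi n.
Qed.

Lemma D1q_wd phi : D1q q phi -> weakly_differentiable phi.
Proof. by case. Qed.

Lemma D1q_lin (a : R) v w : D1q q v -> D1q q w -> D1q q (fun x => a * v x + w x).
Proof.
move=> dv dw; have lv := D1q_lp dv; have lw := D1q_lp dw.
have wv := D1q_wd dv; have ww := D1q_wd dw.
have wd := weakly_differentiable_lin a wv ww.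
have [la _] := lp_scale a qs0 lv.
have [lvw _] := lp_add (ltW qs1) la lw.
apply: D1q_intro => // e e0.
have e'0 : 0 < e / (8 * (`|a| + 1)) by rewrite divr_gt0// mulr_gt0// ltr_wpDl.
have e''0 : 0 < e / 8 by rewrite divr_gt0.
have [psi1 [t1 [g1 n1 l1 m1]]] := D1q_approx dv e'0.
have [psi2 [t2 [g2 n2 l2 m2]]] := D1q_approx dw e''0.
have small (x y : R) : 0 <= x -> 0 <= y -> x < e / (8 * (`|a| + 1)) -> y < e / 8 ->
    4 * (`|a| * x + y) < e.
  move=> x0 y0 xe ye; have h : `|a| * x <= e / 8.
    apply: (@le_trans _ _ (`|a| * (e / (8 * (`|a| + 1))))); first by rewrite ler_wpM2l// ltW.
    have -> : `|a| * (e / (8 * (`|a| + 1))) = e / 8 * (`|a| / (`|a| + 1)).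
      by field; rewrite gt_eqF// ltr_wpDl.
    by rewrite ler_piMr ?(ltW e''0)// ler_pdivrMr ?mul1r ?lerDl// ltr_wpDl.
  by clear - h ye; lra.
have tt := test_lin a t1 t2.
exists (fun x => a * psi1 x + psi2 x); split; first exact: tt.
have [ga na] := lpv_scale a q0 g1.
have [gs ns] := lpv_add (ltW q1) ga g2.
have eG : {ae mu, forall x, grad (fun x => a * psi1 x + psi2 x) x - wgrad (fun x => a * v x + w x) x
    = a *: (grad psi1 x - wgrad v x) + (grad psi2 x - wgrad w x)}.
  move: (wgrad_lin a wv ww); apply: ae_imp => x ->.
  have -> : grad (fun x => a * psi1 x + psi2 x) x = a *: grad psi1 x + grad psi2 x.
    apply/rowP => i; rewrite !mxE partial_lin//; [by case: t1|by case: t2].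
  by rewrite scalerBr opprD addrACA.
have mG : mvec (fun x : R3 mR => grad (fun x => a * psi1 x + psi2 x) x - wgrad (fun x => a * v x + w x) x).
  by apply: mvec_sub; [exact: mgrad|exact: mvec_wgrad].
have [gG nG] := lpv_ae_eq q0 mG eG gs.
have [la1 nla] := lp_scale a qs0 l1.
have [ls1 nls] := lp_add (ltW qs1) la1 l2.
have e1 : (fun x => a * psi1 x + psi2 x - (a * v x + w x)) =
    (fun x => a * (psi1 x - v x) + (psi2 x - w x)) by apply/funext => x; ring.
split => //.
- by rewrite nG; apply: le_lt_trans ns _; rewrite na small// ?nm_ge0.
- by rewrite e1.
- by rewrite e1; apply: le_lt_trans nls _; rewrite nla small// ?nm_ge0.
Qed.

(** [D1q] asks for convergence of gradients only; integrability of the limit follows by subtracting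
    the error from the gradient of one approximating test function. *)
Lemma D1q_lpv phi : D1q q phi -> lpv mu q (wgrad phi).
Proof.
move=> dphi; have [psi [tpsi [l _ _ _]]] := D1q_approx dphi ltr01.
have [] := lpv_sub (ltW q1) (test_grad_lpv (ltW q1) tpsi) l.
by rewrite (_ : (fun x => _) = wgrad phi)//; apply/funext => x; rewrite subKr.
Qed.

(** The constant for test functions times 4 * 4, for the two uses of the weak triangle inequality in
    the passage to the limit. *)
Definition sobolev_const : R := 16 * (2 * q / (3 - q)).

Lemma sobolev_const_ge0 : 0 <= sobolev_const.
Proof. by have /andP[? ?] := q13; rewrite /sobolev_const mulr_ge0// divr_ge0//; lra. Qed.

Lemma D1q_sobolev phi : D1q q phi ->
  nm mu (sobolev_exp q) phi <= sobolev_const * nm mu q (nrm (wgrad phi)).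
Proof.
move=> dphi; pose g := 2 * q / (3 - q).
have g0 : 0 <= g by have /andP[? ?] := q13; rewrite /g divr_ge0//; lra.
apply/ler_addgt0Pr => e e0.
(* The errors add up to 16 g e' from the gradients and 4 e' from the functions. *)
have e'0 : 0 < e / (16 * g + 4) by rewrite divr_gt0//; lra.
have [psi [tpsi [l1 n1 l2 n2]]] := D1q_approx dphi e'0.
have lpsi := test_lp qs0 tpsi.
have [_ n3] := lp_sub (ltW qs1) lpsi l2.
have {}n3 : nm mu (sobolev_exp q) phi <= 4 * (nm mu (sobolev_exp q) psi + nm mu (sobolev_exp q) (fun x => psi x - phi x)).
  by move: n3; rewrite (_ : (fun x => psi x - _) = phi)//; apply/funext => x; rewrite subKr.
have [_ n4] := lpv_add (ltW q1) l1 (D1q_lpv dphi).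
have {}n4 : nm mu q (nrm (grad psi)) <= 4 * (nm mu q (nrm (fun x => grad psi x - wgrad phi x)) + nm mu q (nrm (wgrad phi))).
  by move: n4; rewrite (_ : (fun x => _ + _) = grad psi)//; apply/funext => x; rewrite subrK.
have n5 := test_sobolev q13 tpsi; rewrite -/g in n5.
rewrite /sobolev_const -/g.
have h : (16 * g + 4) * (e / (16 * g + 4)) = e by rewrite mulrCA divff ?mulr1// gt_eqF//; lra.
move: n1 n2 n3 n4 n5 h (nm_ge0 mu q (nrm (wgrad phi))) (nm_ge0 mu q (nrm (fun x => grad psi x - wgrad phi x))).
move: (nm mu (sobolev_exp q) phi) (nm mu (sobolev_exp q) psi) (nm mu q (nrm (grad psi)))
  (nm mu q (nrm (wgrad phi))) (nm mu q (nrm (fun x => grad psi x - wgrad phi x)))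
  (nm mu (sobolev_exp q) (fun x => psi x - phi x)) (e / (16 * g + 4)) => a b c x y z e' n1 n2 n3 n4 n5 h x0 y0.
have h1 : g * c <= g * (4 * (y + x)) by rewrite ler_wpM2l.
have h2 : g * y <= g * e' by rewrite ler_wpM2l// ltW.
clear - n2 n3 n5 h h1 h2; lra.
Qed.

End D1qSpace.

(** * C^1 functionals *)

Section C1Calculus.
Context {R : realType} {T : Type}.
Variables (W : set (T -> R)) (N : (T -> R) -> R).
Hypothesis N0 : forall u, 0 <= N u.
Implicit Types (J : (T -> R) -> R) (D : (T -> R) -> (T -> R) -> R).

Definition deriv_cont D u := forall eps, 0 < eps -> exists2 delta, 0 < delta &
  forall w, W w -> N (fun x => w x - u x) < delta ->
    forall v, W v -> `|D w v - D u v| <= eps * N v.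

(** The derivative is carried as a datum, so that sums and multiples keep explicit formulas; [C1_on]
    asserts only existence. *)
Definition C1_with J D := forall u, W u -> frechet_derivative W N J u (D u) /\ deriv_cont D u.

Lemma C1_with_add J1 D1 J2 D2 : C1_with J1 D1 -> C1_with J2 D2 ->
  C1_with (fun u => J1 u + J2 u) (fun u v => D1 u v + D2 u v).
Proof.
move=> H1 H2 u Wu; have [[l1 [C1 b1] d1] c1] := H1 u Wu; have [[l2 [C2 b2] d2] c2] := H2 u Wu.
split; first split.
- by move=> a v w Wv Ww; rewrite l1// l2//; ring.
- exists (C1 + C2) => v Wv; apply: le_trans (ler_normD _ _) _.
  by rewrite mulrDl lerD// ?b1// b2.
- move=> e e0; have e20 : 0 < e / 2 by rewrite divr_gt0.
  have [x1 x10 h1] := d1 _ e20; have [x2 x20 h2] := d2 _ e20.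
  exists (Num.min x1 x2); first by rewrite lt_min x10.
  move=> h Wh; rewrite lt_min => /andP[n1 n2].
  have := lerD (h1 h Wh n1) (h2 h Wh n2); rewrite -mulrDl -splitr; apply: le_trans.
  apply: le_trans (ler_normD _ _); rewrite le_eqVlt; apply/orP; left; apply/eqP.
  by congr `|_|; ring.
- move=> e e0; have e20 : 0 < e / 2 by rewrite divr_gt0.
  have [x1 x10 h1] := c1 _ e20; have [x2 x20 h2] := c2 _ e20.
  exists (Num.min x1 x2); first by rewrite lt_min x10.
  move=> w Ww; rewrite lt_min => /andP[n1 n2] v Wv.
  have := lerD (h1 w Ww n1 v Wv) (h2 w Ww n2 v Wv); rewrite -mulrDl -splitr; apply: le_trans.
  apply: le_trans (ler_normD _ _); rewrite le_eqVlt; apply/orP; left; apply/eqP.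
  by congr `|_|; ring.
Qed.

Lemma C1_with_scale k J D : C1_with J D ->
  C1_with (fun u => k * J u) (fun u v => k * D u v).
Proof.
move=> H u Wu; have [[l [C b] d] c] := H u Wu.
have K0 : 0 < `|k| + 1 by rewrite ltr_wpDl.
have Kk (e x : R) : 0 <= x -> 0 < e -> `|k| * (e / (`|k| + 1) * x) <= e * x.
  move=> x0 e0; rewrite mulrA ler_wpM2r// mulrCA ler_piMr ?(ltW e0)//.
  by rewrite ler_pdivrMr// mul1r lerDl.
split; first split.
- by move=> a v w Wv Ww; rewrite l//; ring.
- by exists (`|k| * C) => v Wv; rewrite normrM -mulrA ler_wpM2l// b.
- move=> e e0; have [x x0 h] := d _ (divr_gt0 e0 K0).
  exists x => // y Wy ny; rewrite -!mulrBr normrM; apply: le_trans (Kk e _ (N0 y) e0).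
  by rewrite ler_wpM2l// h.
- move=> e e0; have [x x0 h] := c _ (divr_gt0 e0 K0).
  exists x => // w Ww nw v Wv; rewrite -mulrBr normrM; apply: le_trans (Kk e _ (N0 v) e0).
  by rewrite ler_wpM2l// h.
Qed.

Lemma C1_with_ext J D J' D' : (forall a v w, W v -> W w -> W (fun x => a * v x + w x)) ->
  (forall u, W u -> J u = J' u) -> (forall u v, W u -> W v -> D u v = D' u v) ->
  C1_with J D -> C1_with J' D'.
Proof.
move=> Wl EJ ED H u Wu; have [[l [C b] d] c] := H u Wu.
have Wa v w : W v -> W w -> W (fun x => v x + w x).
  move=> Wv Ww; have := Wl 1 v w Wv Ww.
  by rewrite (_ : (fun x => 1 * v x + w x) = (fun x => v x + w x))//; apply/funext => x; rewrite mul1r.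
split; first split.
- by move=> a v w Wv Ww; rewrite -!ED ?l//; exact: Wl.
- by exists C => v Wv; rewrite -ED// b.
- move=> e /d[x x0 h]; exists x => // y Wy ny.
  by rewrite -ED// -!EJ ?h//; exact: Wa.
- move=> e /c[x x0 h]; exists x => // w Ww nw v Wv.
  by rewrite -!ED ?h.
Qed.

Lemma C1_with_on J D : C1_with J D -> C1_on W N J.
Proof. by move=> H; exists D; split=> u Wu; have [] := H u Wu. Qed.

End C1Calculus.

(** * Power functionals composed with a bounded linear map into L^t *)

Section PowerFunctional.
Context d (T : measurableType d) (R : realType) (mu : {measure set T -> \bar R}).
Variables (W : set (T -> R)) (N : (T -> R) -> R) (t C : R).
Variable A : (T -> R) -> T -> 'rV[R]_3.
Hypothesis N0 : forall u, 0 <= N u.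
Hypothesis Wlin : forall a v w, W v -> W w -> W (fun x => a * v x + w x).
Hypothesis t1 : 1 < t.
Hypothesis C0 : 0 <= C.
Hypothesis lA : forall u, W u -> lpv mu t (A u).
Hypothesis AN : forall u, W u -> nm mu t (nrm (A u)) <= C * N u.
Hypothesis Alin : forall a v w, W v -> W w ->
  {ae mu, forall x, A (fun x => a * v x + w x) x = a *: A v x + A w x}.

Let t0 : 0 < t. Proof. by have := t1; lra. Qed.
Let t'0 : 0 < t / (t - 1). Proof. by have := t1; move=> ?; rewrite divr_gt0//; lra. Qed.
Let conj_sum : (t / (t - 1))^-1 + t^-1 = 1.
Proof. by have := t1; move=> t1'; field; apply/andP; split; apply/eqP; lra. Qed.

Let Wadd v w : W v -> W w -> W (fun x => v x + w x).
Proof.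
move=> Wv Ww; have := Wlin 1 Wv Ww.
by rewrite (_ : (fun x => 1 * v x + w x) = (fun x => v x + w x))//; apply/funext => x; rewrite mul1r.
Qed.

Let Aadd v w : W v -> W w -> {ae mu, forall x, A (fun x => v x + w x) x = A v x + A w x}.
Proof.
move=> Wv Ww; have := Alin 1 Wv Ww.
rewrite (_ : (fun x => 1 * v x + w x) = (fun x => v x + w x)); last by apply/funext => x; rewrite mul1r.
by apply: ae_imp => x ->; rewrite scale1r.
Qed.

Let small (e : R) : 0 < e -> 0 < e / (C + 1).
Proof. by move=> e0; rewrite divr_gt0//; have := C0; lra. Qed.

Let small_le (e x : R) : 0 < e -> 0 <= x -> e / (C + 1) * (C * x) <= e * x.
Proof.
move=> e0 x0; rewrite mulrA ler_wpM2r// mulrAC -mulrA ler_piMr ?(ltW e0)//.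
by rewrite ler_pdivrMr ?mul1r ?lerDl// ltr_wpDl.
Qed.

Let small_N (e : R) (h : T -> R) : 0 < e -> W h -> N h < e / (C + 1) -> nm mu t (nrm (A h)) < e.
Proof.
move=> e0 Wh nh; apply: le_lt_trans (AN Wh) _.
have C1 : 0 < C + 1 by rewrite ltr_wpDl.
apply: (@le_lt_trans _ _ ((C + 1) * N h)); first by rewrite ler_wpM2r// lerDl.
by rewrite mulrC -ltr_pdivlMr.
Qed.

(** Used for the gradient with exponent p, and for the function itself, as a vector field, with
    exponents p and r. As [A] is linear only almost everywhere, the values of [A] at sums are
    replaced inside the integrals. *)
Lemma C1_with_power : C1_with W N (fun u => t^-1 * \int[mu]_x (enorm (A u x) `^ t))
  (fun u v => \int[mu]_x edot (vpow t (A u x)) (A v x)).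
Proof.
move=> u Wu; have lu := lA Wu; have [lV nV] := lpv_vpow t0 t1 lu.
have IV v : W v -> mu.-integrable setT (EFin \o (fun x => edot (vpow t (A u x)) (A v x))).
  by move=> Wv; have [] := lp_edot t'0 t0 conj_sum lV (lA Wv).
split; first split.
- move=> a v w Wv Ww; rewrite -(Rint_lin a (IV v Wv) (IV w Ww)).
  apply: Rint_ae_eq.
  + exact: measurable_edot lV.1 (lA (Wlin a Wv Ww)).1.
  + exact/measurable_EFinP/(measurable_int _ (integrable_add (integrable_scale a (IV v Wv)) (IV w Ww))).
  + by move: (Alin a Wv Ww); apply: ae_imp => x ->; rewrite edotDr edotZr.
- exists (nm mu t (nrm (A u)) `^ (t - 1) * C) => v Wv.
  have [_ H] := lp_edot t'0 t0 conj_sum lV (lA Wv).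
  apply: le_trans H _; rewrite nV -mulrA ler_wpM2l ?powR_ge0//; exact: AN.
- move=> e e0; have te0 : 0 < t * (e / (C + 1)) by rewrite mulr_gt0// small.
  have [delta d0 Hd] := power_diff t1 lu te0.
  (* Dividing by [C + 1] instead of [C] covers [C = 0]. *)
  exists (delta / (C + 1)); first exact: small.
  move=> h Wh nh; have := Hd (A h) (lA Wh) (small_N d0 Wh nh) => {}Hd.
  have -> : \int[mu]_x (enorm (A (fun x => u x + h x) x) `^ t) = \int[mu]_x (enorm (A u x + A h x) `^ t).
    have mE (B : T -> 'rV[R]_3) : mvec B -> measurable_fun setT (fun x => enorm (B x) `^ t : measurableTypeR R).
      by move=> mB; apply: (measurableT_comp (measurable_powR t)); exact: measurable_enorm.
    apply: Rint_ae_eq; [exact: mE (lA (Wadd Wu Wh)).1|exact: mE (mvec_add lu.1 (lA Wh).1)|].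
    by move: (Aadd Wu Wh); apply: ae_imp => x ->.
  rewrite -mulrBr -[X in _ - X](mulKf (lt0r_neq0 t0)) -mulrBr normrM ger0_norm ?invr_ge0 ?(ltW t0)//.
  rewrite mulrC ler_pdivrMr//; apply: le_trans Hd _.
  rewrite [X in _ <= X]mulrC -mulrA ler_wpM2l ?(ltW t0)//.
  by apply: le_trans (small_le e0 (N0 h)); rewrite ler_wpM2l ?(ltW (small e0))// AN.
- move=> e e0; have [delta d0 Hd] := power_diff_cont t1 lu (small e0).
  exists (delta / (C + 1)); first exact: small.
  move=> w Ww nw v Wv.
  have E : (fun x => w x - u x) = (fun x => -1 * u x + w x) by apply/funext => x; rewrite mulN1r addrC.
  have Wd : W (fun x => w x - u x) by rewrite E; exact: Wlin.
  have := Hd _ (lA Wd) (small_N d0 Wd nw) _ (lA Wv) => {}Hd.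
  have -> : \int[mu]_x edot (vpow t (A w x)) (A v x) =
     \int[mu]_x edot (vpow t (A u x + A (fun x => w x - u x) x)) (A v x).
    apply: Rint_ae_eq.
    + exact: measurable_edot (mvec_vpow t (lA Ww).1) (lA Wv).1.
    + exact: measurable_edot (mvec_vpow t (mvec_add lu.1 (lA Wd).1)) (lA Wv).1.
    + move: (Aadd Wu Wd); apply: ae_imp => x.
      by rewrite (_ : (fun x => u x + (w x - u x)) = w) => [<-//|]; apply/funext => y; rewrite addrC subrK.
  apply: le_trans Hd _; apply: le_trans (small_le e0 (N0 v)).
  by rewrite ler_wpM2l ?(ltW (small e0))// AN.
Qed.

End PowerFunctional.

Section ScalarFields.
Context d (T : measurableType d) (R : realType) (mu : {measure set T -> \bar R}).
Local Notation mR := (measurableTypeR R).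
Implicit Types (u v h : T -> R) (s t x y : R).

(* Scalars are treated as vectors supported on the first axis, so that the
   results on vector fields apply to them. *)
Definition svec x : 'rV[R]_3 := x *: delta_mx 0 0.

Definition spow t x := `|x| `^ (t - 2) * x.

Lemma edot_svec x y : edot (svec x) (svec y) = x * y.
Proof.
rewrite /svec edotZl edotZr /edot (bigD1 ord0)//= big1 => [|i i0].
  by rewrite !mxE eqxx/= mulr1 addr0 mulr1.
by rewrite !mxE (negbTE i0) andbF mulr0.
Qed.

Lemma enorm_svec x : enorm (svec x) = `|x|.
Proof. by rewrite /enorm edot_svec -expr2 sqrtr_sqr. Qed.

Lemma vpow_svec t x : vpow t (svec x) = svec (spow t x).
Proof. by rewrite /vpow enorm_svec /svec scalerA. Qed.

Lemma svecD x y : svec (x + y) = svec x + svec y. Proof. exact: scalerDl. Qed.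

Lemma svecB x y : svec (x - y) = svec x - svec y. Proof. exact: scalerBl. Qed.

Lemma nrm_svec u : nrm (fun z => svec (u z)) = (fun z => `|u z|).
Proof. by apply/funext => z; rewrite /nrm enorm_svec. Qed.

Lemma nm_abs t u : nm mu t (fun z => `|u z|) = nm mu t u.
Proof.
rewrite nm.unlock; congr (_ `^ _); apply: eq_Rintegral => z _.
by rewrite normr_id.
Qed.

Lemma nm_svec t u : nm mu t (nrm (fun z => svec (u z))) = nm mu t u.
Proof. by rewrite nrm_svec nm_abs. Qed.

Lemma lpv_svec t u : 0 < t -> lp mu t u -> lpv mu t (fun z => svec (u z)).
Proof.
move=> t0 lu; split.
  move=> i; under eq_fun do rewrite !mxE.
  exact: (measurable_funM (lp_measurable lu) (measurable_cst _)).
rewrite nrm_svec.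
have m : measurable_fun setT (fun z => `|u z| : mR) by exact: (measurableT_comp _ (lp_measurable lu)).
by have [] := lp_le t0 m _ lu => // z; rewrite normr_id.
Qed.

Lemma measurable_spow t u : measurable_fun setT (u : T -> mR) ->
  measurable_fun setT (fun z => spow t (u z) : mR).
Proof. by move=> mfu; apply: measurable_funM => //; exact: measurable_norm_powR. Qed.

Lemma lp_of_svec t u : measurable_fun setT (u : T -> mR) -> lpv mu t (fun z => svec (u z)) ->
  lp mu t u.
Proof.
move=> mfu [_]; rewrite nrm_svec => -[_ I]; split => //.
by rewrite (_ : (fun z => _) = (fun z => `| `|u z| | `^ t))//; apply/funext => z; rewrite normr_id.
Qed.

Lemma lp_spow t s u : 0 < t -> 1 < s -> lp mu t u ->
  lp mu (t / (s - 1)) (fun z => spow s (u z)) /\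
  nm mu (t / (s - 1)) (fun z => spow s (u z)) = nm mu t u `^ (s - 1).
Proof.
move=> t0 s1 lu; have [] := lpv_vpow t0 s1 (lpv_svec t0 lu).
have -> : (fun z => vpow s (svec (u z))) = (fun z => svec (spow s (u z))).
  by apply/funext => z; rewrite vpow_svec.
rewrite !nm_svec => l ->; split => //; apply: lp_of_svec => //.
exact: measurable_spow (lp_measurable lu).
Qed.

Lemma nemytskii_spow t s u : 0 < t -> 1 < s -> s - 1 <= t -> lp mu t u ->
  forall e, 0 < e -> exists2 delta, 0 < delta & forall h, lp mu t h -> nm mu t h < delta ->
    nm mu (t / (s - 1)) (fun z => spow s (u z + h z) - spow s (u z)) <= e.
Proof.
move=> t0 s1 st lu e e0.
have [delta d0 H] := nemytskii t0 s1 st (lpv_svec t0 lu) e0.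
exists delta => // h lh; rewrite -nm_svec => nh; have := H _ (lpv_svec t0 lh) nh.
have -> : (fun z => vpow s (svec (u z) + svec (h z)) - vpow s (svec (u z))) =
    (fun z => svec (spow s (u z + h z) - spow s (u z))).
  by apply/funext => z; rewrite -svecD !vpow_svec -svecB.
by rewrite nm_svec.
Qed.

(** The two tangent inequalities, at [x] and at [x + y]: the remainder of the linearisation is
    controlled by the increment of the derivative. *)
Lemma spow_convex t x y : 1 < t -> 0 <= `|x + y| `^ t - `|x| `^ t - t * (spow t x * y) <=
  t * ((spow t (x + y) - spow t x) * y).
Proof.
move=> t1; have := vpow_convex (svec x) (svec (x + y)) t1.
have := vpow_convex (svec (x + y)) (svec x) t1.
rewrite !vpow_svec !enorm_svec -!svecB !edot_svec.
rewrite [x + y - x]addrC addKr opprD addrA subrr sub0r.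
by move=> ? ?; apply/andP; split; lra.
Qed.

End ScalarFields.

(** * The dual energy *)

Lemma eq_ple (R : realType) (x y : R) : x = y -> x <= y.
Proof. by move=> ->. Qed.

Section DualEnergy.
Context {R : realType}.
Local Notation mR := (measurableTypeR R).
Local Notation mu := (@mu3 R).
Implicit Types (f g phi psi w : R3 R -> R) (e : R).

Let expand_le (a b c x : R) : a + x * (b - a) <= c -> x * b + (1 - x) * a <= c.
Proof. by lra. Qed.

Let le_four (x : R) : 0 <= x -> x <= 4 * (x + 1).
Proof. by lra. Qed.

Let energy_le (x a b c : R) : x * a + (1 - x) * c <= b -> (a - b) * x <= (x - 1) * (c - b).
Proof. by lra. Qed.

Let le_sum8 (x y z : R) : x <= z -> y <= z -> 4 * (x + y) <= 8 * z.
Proof. by lra. Qed.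

Let le_sum2 (x y z : R) : x <= z -> y <= z -> x + y <= 2 * (z + 1).
Proof. by lra. Qed.

Let le_halves (x y z t : R) : z <= x + y -> x <= t / 2 -> y <= t / 2 -> z <= t.
Proof. by lra. Qed.

Variable q : R.
Hypothesis q13 : 1 < q < 3.

Let q1 : 1 < q. Proof. by case/andP: q13. Qed.
Let q0 : 0 < q. Proof. by have := q1; lra. Qed.
Local Notation qs := (sobolev_exp q).
Local Notation qc := (qs / (qs - 1)).
Local Notation S := (sobolev_const q).
Let qs1 : 1 < qs. Proof. exact: sobolev_exp_ge1. Qed.
Let qs0 : 0 < qs. Proof. by have := qs1; lra. Qed.
Let qc1 : 1 < qc. Proof. by have := qs1 => ?; rewrite ltr_pdivlMr; lra. Qed.
Let qc0 : 0 < qc. Proof. by have := qc1; lra. Qed.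
Let qc_conj : qc^-1 + qs^-1 = 1.
Proof. by have := qs1 => ?; field; apply/andP; split; apply/eqP; lra. Qed.
Let q'0 : 0 < q / (q - 1). Proof. by have := q1 => ?; rewrite divr_gt0//; lra. Qed.
Let q_conj : (q / (q - 1))^-1 + q^-1 = 1.
Proof. by have := q1 => ?; field; apply/andP; split; apply/eqP; lra. Qed.
Let S0 : 0 <= S. Proof. exact: sobolev_const_ge0. Qed.

(** The equation with a general right side, because the energies of two data are compared below. *)
Definition dual_sol f phi := D1q q phi /\ forall w, D1q q w ->
  \int[mu]_x edot (vpow q (wgrad phi x)) (wgrad w x) = \int[mu]_x (f x * w x).

Local Notation gn phi := (nm mu q (nrm (wgrad phi))).

Let gn0 phi : 0 <= gn phi. Proof. exact: nm_ge0. Qed.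

Let int_fw f w : lp mu qc f -> D1q q w ->
  mu.-integrable setT (EFin \o (fun x => f x * w x)) /\
  `|\int[mu]_x (f x * w x)| <= nm mu qc f * nm mu qs w.
Proof.
move=> lf dw; have lw := D1q_lp q13 dw.
by split; [have [] := hoelder1 qc0 qs0 qc_conj lf lw|exact: hoelder_le].
Qed.

Lemma dual_sol_grad f phi : dual_sol f phi -> gn phi `^ q = \int[mu]_x (f x * phi x).
Proof.
move=> [dphi H]; rewrite -H// nm_nrm//.
by apply: eq_Rintegral => x _; rewrite edot_vpow.
Qed.

(** [phi] competes in the maximum that defines E(g), attained at [psi]. The proof integrates the
    tangent inequality of |.|^q at the gradient of [psi], and uses the equation of [psi] tested with
    [phi] and with [psi]. *)
Lemma dual_sol_energy f g phi psi : lp mu qc f -> lp mu qc g ->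
  dual_sol f phi -> dual_sol g psi ->
  \int[mu]_x ((g x - f x) * phi x) <=
    (q - 1) / q * \int[mu]_x (g x * psi x) - (q - 1) / q * \int[mu]_x (f x * phi x).
Proof.
move=> lf lg sphi spsi; have [dphi _] := sphi; have [dpsi Hpsi] := spsi.
have [I1 _] := int_fw lf dphi; have [I2 _] := int_fw lg dphi.
have Lphi := D1q_lpv q13 dphi; have Lpsi := D1q_lpv q13 dpsi.
have [lV _] := lpv_vpow q0 q1 Lpsi.
have [I3 _] := lp_edot q'0 q0 q_conj lV Lphi.
have [I4 _] := lp_edot q'0 q0 q_conj lV Lpsi.
have I5 := nrm_powR_integrable Lpsi; have I6 := nrm_powR_integrable Lphi.
have I7 := @integrable_scale _ _ _ mu q _ I3.
have I8 := @integrable_scale _ _ _ mu (1 - q) _ I5.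
have C : \int[mu]_x (q * edot (vpow q (wgrad psi x)) (wgrad phi x) + (1 - q) * enorm (wgrad psi x) `^ q)
    <= \int[mu]_x (enorm (wgrad phi x) `^ q).
  apply: le_Rintegral => //; first exact: (integrable_add I7 I8).
  move=> x _; have := vpow_convex (wgrad psi x) (wgrad phi x) q1.
  by rewrite edotBr (edot_vpow _ q1); exact: expand_le.
have aphi := etrans (esym (nm_nrm (wgrad phi) q0)) (dual_sol_grad sphi).
have apsi := etrans (esym (nm_nrm (wgrad psi) q0)) (dual_sol_grad spsi).
have L := Rint_lin2 q (1 - q) I3 I5.
have {}C := le_trans (eq_ple (esym L)) (le_trans C (eq_ple aphi)).
have {L}E : q * \int[mu]_x edot (vpow q (wgrad psi x)) (wgrad phi x)
    + (1 - q) * \int[mu]_x (enorm (wgrad psi x) `^ q) =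
  q * \int[mu]_x (g x * phi x) + (1 - q) * \int[mu]_x (g x * psi x).
  by congr (q * _ + (1 - q) * _); [exact: Hpsi|exact: apsi].
have {}C := le_trans (eq_ple (esym E)) C.
have -> : \int[mu]_x ((g x - f x) * phi x) = \int[mu]_x (g x * phi x) - \int[mu]_x (f x * phi x).
  have := Rint_lin (-1) I1 I2; rewrite mulN1r [X in _ = X]addrC => <-.
  by apply: eq_Rintegral => x _; ring.
move: C; move: (\int[mu]_x (g x * phi x)) (\int[mu]_x (f x * phi x)) (\int[mu]_x (g x * psi x)) => a b c C.
by rewrite -mulrBr mulrAC ler_pdivlMr//; exact: energy_le.
Qed.

(** The solution tested against itself, with the Sobolev inequality, gives gn^q <= S F gn for the
    norm gn of its gradient. *)
Lemma dual_sol_bound f phi F : lp mu qc f -> dual_sol f phi -> nm mu qc f <= F ->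
  gn phi <= (S * F) `^ (q - 1)^-1.
Proof.
move=> lf sphi nf; have [dphi _] := sphi; have q10 : 0 < q - 1 by have := q1; lra.
have F0 : 0 <= F by apply: le_trans nf; exact: nm_ge0.
have SF : 0 <= S * F by exact: mulr_ge0.
have [g0|g0] := eqVneq (gn phi) 0; first by rewrite g0 powR_ge0.
have [_ H] := int_fw lf dphi.
have H1 : gn phi `^ q <= S * F * gn phi.
  rewrite (dual_sol_grad sphi); apply: le_trans (ler_norm _) _; apply: le_trans H _.
  apply: (@le_trans _ _ (F * (S * gn phi))); first by rewrite ler_pM ?nm_ge0 ?D1q_sobolev.
  by rewrite mulrA (mulrC F).
have gp : 0 < gn phi by rewrite lt_neqAle eq_sym g0 gn0.
have H2 : gn phi `^ (q - 1) <= S * F.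
  rewrite -(ler_pM2r gp); apply: le_trans H1; rewrite le_eqVlt; apply/orP; left; apply/eqP.
  by rewrite -{2}(powRr1 (gn0 phi)) -powRD ?g0 ?implybT// subrK.
have -> : gn phi = (gn phi `^ (q - 1)) `^ (q - 1)^-1 by rewrite -powRrM mulfV ?gt_eqF// powRr1.
by apply: ler_powRl; rewrite ?powR_ge0// invr_ge0 ltW.
Qed.

(** The coercivity inequality is integrated for the two gradients; by the two equations tested with
    psi - phi, the monotone term is the pairing of g - f with psi - phi. *)
Lemma dual_sol_sub_energy eta C f g phi psi :
  (forall a b : 'rV[R]_3, enorm (a - b) `^ q <= eta * (enorm a `^ q + enorm b `^ q)
     + C * edot (vpow q a - vpow q b) (a - b)) -> 0 <= C ->
  lp mu qc f -> lp mu qc g -> dual_sol f phi -> dual_sol g psi ->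
  gn (fun x => psi x - phi x) `^ q <= eta * (gn psi `^ q + gn phi `^ q)
    + C * (nm mu qc (fun x => g x - f x) * nm mu qs (fun x => psi x - phi x)).
Proof.
move=> HC C0 lf lg sphi spsi; have [dphi Hphi] := sphi; have [dpsi Hpsi] := spsi.
have E : (fun x => psi x - phi x) = (fun x => -1 * phi x + psi x) by apply/funext => x; rewrite mulN1r addrC.
have dw : D1q q (fun x => psi x - phi x) by rewrite E; exact: D1q_lin.
set w := (fun x => psi x - phi x) in dw *.
have Lphi := D1q_lpv q13 dphi; have Lpsi := D1q_lpv q13 dpsi; have Lw := D1q_lpv q13 dw.
have [lVp _] := lpv_vpow q0 q1 Lpsi; have [lVf _] := lpv_vpow q0 q1 Lphi.
have wE : {ae mu, forall x, wgrad w x = wgrad psi x - wgrad phi x}.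
  rewrite /w E; move: (wgrad_lin (-1) (D1q_wd dphi) (D1q_wd dpsi)); apply: ae_imp => x ->.
  by rewrite scaleN1r addrC.
have [I1 _] := lp_edot q'0 q0 q_conj lVp Lw; have [I2 _] := lp_edot q'0 q0 q_conj lVf Lw.
have I3 := nrm_powR_integrable Lpsi; have I4 := nrm_powR_integrable Lphi.
have I5 := nrm_powR_integrable Lw.
have I6 := @integrable_scale _ _ _ mu (-1) _ I2.
have I7 := integrable_add I6 I1.
have I8 := integrable_add I3 I4.
have I9 := integrable_add (@integrable_scale _ _ _ mu eta _ I8) (@integrable_scale _ _ _ mu C _ I7).
have [lgf _] := lp_sub (ltW qc1) lg lf.
have [J1 _] := int_fw lf dw; have [J2 _] := int_fw lg dw.
have [_ H] := int_fw lgf dw.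
have D : \int[mu]_x (-1 * edot (vpow q (wgrad phi x)) (wgrad w x) + edot (vpow q (wgrad psi x)) (wgrad w x))
    = \int[mu]_x ((g x - f x) * w x).
  rewrite (Rint_lin _ I2 I1) (Hphi _ dw) (Hpsi _ dw) -(Rint_lin _ J1 J2).
  by apply: eq_Rintegral => x _; ring.
apply: (@le_trans _ _ (eta * (gn psi `^ q + gn phi `^ q) + C * \int[mu]_x ((g x - f x) * w x))); last first.
  by rewrite lerD2l ler_wpM2l// (le_trans (ler_norm _)).
rewrite -D (nm_nrm (wgrad psi) q0) (nm_nrm (wgrad phi) q0) (nm_nrm _ q0).
rewrite -(Rint_add I3 I4) -(Rint_lin2 _ _ I8 I7).
apply: (Rint_ae_le I5 I9); move: wE; apply: ae_imp => x Hx.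
rewrite Hx; apply: le_trans (HC _ _) _.
by rewrite lerD2l ler_wpM2l// edotBl mulN1r addrC.
Qed.

(** The parameter of [vpow_coercive] is fixed by the common bound [K] on both gradients, delta
    afterwards by the resulting [C]. Each of the two terms is at most Tq/2, and [Tq] is such that
    the Sobolev inequality ends with [e]. *)
Lemma dual_sol_continuity f phi e : lp mu qc f -> dual_sol f phi -> 0 < e ->
  exists2 delta, 0 < delta & forall g psi, lp mu qc g -> dual_sol g psi ->
    nm mu qc (fun x => g x - f x) < delta -> nm mu qs (fun x => psi x - phi x) <= e.
Proof.
move=> lf sphi e0; have [dphi _] := sphi.
(* For |g - f| < 1 the weak triangle inequality bounds the norm of [g] by [F] as well. *)
pose F := 4 * (nm mu qc f + 1).
have F0 : 0 <= F by rewrite mulr_ge0// addr_ge0// nm_ge0.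
pose K := (S * F) `^ (q - 1)^-1.
have K0 : 0 <= K by exact: powR_ge0.
pose Tq := (e / (S + 1)) `^ q.
have S1 : 0 < S + 1 by rewrite ltr_wpDl.
have T0 : 0 < Tq by rewrite powR_gt0// divr_gt0.
have Kq : 0 <= K `^ q by exact: powR_ge0.
have eta0 : 0 < Tq / (4 * (K `^ q + 1)) by rewrite divr_gt0// mulr_gt0// ltr_wpDl.
have [C C0 HC] := vpow_coercive q1 eta0.
(* 8 S K bounds psi - phi in L^{q^*}: 4 from the weak triangle inequality, 2 for the two
   solutions. *)
pose B := C * (8 * S * K).
have B0 : 0 <= B by apply: mulr_ge0 => //; apply: mulr_ge0 => //; exact: mulr_ge0.
exists (Num.min 1 (Tq / (2 * (B + 1)))).
  by rewrite lt_min ltr01 divr_gt0// mulr_gt0// ltr_wpDl.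
move=> g psi lg spsi; rewrite lt_min => /andP[n1 n2]; have [dpsi _] := spsi.
have E : (fun x => psi x - phi x) = (fun x => -1 * phi x + psi x) by apply/funext => x; rewrite mulN1r addrC.
have dw : D1q q (fun x => psi x - phi x) by rewrite E; exact: D1q_lin.
have ng : nm mu qc g <= F.
  have [lgf _] := lp_sub (ltW qc1) lg lf.
  have [_] := lp_add (ltW qc1) lf lgf.
  rewrite (_ : (fun x => f x + (g x - f x)) = g); last by apply/funext => x; rewrite addrC subrK.
  by move=> h; apply: le_trans h _; rewrite ler_wpM2l// lerD2l ltW.
have nf : nm mu qc f <= F by apply: le_four; exact: nm_ge0.
have bphi := dual_sol_bound lf sphi nf; have bpsi := dual_sol_bound lg spsi ng.
rewrite -/K in bphi bpsi.
have nw : nm mu qs (fun x => psi x - phi x) <= 8 * S * K.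
  have [_ h] := lp_sub (ltW qs1) (D1q_lp q13 dpsi) (D1q_lp q13 dphi).
  apply: le_trans h _.
  have h1 := le_trans (D1q_sobolev q13 dpsi) (ler_wpM2l S0 bpsi).
  have h2 := le_trans (D1q_sobolev q13 dphi) (ler_wpM2l S0 bphi).
  by rewrite -mulrA; exact: le_sum8.
have H := dual_sol_sub_energy HC C0 lf lg sphi spsi.
have H1 : Tq / (4 * (K `^ q + 1)) * (gn psi `^ q + gn phi `^ q) <= Tq / 2.
  have -> : Tq / 2 = Tq / (4 * (K `^ q + 1)) * (2 * (K `^ q + 1)).
    by field; rewrite gt_eqF// ltr_wpDl.
  rewrite ler_wpM2l ?(ltW eta0)//.
  have h1 : gn psi `^ q <= K `^ q by apply: ler_powRl => //; exact: ltW.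
  have h2 : gn phi `^ q <= K `^ q by apply: ler_powRl => //; exact: ltW.
  exact: (le_sum2 h1 h2).
have H2 : C * (nm mu qc (fun x => g x - f x) * nm mu qs (fun x => psi x - phi x)) <= Tq / 2.
  apply: (@le_trans _ _ (Tq / (2 * (B + 1)) * B)).
    rewrite /B mulrCA; apply: ler_pM; rewrite ?nm_ge0 ?mulr_ge0 ?nm_ge0 ?ler_wpM2l//.
    exact: ltW.
  have -> : Tq / (2 * (B + 1)) * B = Tq / 2 * (B / (B + 1)) by field; rewrite gt_eqF// ltr_wpDl.
  by rewrite ler_piMr ?divr_ge0 ?(ltW T0)// ler_pdivrMr ?mul1r ?lerDl// ltr_wpDl.
have gq : gn (fun x => psi x - phi x) `^ q <= Tq by exact: le_halves H H1 H2.
have gw : gn (fun x => psi x - phi x) <= e / (S + 1).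
  by apply: (le_powRK q0); [exact: gn0|rewrite divr_ge0 ?(ltW e0) ?(ltW S1)|exact: gq].
apply: le_trans (D1q_sobolev q13 dw) _.
apply: (@le_trans _ _ (S * (e / (S + 1)))); first by rewrite ler_wpM2l.
by rewrite mulrCA ler_piMr ?(ltW e0)// ler_pdivrMr ?mul1r ?lerDl.
Qed.

End DualEnergy.

(** * The nonlocal term *)

Section NonlocalTerm.
Context {R : realType}.
Local Notation mR := (measurableTypeR R).
Local Notation mu := (@mu3 R).
Implicit Types (u v w h : R3 R -> R) (e : R).
Variables (p q s : R) (phi : (R3 R -> R) -> R3 R -> R).
Hypothesis p13 : 1 < p < 3.
Hypothesis q13 : 1 < q < 3.
Hypothesis s1 : 1 < s.
Local Notation qs := (sobolev_exp q).
Local Notation qc := (qs / (qs - 1)).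
Local Notation m := (s * qc).
Hypothesis pm : p <= m < sobolev_exp p.
Hypothesis phiP : forall u, W1p p u -> dual_sol q (fun x => `|u x| `^ s) (phi u).

Let p1 : 1 < p. Proof. by case/andP: p13. Qed.
Let p0 : 0 < p. Proof. by have := p1; lra. Qed.
Let q1 : 1 < q. Proof. by case/andP: q13. Qed.
Let q0 : 0 < q. Proof. by have := q1; lra. Qed.
Let s0 : 0 < s. Proof. by have := s1; lra. Qed.
Let s10 : 0 < s - 1. Proof. by have := s1; lra. Qed.
Let qs1 : 1 < qs. Proof. exact: sobolev_exp_ge1. Qed.
Let qs0 : 0 < qs. Proof. by have := qs1; lra. Qed.
Let qc1 : 1 < qc. Proof. by have := qs1 => ?; rewrite ltr_pdivlMr; lra. Qed.
Let qc0 : 0 < qc. Proof. by have := qc1; lra. Qed.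
Let qc_conj : qc^-1 + qs^-1 = 1.
Proof. by have := qs1 => ?; field; apply/andP; split; apply/eqP; lra. Qed.
Let m0 : 0 < m. Proof. exact: mulr_gt0. Qed.
Let sm : s - 1 <= m.
Proof.
apply: (@le_trans _ _ s); first by rewrite gerBl.
by rewrite ler_peMr ?(ltW s0)// ltW.
Qed.
Let k0 : 0 < m / (s - 1). Proof. exact: divr_gt0. Qed.
Let k1 : 1 <= m / (s - 1). Proof. by rewrite ler_pdivlMr// mul1r. Qed.
(** |u|^(s-2) u lies in L^(m/(s-1)), and its product with a direction in L^m lies in the dual of
    L^{q^*}. *)
Let m_conj : (m / (s - 1))^-1 + m^-1 = qc^-1.
Proof.
have qn := lt0r_neq0 qc0; have sn := lt0r_neq0 s0.
rewrite invf_div -[X in _ + X]mul1r -mulrDl subrK invfM mulrA divff// mul1r //.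
Qed.

Local Notation f u := (fun x => `|u x| `^ s).
Local Notation N := (normW1p p).

(** An informative existential, so that the constant can be named [C] throughout the section. *)
Let embed : {C : R | 0 <= C & forall u, W1p p u -> lp mu m u /\ nm mu m u <= C * N u}.
Proof. by have /cid2[C C0 HC] := sobolev_embedding p13 pm; exists C. Qed.

Let C := s2val embed.
Let C0 : 0 <= C. Proof. exact: s2valP embed. Qed.
Let lpm u : W1p p u -> lp mu m u. Proof. by move=> /(s2valP' embed)[]. Qed.
Let nmC u : W1p p u -> nm mu m u <= C * N u. Proof. by move=> /(s2valP' embed)[]. Qed.

Let lpf u : W1p p u -> lp mu qc (f u).
Proof. by move=> /lpm lu; have [] := lp_abs_powR qc0 s0 lu. Qed.

Let lphi u : W1p p u -> lp mu qs (phi u).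
Proof. by move=> /phiP[/(D1q_lp q13)]. Qed.

Let lpD u v : W1p p u -> W1p p v -> lp mu qc (fun x => spow s (u x) * v x) /\
  nm mu qc (fun x => spow s (u x) * v x) <= nm mu m u `^ (s - 1) * nm mu m v.
Proof.
move=> Wu Wv; have [lsu nsu] := lp_spow m0 s1 (lpm Wu).
by have [l n] := lp_mul k0 m0 qc0 m_conj lsu (lpm Wv); rewrite -nsu.
Qed.

Let W1p_add u h : W1p p u -> W1p p h -> W1p p (fun x => u x + h x).
Proof.
move=> Wu Wh; have := W1p_lin 1 (ltW p1) Wu Wh.
by rewrite (_ : (fun x => 1 * u x + h x) = (fun x => u x + h x))//; apply/funext => x; rewrite mul1r.
Qed.

(** By [spow_convex] the remainder is at most s times the increment of the derivative times [h], to
    which Hoelder's inequality applies. *)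
Let remainder u h : W1p p u -> W1p p h ->
  let X := nm mu (m / (s - 1)) (fun x => spow s (u x + h x) - spow s (u x)) in
  let rem x := `|u x + h x| `^ s - `|u x| `^ s - s * (spow s (u x) * h x) in
  lp mu qc rem /\ nm mu qc rem <= s * (X * nm mu m h).
Proof.
move=> Wu Wh X rem.
have [l1 _] := lp_spow m0 s1 (lpm Wu); have [l2 _] := lp_spow m0 s1 (lpm (W1p_add Wu Wh)).
have [l3 _] := lp_sub k1 l2 l1.
have [l4 n4] := lp_mul k0 m0 qc0 m_conj l3 (lpm Wh).
have [l5 n5] := lp_scale s qc0 l4.
have [lD _] := lpD Wu Wh; have [lsD _] := lp_scale s qc0 lD.
have [lfg _] := lp_sub (ltW qc1) (lpf (W1p_add Wu Wh)) (lpf Wu).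
have [lr _] := lp_sub (ltW qc1) lfg lsD.
have [|l n] := lp_le qc0 (lp_measurable lr) _ l5.
  move=> x; have /andP[h1 h2] := spow_convex (u x) (h x) s1.
  by rewrite [leLHS]ger0_norm// (le_trans h2)// ler_norm.
split => //; apply: le_trans n _; rewrite n5 gtr0_norm//.
by rewrite ler_wpM2l ?(ltW s0).
Qed.

(** One radius for the derivative, the potential and the datum. The Lipschitz bound on the datum is
    also what brings [dual_sol_continuity] into play. *)
Let local u : W1p p u -> forall e, 0 < e -> exists2 delta, 0 < delta &
  forall h, W1p p h -> nm mu m h < delta ->
  [/\ nm mu (m / (s - 1)) (fun x => spow s (u x + h x) - spow s (u x)) <= e,
      nm mu qs (fun x => phi (fun x => u x + h x) x - phi u x) <= e &
      nm mu qc (fun x => `|u x + h x| `^ s - `|u x| `^ s) <=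
        4 * (s * (nm mu m u `^ (s - 1) + 1)) * nm mu m h].
Proof.
move=> Wu e e0; set K := 4 * _.
have U0 : 0 <= nm mu m u `^ (s - 1) by exact: powR_ge0.
have K0 : 0 < K by rewrite mulr_gt0// mulr_gt0// ltr_wpDl.
(* The increment of the derivative is also kept below 1, so that the + 1 in [K] absorbs the
   remainder. *)
have e10 : 0 < Num.min 1 e by rewrite lt_min ltr01.
have [x x0 Hx] := nemytskii_spow m0 s1 sm (lpm Wu) e10.
have [y y0 Hy] := dual_sol_continuity q13 (lpf Wu) (phiP Wu) e0.
exists (Num.min x (y / K)); first by rewrite lt_min x0 divr_gt0.
move=> h Wh; rewrite lt_min => /andP[n1 n2].
have := Hx h (lpm Wh) n1; rewrite le_min => /andP[X1 Xe].
have Wuh := W1p_add Wu Wh.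
have H : nm mu qc (fun x => `|u x + h x| `^ s - `|u x| `^ s) <= K * nm mu m h.
  have [lr nr] := remainder Wu Wh.
  have [lD nD] := lpD Wu Wh; have [lsD nsD] := lp_scale s qc0 lD.
  have [_] := lp_add (ltW qc1) lr lsD.
  have -> : (fun x => `|u x + h x| `^ s - `|u x| `^ s - s * (spow s (u x) * h x) + s * (spow s (u x) * h x))
      = (fun x => `|u x + h x| `^ s - `|u x| `^ s) by apply/funext => z; rewrite subrK.
  move=> n; apply: le_trans n _; rewrite nsD gtr0_norm//.
  rewrite /K -[X in _ <= X]mulrA ler_wpM2l//.
  have h1 : s * (nm mu (m / (s - 1)) (fun x => spow s (u x + h x) - spow s (u x)) * nm mu m h) <= s * (1 * nm mu m h).
    by rewrite ler_wpM2l ?(ltW s0)// ler_wpM2r ?nm_ge0.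
  have h2 : s * nm mu qc (fun x => spow s (u x) * h x) <= s * (nm mu m u `^ (s - 1) * nm mu m h).
    by rewrite ler_wpM2l ?(ltW s0).
  have -> : s * (nm mu m u `^ (s - 1) + 1) * nm mu m h
      = s * (1 * nm mu m h) + s * (nm mu m u `^ (s - 1) * nm mu m h) by ring.
  exact: lerD (le_trans nr h1) h2.
split => //; apply: (Hy _ _ (lpf Wuh) (phiP Wuh)).
by apply: le_lt_trans H _; rewrite mulrC -ltr_pdivlMr.
Qed.

Let Ipair g w : lp mu qc g -> lp mu qs w -> mu.-integrable setT (EFin \o (fun x => g x * w x)).
Proof. by move=> lg lw; have [] := hoelder1 qc0 qs0 qc_conj lg lw. Qed.

Let Npair g w : lp mu qc g -> lp mu qs w -> `|\int[mu]_x (g x * w x)| <= nm mu qc g * nm mu qs w.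
Proof. exact: hoelder_le. Qed.

Let Ilin a g1 g2 w : lp mu qc g1 -> lp mu qc g2 -> lp mu qs w ->
  \int[mu]_x ((a * g1 x + g2 x) * w x) = a * \int[mu]_x (g1 x * w x) + \int[mu]_x (g2 x * w x).
Proof.
move=> l1 l2 lw; rewrite -(Rint_lin a (Ipair l1 lw) (Ipair l2 lw)).
by apply: eq_Rintegral => x _; ring.
Qed.

Let Ilinr g w1 w2 : lp mu qc g -> lp mu qs w1 -> lp mu qs w2 ->
  \int[mu]_x (g x * (w1 x - w2 x)) = \int[mu]_x (g x * w1 x) - \int[mu]_x (g x * w2 x).
Proof.
move=> lg l1 l2; have := Rint_lin (-1) (Ipair lg l2) (Ipair lg l1).
rewrite mulN1r [X in _ = X]addrC => <-.
by apply: eq_Rintegral => x _; ring.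
Qed.

Let scaled (e K x : R) : 0 < e -> 0 <= K -> 0 <= x -> e / (K + 1) * K * x <= e * x.
Proof.
move=> e0 K0 x0; rewrite ler_wpM2r// mulrAC -mulrA ler_piMr ?(ltW e0)//.
by rewrite ler_pdivrMr ?mul1r ?lerDl// ltr_wpDl.
Qed.

Let nm_small (d : R) h : 0 < d -> W1p p h -> N h < d / (C + 1) -> nm mu m h < d.
Proof.
move=> d0 Wh nh; have C1 : 0 < C + 1 by rewrite ltr_wpDl.
apply: le_lt_trans (nmC Wh) _.
apply: (@le_lt_trans _ _ ((C + 1) * N h)); first by rewrite ler_wpM2r ?normW1p_ge0// lerDl.
by rewrite mulrC -ltr_pdivlMr.
Qed.

Let sandwich (a b c d x y : R) : a <= d -> d <= b -> b - a <= x -> `|a - c| <= y -> `|d - c| <= x + y.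
Proof. by rewrite ler_norml => ? ? ? /andP[? ?]; rewrite ler_norml; apply/andP; split; lra. Qed.

(** [dual_sol_energy] in both directions encloses the difference of energies between the pairings of
    the increment of |u|^s with the old and with the new potential. These differ by a small multiple
    of the norm of [h], and in the former the increment is linearised. *)
Let diff u : W1p p u -> forall e, 0 < e -> exists2 delta, 0 < delta & forall h, W1p p h -> N h < delta ->
  `|(q - 1) / q * \int[mu]_x (`|u x + h x| `^ s * phi (fun x => u x + h x) x)
    - (q - 1) / q * \int[mu]_x (`|u x| `^ s * phi u x)
    - s * \int[mu]_x (spow s (u x) * h x * phi u x)| <= e * N h.
Proof.
move=> Wu e e0; have lp_u := lphi Wu.
pose K := 4 * (s * (nm mu m u `^ (s - 1) + 1)).
have K0 : 0 <= K by rewrite mulr_ge0// mulr_ge0 ?(ltW s0)// addr_ge0// powR_ge0.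
(* [K] is for the gap between the two enclosing terms, the second summand for the linearisation
   error, and [C] passes from L^m to the norm of W^{1,p}. *)
pose B := (K + s * nm mu qs (phi u)) * C.
have B0 : 0 <= B by rewrite mulr_ge0// addr_ge0// mulr_ge0 ?nm_ge0// ltW.
have e'0 : 0 < e / (B + 1) by rewrite divr_gt0// ltr_wpDl.
have [x x0 H] := local Wu e'0.
exists (x / (C + 1)); first by rewrite divr_gt0// ltr_wpDl.
move=> h Wh nh; have [hX hY hG] := H h Wh (nm_small x0 Wh nh); rewrite -/K in hG.
have Wuh := W1p_add Wu Wh; have lp_w := lphi Wuh.
have lf := lpf Wu; have lg := lpf Wuh.
have [lgf _] := lp_sub (ltW qc1) lg lf; have [lfg _] := lp_sub (ltW qc1) lf lg.
have E1 := dual_sol_energy q13 lf lg (phiP Wu) (phiP Wuh).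
have E2 := dual_sol_energy q13 lg lf (phiP Wuh) (phiP Wu).
have E3 : \int[mu]_x ((`|u x| `^ s - `|u x + h x| `^ s) * phi (fun x => u x + h x) x)
   = - \int[mu]_x ((`|u x + h x| `^ s - `|u x| `^ s) * phi (fun x => u x + h x) x).
  rewrite -mulN1r -RintegralZl//; last exact: (Ipair lgf lp_w).
  by apply: eq_Rintegral => z _; ring.
rewrite {}E3 in E2.
have [lr nr] := remainder Wu Wh.
have [lD _] := lpD Wu Wh.
have E4 : \int[mu]_x ((`|u x + h x| `^ s - `|u x| `^ s) * phi u x) - s * \int[mu]_x (spow s (u x) * h x * phi u x)
  = \int[mu]_x ((`|u x + h x| `^ s - `|u x| `^ s - s * (spow s (u x) * h x)) * phi u x).
  have := Ilin (- s) lD lgf lp_u; rewrite mulNr addrC => <-.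
  by apply: eq_Rintegral => z _; ring.
have hx : 0 <= nm mu m h by exact: nm_ge0.
have [lw _] := lp_sub (ltW qs1) lp_w lp_u.
have E5 : \int[mu]_x ((`|u x + h x| `^ s - `|u x| `^ s) * phi (fun x => u x + h x) x)
  - \int[mu]_x ((`|u x + h x| `^ s - `|u x| `^ s) * phi u x) <= K * nm mu m h * (e / (B + 1)).
  rewrite -Ilinr//; apply: le_trans (ler_norm _) _; apply: le_trans (Npair lgf lw) _.
  by apply: ler_pM => //; exact: nm_ge0.
have E6 : `|\int[mu]_x ((`|u x + h x| `^ s - `|u x| `^ s) * phi u x) - s * \int[mu]_x (spow s (u x) * h x * phi u x)|
    <= s * (e / (B + 1) * nm mu m h) * nm mu qs (phi u).
  rewrite E4; apply: le_trans (Npair lr lp_u) _; rewrite ler_wpM2r ?nm_ge0//.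
  by apply: le_trans nr _; rewrite ler_wpM2l ?(ltW s0)// ler_wpM2r.
have E7 : (q - 1) / q * \int[mu]_x (`|u x + h x| `^ s * phi (fun x => u x + h x) x)
    - (q - 1) / q * \int[mu]_x (`|u x| `^ s * phi u x) <=
   \int[mu]_x ((`|u x + h x| `^ s - `|u x| `^ s) * phi (fun x => u x + h x) x).
  by rewrite -lerN2 opprB; exact: E2.
apply: le_trans (sandwich E1 E7 E5 E6) _.
have -> : K * nm mu m h * (e / (B + 1)) + s * (e / (B + 1) * nm mu m h) * nm mu qs (phi u)
  = e / (B + 1) * ((K + s * nm mu qs (phi u)) * nm mu m h) by ring.
apply: le_trans (scaled e0 B0 (normW1p_ge0 p h)).
rewrite -[X in _ <= X]mulrA ler_wpM2l ?(ltW e'0)// /B -mulrA ler_wpM2l ?nmC//.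
by rewrite addr_ge0// mulr_ge0 ?nm_ge0// ltW.
Qed.

Let tri (a b c x y z : R) : `|a| <= x -> `|b| <= y -> `|c| <= z -> `|a + b + c| <= x + y + z.
Proof.
move=> ha hb hc; apply: le_trans (ler_normD _ _) _; rewrite lerD//.
by apply: le_trans (ler_normD _ _) _; rewrite lerD.
Qed.

Let cont u : W1p p u -> deriv_cont (W1p p) N
  (fun u v => s * \int[mu]_x (spow s (u x) * v x * phi u x)) u.
Proof.
move=> Wu e e0; have lp_u := lphi Wu.
pose U := nm mu m u `^ (s - 1); pose P := nm mu qs (phi u).
have U0 : 0 <= U by exact: powR_ge0.
have P0 : 0 <= P by exact: nm_ge0.
pose B := s * (P + 1 + U) * C.
have B0 : 0 <= B by rewrite !mulr_ge0 ?(ltW s0)// !addr_ge0.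
have e'0 : 0 < Num.min 1 (e / (B + 1)) by rewrite lt_min ltr01 divr_gt0// ltr_wpDl.
have [x x0 H] := local Wu e'0.
exists (x / (C + 1)); first by rewrite divr_gt0// ltr_wpDl.
move=> w Ww nw v Wv.
have Ed : (fun x => w x - u x) = (fun x => -1 * u x + w x) by apply/funext => z; rewrite mulN1r addrC.
have Wh : W1p p (fun x => w x - u x) by rewrite Ed; exact: (W1p_lin (-1) (ltW p1) Wu Ww).
have [hX hY _] := H _ Wh (nm_small x0 Wh nw).
have Ew : (fun x => u x + (w x - u x)) = w by apply/funext => z; rewrite addrC subrK.
rewrite {}Ew in hY.
have {}hX : nm mu (m / (s - 1)) (fun x => spow s (w x) - spow s (u x)) <= Num.min 1 (e / (B + 1)).
  move: hX; rewrite (_ : (fun x => spow s (u x + _) - _) = (fun x => spow s (w x) - spow s (u x)))//.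
  by apply/funext => z; rewrite [u z + _]addrC subrK.
set e' := Num.min 1 _ in hX hY e'0.
have e'1 : e' <= 1 by rewrite ge_min lexx.
have e'e : e' <= e / (B + 1) by rewrite ge_min lexx orbT.
have lp_w := lphi Ww.
have [lsu _] := lp_spow m0 s1 (lpm Wu); have [lsw _] := lp_spow m0 s1 (lpm Ww).
have [ls _] := lp_sub k1 lsw lsu.
have [lsv nsv] := lp_mul k0 m0 qc0 m_conj ls (lpm Wv).
have [lD nD] := lpD Wu Wv; have [lDw _] := lpD Ww Wv.
have [lw _] := lp_sub (ltW qs1) lp_w lp_u.
have V0 : 0 <= nm mu m v by exact: nm_ge0.
have nsv' : nm mu qc (fun x => (spow s (w x) - spow s (u x)) * v x) <= e' * nm mu m v.
  by apply: le_trans nsv _; rewrite ler_wpM2r.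
have T1 : `|\int[mu]_x ((spow s (w x) - spow s (u x)) * v x * phi u x)| <= e' * nm mu m v * P.
  by apply: le_trans (Npair lsv lp_u) _; rewrite ler_wpM2r.
(* Of the two small factors one is merely bounded by 1, so that all three terms are linear in
   [e']. *)
have T2 : `|\int[mu]_x ((spow s (w x) - spow s (u x)) * v x * (phi w x - phi u x))| <= e' * nm mu m v * 1.
  apply: le_trans (Npair lsv lw) _; apply: ler_pM; rewrite ?nm_ge0//.
  exact: le_trans hY e'1.
have T3 : `|\int[mu]_x (spow s (u x) * v x * (phi w x - phi u x))| <= U * nm mu m v * e'.
  by apply: le_trans (Npair lD lw) _; apply: ler_pM; rewrite ?nm_ge0.
(* The pattern a'b' - ab = (a' - a)b + (a' - a)(b' - b) + a(b' - b), with b the potential and a the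
   factor of the derivative that depends on u. *)
have E : \int[mu]_x (spow s (w x) * v x * phi w x) - \int[mu]_x (spow s (u x) * v x * phi u x) =
  \int[mu]_x ((spow s (w x) - spow s (u x)) * v x * phi u x)
  + \int[mu]_x ((spow s (w x) - spow s (u x)) * v x * (phi w x - phi u x))
  + \int[mu]_x (spow s (u x) * v x * (phi w x - phi u x)).
  rewrite (Ilinr lsv lp_w lp_u) (Ilinr lD lp_w lp_u).
  have G : \int[mu]_x ((spow s (w x) - spow s (u x)) * v x * phi w x) =
      -1 * \int[mu]_x (spow s (u x) * v x * phi w x) + \int[mu]_x (spow s (w x) * v x * phi w x).
    rewrite -(Ilin (-1) lD lDw lp_w); apply: eq_Rintegral => z _; ring.
  by rewrite G; ring.
rewrite -mulrBr normrM gtr0_norm// E.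
apply: (@le_trans _ _ (s * (e' * nm mu m v * P + e' * nm mu m v * 1 + U * nm mu m v * e'))).
  by rewrite ler_wpM2l ?(ltW s0)// tri.
have -> : s * (e' * nm mu m v * P + e' * nm mu m v * 1 + U * nm mu m v * e') =
   e' * (s * (P + 1 + U) * nm mu m v) by ring.
apply: le_trans (scaled e0 B0 (normW1p_ge0 p v)).
rewrite -[X in _ <= X]mulrA; apply: ler_pM => //.
- exact: ltW.
- by rewrite !mulr_ge0 ?(ltW s0)// !addr_ge0.
- by rewrite /B -[X in _ <= X]mulrA ler_wpM2l ?nmC// mulr_ge0 ?(ltW s0)// !addr_ge0.
Qed.

Lemma C1_with_nonlocal : C1_with (W1p p) N
  (fun u => (q - 1) / q * \int[mu]_x (`|u x| `^ s * phi u x))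
  (fun u v => s * \int[mu]_x (spow s (u x) * v x * phi u x)).
Proof.
move=> u Wu; split; last exact: cont.
have lp_u := lphi Wu; split; last exact: diff.
- move=> a v w Wv Ww; have [lv _] := lpD Wu Wv; have [lw _] := lpD Wu Ww.
  rewrite mulrCA -mulrDr -(Ilin a lv lw lp_u); congr (_ * _).
  by apply: eq_Rintegral => x _; ring.
- exists (s * (nm mu m u `^ (s - 1) * C * nm mu qs (phi u))) => v Wv.
  have [lv nv] := lpD Wu Wv; rewrite normrM gtr0_norm// -mulrA ler_wpM2l ?(ltW s0)//.
  apply: le_trans (Npair lv lp_u) _; rewrite [X in _ <= X]mulrAC ler_wpM2r ?nm_ge0//.
  apply: le_trans nv _; rewrite -[X in _ <= X]mulrA ler_wpM2l ?powR_ge0//; exact: nmC.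
Qed.

End NonlocalTerm.

Theorem proposition2p3 (R : realType) (p q s r lambda : R)
    (phi : (R3 R -> R) -> R3 R -> R) :
  1 < p < 3 ->
  Num.max 1 (3 * p / (5 * p - 3)) < q < 3 ->
  Num.max 1 ((sobolev_exp q - 1) * p / sobolev_exp q) < s
    < (sobolev_exp q - 1) * sobolev_exp p / sobolev_exp q ->
  p < r < sobolev_exp p ->
  0 < lambda ->
  (forall u, W1p p u -> weak_solution q s u (phi u)) ->
  let J u : R :=
    p^-1 * \int[leb3 R]_x (enorm (wgrad u x) `^ p + `|u x| `^ p)
    + lambda * (q - 1) / (q * s) * \int[leb3 R]_x (phi u x * `|u x| `^ s)
    - r^-1 * \int[leb3 R]_x (`|u x| `^ r) in
  C1_on (W1p p) (normW1p p) J /\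
  forall u, W1p p u ->
    frechet_derivative (W1p p) (normW1p p) J u (fun v =>
      \int[leb3 R]_x (enorm (wgrad u x) `^ (p - 2)
                        * edot (wgrad u x) (wgrad v x)
                      + `|u x| `^ (p - 2) * u x * v x)
      + lambda * \int[leb3 R]_x (phi u x * `|u x| `^ (s - 2) * u x * v x)
      - \int[leb3 R]_x (`|u x| `^ (r - 2) * u x * v x)).
Proof.
move=> p13 /andP[+ q3]; rewrite gt_max => /andP[q1 _] /andP[+ s2].
rewrite gt_max => /andP[s1 ps] /andP[pr rs] l0 phiP J.
have q13 : 1 < q < 3 by rewrite q1.
have [p1 p3] := andP p13.
have p0 : 0 < p by exact: lt_trans p1.
have r1 : 1 < r by exact: lt_trans pr.
have r0 : 0 < r by exact: lt_trans r1.
have q0 : 0 < q by exact: lt_trans q1.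
have s0 : 0 < s by exact: lt_trans s1.
(* The product measure of the statement under the name for which the results above are proved. *)
pose mu := @mu3 R.
pose qs := sobolev_exp q; pose qc := qs / (qs - 1).
have qs1 : 1 < qs by exact: sobolev_exp_ge1.
have qs0 : 0 < qs by exact: lt_trans qs1.
have qs10 : 0 < qs - 1 by rewrite subr_gt0.
(* The two bounds on [s], multiplied by the conjugate exponent [qc] of q^*. *)
have pm : p <= s * qc < sobolev_exp p.
  have e x : (qs - 1) * x / qs * qc = x by rewrite /qc; field; rewrite !gt_eqF.
  have qc0 : 0 < qc by rewrite divr_gt0.
  by rewrite -{1}(e p) -(e (sobolev_exp p)) ltr_pM2r// s2 andbT ler_pM2r// ltW.
have dsol u : W1p p u -> dual_sol q (fun x => `|u x| `^ s) (phi u).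
  move=> /phiP[dphi H]; split => // w dw.
  have := H w dw; rewrite -/mu => <-; apply: eq_Rintegral => x _.
  by rewrite /vpow edotZl.
have Wlin a v w : W1p p v -> W1p p w -> W1p p (fun x => a * v x + w x).
  exact/W1p_lin/ltW.
have N0 := @normW1p_ge0 R p.
have [Cr Cr0 HCr] := @sobolev_embedding R p r p13 ltac:(by rewrite (ltW pr) rs).
have lin_svec (a : R) (v w : R3 R -> R) :
    {ae mu, forall x, svec (a * v x + w x) = a *: svec (v x) + svec (w x)}.
  by apply: aeW => x; rewrite svecD /svec scalerA.
have H1 := @C1_with_power _ _ _ mu (W1p p) (normW1p p) p 1 (@wgrad R) N0 Wlin p1 ler01
  (fun u Wu => W1p_lpv p0 Wu)
  (fun u Wu => le_trans (nm_wgrad_le_normW1p p0 Wu) (eq_ple (esym (mul1r _))))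
  (fun a v w Wv Ww => let: And3 _ dv _ := Wv in let: And3 _ dw _ := Ww in wgrad_lin a dv dw).
have H2 := @C1_with_power _ _ _ mu (W1p p) (normW1p p) p 1 (fun u x => svec (u x)) N0 Wlin p1 ler01
  (fun u Wu => lpv_svec p0 (W1p_lp p0 Wu))
  (fun u Wu => le_trans (eq_ple (nm_svec mu p u)) (le_trans (nm_le_normW1p p0 Wu) (eq_ple (esym (mul1r _)))))
  (fun a v w _ _ => lin_svec a v w).
have H3 := @C1_with_power _ _ _ mu (W1p p) (normW1p p) r Cr (fun u x => svec (u x)) N0 Wlin r1 Cr0
  (fun u Wu => lpv_svec r0 (HCr u Wu).1)
  (fun u Wu => le_trans (eq_ple (nm_svec mu r u)) (HCr u Wu).2)
  (fun a v w _ _ => lin_svec a v w).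
have H4 := C1_with_nonlocal p13 q13 s1 pm dsol.
(* [H4] concerns (q - 1)/q int phi_u |u|^s, whose derivative carries a factor [s]; the coefficient
   [lambda / s] yields those of [J] and of its derivative. *)
have H := C1_with_add (C1_with_add (C1_with_add H1 H2) (C1_with_scale N0 (lambda / s) H4))
  (C1_with_scale N0 (-1) H3).
pose D u v : R := \int[mu]_x (enorm (wgrad u x) `^ (p - 2) * edot (wgrad u x) (wgrad v x)
                      + `|u x| `^ (p - 2) * u x * v x)
      + lambda * \int[mu]_x (phi u x * `|u x| `^ (s - 2) * u x * v x)
      - \int[mu]_x (`|u x| `^ (r - 2) * u x * v x).
have HJ : C1_with (W1p p) (normW1p p) J D.
  apply: (C1_with_ext Wlin _ _ H) => [u Wu|u v Wu Wv].
    (* [J] has the gradient and the function under one integral, [H] has them in two; integrability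
       of each term justifies the splitting. *)
    have e1 : \int[mu]_x (enorm (wgrad u x) `^ p + `|u x| `^ p) =
        \int[mu]_x (enorm (wgrad u x) `^ p) + \int[mu]_x (`|u x| `^ p).
      exact: Rint_add (nrm_powR_integrable (W1p_lpv p0 Wu)) (lp_integrable (W1p_lp p0 Wu)).
    have e2 t : \int[mu]_x (enorm (svec (u x)) `^ t) = \int[mu]_x (`|u x| `^ t).
      by apply: eq_Rintegral => x _; rewrite enorm_svec.
    have e3 : \int[mu]_x (`|u x| `^ s * phi u x) = \int[mu]_x (phi u x * `|u x| `^ s).
      by apply: eq_Rintegral => x _; rewrite mulrC.
    rewrite !e2 e3 /J -/mu e1 mulrDr mulN1r; congr (_ + _ - _).
    by rewrite invfM; ring.
  have p'0 : 0 < p / (p - 1) by rewrite divr_gt0// subr_gt0.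
  have conj : (p / (p - 1))^-1 + p^-1 = 1 by field; rewrite !gt_eqF// subr_gt0.
  have [lV _] := lpv_vpow p0 p1 (W1p_lpv p0 Wu).
  have [lS _] := lpv_vpow p0 p1 (lpv_svec p0 (W1p_lp p0 Wu)).
  have [I1 _] := lp_edot p'0 p0 conj lV (W1p_lpv p0 Wv).
  have [I2 _] := lp_edot p'0 p0 conj lS (lpv_svec p0 (W1p_lp p0 Wv)).
  rewrite /D -(Rint_add I1 I2) mulN1r; congr (_ + _ - _).
  - by apply: eq_Rintegral => x _; rewrite vpow_svec edot_svec /vpow edotZl /spow; ring.
  - rewrite mulrA divfK ?gt_eqF//; congr (_ * _).
    by apply: eq_Rintegral => x _; rewrite /spow; ring.
  - by apply: eq_Rintegral => x _; rewrite vpow_svec edot_svec /spow; ring.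
split; first exact: C1_with_on HJ.
by move=> u Wu; have [] := HJ u Wu.
Qed.
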